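(* Let $d\in\mathbb N$, and put $\eta:=1/q-1/2$. Then $$ \sigma_m(\mathbf W^r_q)_{\infty} \ll \begin{cases} m^{-r+\eta}(\log m)^{(d-1)(r-2\eta)+1/2}, & 1<q\le 2,\quad r>1/q,\\ m^{-r}(\log m)^{r(d-1)+1/2}, & 2\le q<\infty, \quad r>1/2.\end{cases} $$
   Context: $\mathbb T^d=[0,2\pi)^d$ (functions are $2\pi$-periodic in each variable) carries the normalized Lebesgue measure $(2\pi)^{-d}d\mathbf x$; $\|\cdot\|_p$ is the norm of $L_p=L_p(\mathbb T^d)$, $\|\cdot\|_\infty$ is the uniform norm, and convolution is $(f\ast g)(\mathbf x)=(2\pi)^{-d}\int_{\mathbb T^d}f(\mathbf y)g(\mathbf x-\mathbf y)\,d\mathbf y$. For $r>0$ let $F_r(x):=1+2\sum_{k=1}^\infty k^{-r}\cos(kx-r\pi/2)$ (univariate), $F_r(\mathbf x):=\prod_{j=1}^d F_r(x_j)$ for $\mathbf x=(x_1,\dots,x_d)$, and $$\mathbf W^r_q:=\{f: f=\varphi\ast F_r,\ \|\varphi\|_q\le 1\}.$$ Best $m$-term trigonometric approximation: $$\sigma_m(f)_\infty:=\inf\Big\{\Big\|f-\sum_{j=1}^m c_je^{i(\mathbf k^j,\mathbf x)}\Big\|_\infty:\ \mathbf k^j\in\mathbb Z^d,\ c_j\in\mathbb C\Big\},\qquad \sigma_m(\mathbf W)_\infty:=\sup_{f\in\mathbf W}\sigma_m(f)_\infty .$$ $a_m\ll b_m$ means $a_m\le Cb_m$ for all integers $m\ge2$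 with $C>0$ independent of $m$ (it may depend on $r,q,d$). *)

(* Defs.v *)
From HB Require Import structures.
From mathcomp Require Import all_boot all_order all_algebra.
From mathcomp Require Import all_classical all_reals all_analysis.
From mathcomp Require Import complex.

Set Implicit Arguments.
Unset Strict Implicit.
Unset Printing Implicit Defensive.

Import Order.TTheory GRing.Theory Num.Theory.
Import numFieldNormedType.Exports.
Import ComplexField Normc.

Local Open Scope classical_set_scope.
Local Open Scope ring_scope.
Local Open Scope complex_scope.

(* R^d with the product of the Borel sigma-algebras.  Functions on the torus
   are functions on R^d that are 2 pi-periodic in each variable. *)
Notation Rn R d := (d.-tuple (measurableTypeR R)).

Section torus_measure.
Variable R : realType.

Lemma twopi_gt0 : 0 < pi *+ 2 :> R.
Proof. by rewrite mulrn_wgt0// pi_gt0. Qed.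

Definition cons_pair d (p : measurableTypeR R * Rn R d) : Rn R d.+1 :=
  [tuple of p.1 :: p.2].

Lemma measurable_cons_pair d : measurable_fun [set: _] (@cons_pair d).
Proof. exact: measurable_cons. Qed.

HB.instance Definition _ d := isMeasurableFun.Build _ _ _ _
  (@cons_pair d) (@measurable_cons_pair d).

(* The d-fold product of the uniform probability on [0, 2 pi], transported
   from nested pairs to tuples.  It is (2 pi)^-d times Lebesgue measure on the
   cube [0, 2 pi]^d, which differs from [0, 2 pi)^d by a null set, and it
   vanishes off the cube, so that integrals over the torus are integrals over
   the whole of R^d for this measure. *)
Fixpoint torus_measure (d : nat) : probability (Rn R d) R :=
  match d with
  | 0 => dirac ([tuple] : Rn R 0)
  | d'.+1 => distribution (uniform_prob twopi_gt0 \x torus_measure d')%E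
               (@cons_pair d')
  end.

End torus_measure.

Section functions_on_torus.
Variables (R : realType) (d : nat).
Implicit Types (f g phi : Rn R d -> R[i]) (x y : Rn R d).

Definition shift2pi x (j : 'I_d) : Rn R d :=
  [tuple tnth x l + (if l == j then pi *+ 2 else 0) | l < d].

Definition periodic2pi f := forall x j, f (shift2pi x j) = f x.

Definition Cmeasurable f :=
  measurable_fun [set: Rn R d] (fun x => complex.Re (f x)) /\
  measurable_fun [set: Rn R d] (fun x => complex.Im (f x)).

Definition Cintegral f : R[i] :=
  (\int[torus_measure R d]_x complex.Re (f x)) +i*
  (\int[torus_measure R d]_x complex.Im (f x)).

Definition Lqnorm (q : R) f : \bar R :=
  ('N[torus_measure R d]_(q%:E)[(fun x => (normc (f x))%:E)])%E.

(* The uniform norm is a genuine supremum, not an essential one. *)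
Definition unorm f : \bar R :=
  ereal_sup [set (normc (f x))%:E | x in [set: Rn R d]].

Definition conv f g x : R[i] :=
  Cintegral (fun y => f y * g [tuple tnth x l - tnth y l | l < d]).

(* e^{i (k, x)} *)
Definition cexp (k : d.-tuple int) x : R[i] :=
  let t := \sum_(l < d) (tnth k l)%:~R * tnth x l in cos t +i* sin t.

End functions_on_torus.

Section classes.
Variable R : realType.

(* For 0 < r <= 1 the series converges only conditionally and may diverge at
   the points of 2 pi Z, where the limit operator then returns 0; this null
   set does not affect the convolutions below. *)
Definition F1 (r t : R) : R :=
  1 + 2 * limn (fun n : nat =>
    \sum_(1 <= k < n) k%:R `^ (- r) * cos (k%:R * t - r * pi / 2)).

Definition F d (r : R) (x : Rn R d) : R[i] :=
  (\prod_(j < d) F1 r (tnth x j))%:C.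

Definition W d (r q : R) : set (Rn R d -> R[i]) :=
  [set f | exists phi : Rn R d -> R[i],
    [/\ Cmeasurable phi, periodic2pi phi, (Lqnorm q phi <= 1)%E
      & f = conv phi (@F d r)]].

Definition sigma d (m : nat) (f : Rn R d -> R[i]) : \bar R :=
  ereal_inf [set e | exists (k : 'I_m -> d.-tuple int) (c : 'I_m -> R[i]),
    e = unorm (fun x => f x - \sum_(j < m) c j * cexp (k j) x)].

Definition sigma_class d (m : nat) (A : set (Rn R d -> R[i])) : \bar R :=
  ereal_sup [set sigma m f | f in A].

(* a_m << b_m *)
Definition lesssim (a : nat -> \bar R) (b : nat -> R) :=
  exists2 C : R, 0 < C & forall m, (2 <= m)%N -> (a m <= (C * b m)%:E)%E.

End classes.

(* Main.v *)
(** Since [L_q] is contained in [L_2] for [q >= 2], it suffices to treat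
    [1 < q <= 2].  Group the frequencies into hyperbolic layers
    [{k | sum_j l(k_j) = n}], of cardinality [O(2^n n^(d-1))], where [l(a)] is
    the number of binary digits of [|a|].

    1. Let [g] be a trigonometric polynomial with spectrum in the layer [n] and
    coefficients bounded by [1].  The Fourier coefficients of products of [j]
    such polynomials are controlled by the product weights
    [prod_i 2^(-(1 - j eps) l(k_i))], which are stable under convolution with
    one more layer; this bounds the even moments of [g], hence all moments
    [p >= 2] since [|g|^p <= A^(p-2) |g|^2 + A^(p-2m) |g|^(2m)].  By duality,
    [phi] in the unit ball of [L_q] has Fourier coefficients with
    [sum_(layer n) |phi^(k)| << 2^(n/q) n^((d-1)(1-1/q))].

    2. Hence [f = phi * F_r] is the sum of its layers, the [n]-th one having
    Wiener norm [<< 2^(-n(r-1/q)) n^((d-1)(1-1/q))].  The partial sums of the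
    kernel converge almost everywhere (Dirichlet's test), and dominated
    convergence identifies [f] with the sum at every point.

    3. A polynomial with frequencies at most [2^n] and Wiener norm [1] is
    within [C (n/m)^(1/2)] of an [m]-term one in the uniform norm: average
    signed exponentials on a fine grid, chosen greedily for an exponential
    potential.

    4. With [2^N N^(d-1)] of order [m], keep the layers [n < N] entirely and
    use step 3 on the layer [n >= N] with [m 2^(-(r-1/q)(n-N))] terms. *)
Require Import Defs.
From mathcomp Require Import all_boot all_order all_algebra.
From mathcomp Require Import all_classical all_reals all_analysis.
From mathcomp Require Import measurable_realfun complex ring lra zify.
Set Implicit Arguments.
Unset Strict Implicit.
Unset Printing Implicit Defensive.
Import Order.TTheory GRing.Theory Num.Theory.
Import numFieldNormedType.Exports.
Import ComplexField Normc.
Local Open Scope classical_set_scope.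
Local Open Scope ring_scope.
Local Open Scope complex_scope.

(** * Dyadic layers of integer frequencies *)

(** The powers of the logarithm shape the proof. In step 1 the dual bound is proved on one layer at
    a time, where the moments cost the factor [n^(d-1)] only once. It is stated for the integral of
    [|phi| |g|], not for the modulus of the integral of [phi g], because the same bound must also
    provide an integrable majorant in step 2. A majorant is needed since the series of [F_r] may
    converge only conditionally while the uniform norm asks for every point. The partial kernels are
    products over cubes [|k_j| < 2^N], to which one-dimensional convergence applies; the difference
    of consecutive cubes meets only layers of level above [N], to which the estimates apply.

    In step 4 put [V = 2^N N^(d-1)]. The layer [N] contributes [2^(-N(r-1/q)) N^((d-1)(1-1/q))
    (N/V)^(1/2)], and replacing [2^-N] by [N^(d-1)/V] yields the power [(d-1)(r-2eta) + 1/2] of the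
    logarithm, the [1/2] being the price of controlling all grid points at once. In statements at
    dimension [d.+1], the letter [d] stands for what is [d-1] above. *)

Definition level1 (k : int) : nat :=
  if k == 0 then 0%N else (trunc_log 2 `|k|%N).+1.

Definition shell1 (s : nat) : seq int :=
  if s is s'.+1 then
    [seq j%:Z | j <- iota (2 ^ s') (2 ^ s')] ++
    [seq - (j%:Z) | j <- iota (2 ^ s') (2 ^ s')]
  else [:: 0].

Lemma level1_le (k : int) n : (level1 k <= n)%N = (`|k| < 2 ^ n)%N.
Proof.
rewrite /level1; case: eqP => [->|/eqP k0].
  by rewrite absz0 leq0n expn_gt0.
have k1 : (0 < `|k|)%N by rewrite absz_gt0.
have /andP[lb ub] := trunc_log_bounds (isT : (1 < 2)%N) k1.
apply/idP/idP => [h|h].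
  by apply: leq_trans ub _; rewrite leq_exp2l.
rewrite ltnNge; apply/negP => h'.
by move: (leq_ltn_trans lb h); rewrite ltn_exp2l // ltnNge h'.
Qed.

Lemma level1N k : level1 (- k) = level1 k.
Proof. by rewrite /level1 oppr_eq0 abszN. Qed.

Lemma level1_bound (k : int) : (`|k| < 2 ^ level1 k)%N.
Proof. by rewrite -level1_le. Qed.

Lemma level1S (k : int) n :
  (level1 k == n.+1)%N = (2 ^ n <= `|k| < 2 ^ n.+1)%N.
Proof. by rewrite eqn_leq [(n < _)%N]ltnNge !level1_le -leqNgt andbC. Qed.

(** An addition carries at most one binary digit. *)
Lemma level1_split (a b : int) :
  (level1 a <= (maxn (level1 b) (level1 (a - b))).+1)%N.
Proof.
set m := maxn _ _; rewrite level1_le.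
have hb : (`|b| < 2 ^ m)%N by rewrite -level1_le leq_maxl.
have hc : (`|a - b| < 2 ^ m)%N by rewrite -level1_le leq_maxr.
rewrite expnS; move: (2 ^ m)%N hb hc; lia.
Qed.

Lemma mem_shell1 s k : (k \in shell1 s) = (level1 k == s).
Proof.
case: s => [|s].
  rewrite inE /level1; case: eqP => [//|_]; by [].
rewrite level1S mem_cat; apply/orP/andP => [|[h1 h2]].
  case=> /mapP[j]; rewrite mem_iota => /andP[h1 h2] ->;
  rewrite ?abszN absz_nat; split => //; rewrite expnS; lia.
have h3 : (`|k| \in iota (2 ^ s) (2 ^ s))%N.
  by rewrite mem_iota h1 /=; move: h2; rewrite expnS; lia.
case: (lerP 0 k) => k0.
  by left; apply/mapP; exists `|k|%N => //; rewrite gez0_abs.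
by right; apply/mapP; exists `|k|%N => //; lia.
Qed.

Lemma size_shell1 s : size (shell1 s) = (2 ^ s)%N.
Proof.
case: s => [|s] //=.
by rewrite size_cat !size_map size_iota expnS mul2n addnn.
Qed.

Lemma uniq_shell1 s : uniq (shell1 s).
Proof.
case: s => [|s] //=.
rewrite cat_uniq !map_inj_uniq ?iota_uniq ?andbT /=; last 2 first.
  by move=> i j /oppr_inj [].
  by move=> i j [].
apply/hasPn => _ /mapP[j hj ->]; apply/negP => /mapP[i hi].
move: hi hj; rewrite !mem_iota => /andP[i1 _] /andP[j1 _] /eqP.
have : (0 < 2 ^ s)%N by rewrite expn_gt0.
lia.
Qed.

Definition box1 N : seq int := flatten [seq shell1 s | s <- iota 0 N.+1].

Lemma mem_box1 N k : (k \in box1 N) = (level1 k <= N)%N.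
Proof.
apply/flatten_mapP/idP => [[s]|h].
  by rewrite mem_iota mem_shell1 => hs /eqP ->; lia.
by exists (level1 k); rewrite ?mem_shell1 // mem_iota; lia.
Qed.

(** The lists [f x] are disjoint because [g] recovers [x] from any member. *)
Lemma uniq_flatten_map (S T : eqType) (f : S -> seq T) (g : T -> S)
  (s : seq S) : uniq s -> (forall x, uniq (f x)) ->
  (forall x y, y \in f x -> g y = x) ->
  uniq (flatten [seq f x | x <- s]).
Proof.
move=> us uf h; elim: s us => [//|x s IH] /= /andP[xs us].
rewrite cat_uniq uf IH // andbT /=.
apply/hasPn => y /flatten_mapP[z zs yz]; apply/negP => yx.
by move: xs; rewrite -(h _ _ yx) (h _ _ yz) zs.
Qed.

Lemma uniq_box1 N : uniq (box1 N).
Proof.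
apply: (@uniq_flatten_map _ _ _ level1); rewrite ?iota_uniq //.
  exact: uniq_shell1.
by move=> s k; rewrite mem_shell1 => /eqP.
Qed.

Lemma sum_box1 (V : nmodType) N (F : int -> V) :
  \sum_(b <- box1 N) F b = \sum_(s < N.+1) \sum_(b <- shell1 s) F b.
Proof.
rewrite /box1 big_flatten big_map.
by rewrite -(big_mkord xpredT (fun s => \sum_(b <- shell1 s) F b)) /index_iota subn0.
Qed.

Lemma sum_box1_level (R : pzRingType) N (G : nat -> R) :
  \sum_(b <- box1 N) G (level1 b) = \sum_(s < N.+1) 2 ^+ s * G s.
Proof.
rewrite sum_box1; apply: eq_bigr => s _.
rewrite (eq_big_seq (fun=> G s)); last first.
  by move=> b; rewrite mem_shell1 => /eqP ->.
by rewrite big_const_seq count_predT size_shell1 iter_addr_0 -natrX mulr_natl.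
Qed.

Lemma maxn_pred_le t u v :
  (t <= (maxn u v).+1)%N -> (u <= v)%N -> (maxn t.-1 u <= v)%N.
Proof. by lia. Qed.

(** * Geometric sums and convolution of dyadic weights on the integers *)

Section RealSums.
Variable R : realFieldType.
Implicit Types x y z : R.

Lemma ler_sum_sub (I : eqType) (s t : seq I) (F : I -> R) :
  uniq s -> {subset s <= t} -> (forall i, 0 <= F i) ->
  \sum_(i <- s) F i <= \sum_(i <- t) F i.
Proof.
elim: s t => [|i s IH] t /=; first by move=> _ _ F0; rewrite big_nil sumr_ge0.
move=> /andP[is' us] st F0.
have it : i \in t by apply: st; rewrite inE eqxx.
rewrite big_cons (perm_big _ (perm_to_rem it)) big_cons lerD2l.
apply: IH => // j js.
have : j \in t by apply: st; rewrite inE js orbT.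
rewrite (perm_mem (perm_to_rem it)) inE => /orP[/eqP ji|//].
by rewrite -ji js in is'.
Qed.

(** The exponent is the distance of [s] and [m]: one of the two truncated differences always
    vanishes. *)
Lemma sum_geo_dist z (m B : nat) : 0 < z < 1 ->
  \sum_(s < B) z ^+ ((s - m) + (m - s)) <= 2 / (1 - z).
Proof.
move=> /andP[z0 z1]; have z1' : 0 < 1 - z by rewrite subr_gt0.
(* The sharper bound is the value of the full series over all [s], which is what an induction on [m]
   can carry. *)
suff : \sum_(s < B) z ^+ ((s - m) + (m - s)) <= (1 + z - z ^+ m.+1) / (1 - z).
  move/le_trans; apply; rewrite ler_pM2r ?invr_gt0 //.
  by have := exprn_gt0 m.+1 z0; lra.
elim: m B => [|m IH] B.
  rewrite expr1 addrK; under eq_bigr do rewrite subn0 addn0.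
  rewrite ler_pdivlMr //.
  have := subrX1 z B; have := exprn_gt0 B z0.
  set S := \sum_(i < B) _; move=> h1 h2.
  have -> : S * (1 - z) = 1 - z ^+ B by rewrite -[1 - z ^+ B]opprB h2; ring.
  lra.
case: B => [|B].
  rewrite big_ord0; apply: divr_ge0; last lra.
  have : z ^+ m.+2 <= 1 by apply: exprn_ile1; lra.
  lra.
rewrite big_ord_recl /= sub0n add0n subn0.
under eq_bigr do rewrite /bump leq0n add1n !subSS.
apply: (le_trans (lerD (lexx _) (IH B))).
rewrite -[X in X + _](@mulfK _ (1 - z)) ?gt_eqF // -mulrDl.
rewrite ler_pM2r ?invr_gt0 // !exprS; set w := z ^+ m; lra.
Qed.

Lemma sum_geo_tail z (N M : nat) : 0 < z < 1 ->
  \sum_(n < M | (N <= n)%N) z ^+ n <= z ^+ N / (1 - z).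
Proof.
move=> /andP[z0 z1]; have z1' : 0 < 1 - z by rewrite subr_gt0.
elim: N M => [|N IH] M.
  rewrite ler_pdivlMr // expr0.
  have -> : (\sum_(n < M | (0 <= n)%N) z ^+ n) * (1 - z) = 1 - z ^+ M.
    by rewrite -[1 - z ^+ M]opprB subrX1 -mulNr opprB mulrC.
  by rewrite lerBlDr lerDl exprn_ge0 // ltW.
case: M => [|M]; first by rewrite big_ord0 divr_ge0 ?exprn_ge0 // ltW.
rewrite big_mkcond big_ord_recl /= add0r -big_mkcond /=.
rewrite (eq_bigr (fun n : 'I_M => z * z ^+ n)); last by move=> n _; rewrite -exprS.
under eq_bigl do rewrite /bump leq0n add1n ltnS.
by rewrite -mulr_sumr exprS -mulrA ler_pM2l // IH.
Qed.

(** The terms grow with ratio [2 y] up to [s = m] and decay with ratio [2 x y] afterwards, so the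
    sum is comparable to its peak [(2 x y)^m]; [z] is the slower of the two rates of decay away from
    the peak. *)
Lemma sum_max_geo x y : 0 < x <= 1 -> 1 < 2 * y -> 2 * x * y < 1 ->
  exists2 C, 0 < C & forall m B : nat,
  \sum_(s < B) 2 ^+ s * (x ^+ maxn m s * y ^+ s) <= C * (2 * x * y) ^+ m.
Proof.
move=> /andP[x0 x1] y1 xy1.
have y0 : 0 < y by lra.
have xy0 : 0 < 2 * x * y by rewrite !mulr_gt0.
set z := Num.max (2 * y)^-1 (2 * x * y).
have z01 : 0 < z < 1.
  rewrite lt_max xy0 orbT gt_max xy1 andbT.
  by rewrite invf_lt1 // mulr_gt0.
exists (2 / (1 - z)).
  by rewrite divr_gt0 // subr_gt0; case/andP: z01.
move=> m B.
apply: le_trans (_ : (2 * x * y) ^+ m *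
  \sum_(s < B) z ^+ ((s - m) + (m - s)) <= _); last first.
  rewrite mulrC ler_wpM2r ?exprn_ge0 // ?(ltW xy0) //; exact: sum_geo_dist.
rewrite mulr_sumr ler_sum // => s _.
have z0 : 0 <= z by case/andP: z01 => /ltW.
case: (leqP m s) => ms.
  have /eqP -> : (m - s == 0)%N by rewrite subn_eq0.
  rewrite addn0.
  have -> : 2 ^+ s * (x ^+ s * y ^+ s) = (2 * x * y) ^+ m * (2 * x * y) ^+ (s - m).
    by rewrite -exprD subnKC // !exprMn mulrA.
  rewrite ler_wpM2l ?exprn_ge0 // ?(ltW xy0) // lerXn2r ?nnegrE // ?(ltW xy0) //.
  by rewrite le_max lexx orbT.
have /eqP -> : (s - m == 0)%N by rewrite subn_eq0 ltnW.
rewrite add0n.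
have -> : 2 ^+ s * (x ^+ m * y ^+ s) = (2 * x * y) ^+ m * ((2 * y)^-1) ^+ (m - s).
  have -> : 2 * x * y = x * (2 * y) by ring.
  have E : (2 * y) ^+ m = (2 * y) ^+ s * (2 * y) ^+ (m - s).
    by rewrite -exprD subnKC // ltnW.
  rewrite exprMn E exprVn [X in _ = X / _]mulrA mulfK; last first.
    by rewrite expf_neq0 // gt_eqF // mulr_gt0.
  by rewrite exprMn; ring.
rewrite ler_wpM2l ?exprn_ge0 // ?(ltW xy0) // lerXn2r ?nnegrE //.
- by rewrite invr_ge0 mulr_ge0 // ltW.
- by rewrite le_max lexx.
Qed.

(** With [x = 2^-s] and [y = 2^-t] this is the dyadic form of the estimate that [|k|^-s] convolved
    with [|k|^-t] is [O(|k|^(1-s-t))] for [s, t < 1 < s + t]. Either [b] or [a - b] has at least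
    [level1 a - 1] digits, and each case reduces to a sum over levels. *)
Lemma conv_level1 x y : 0 < x <= 1 -> 0 < y <= 1 ->
  1 < 2 * x -> 1 < 2 * y -> 2 * x * y < 1 ->
  exists2 C, 0 < C & forall (a : int) (B : nat),
  \sum_(b <- box1 B) x ^+ level1 (a - b) * y ^+ level1 b <=
    C * (2 * x * y) ^+ level1 a.
Proof.
move=> hx hy x1 y1 xy1.
have /andP[x0 xl1] := hx; have /andP[y0 yl1] := hy.
have xy0 : 0 < 2 * x * y by rewrite !mulr_gt0.
have [C1 C10 H1] := sum_max_geo hx y1 xy1.
have yx1 : 2 * y * x < 1 by move: xy1; congr (_ < _); ring.
have [C2 C20 H2] := sum_max_geo hy x1 yx1.
(* The division by [2 x y] pays for the digit lost in [level1_split], which is why [t.-1] occurs in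
   [G1] and [G2]. *)
exists ((C1 + C2) / (2 * x * y)); first by rewrite divr_gt0 // addr_gt0.
move=> a B; set t := level1 a.
pose G1 s := x ^+ maxn t.-1 s * y ^+ s.
pose G2 s := y ^+ maxn t.-1 s * x ^+ s.
have G10 s : 0 <= G1 s by rewrite mulr_ge0 // exprn_ge0 // ltW.
have G20 s : 0 <= G2 s by rewrite mulr_ge0 // exprn_ge0 // ltW.
have step b : x ^+ level1 (a - b) * y ^+ level1 b <=
    G1 (level1 b) + G2 (level1 (a - b)).
  have := level1_split a b; rewrite -/t.
  set u := level1 b; set v := level1 (a - b) => h.
  case: (leqP u v) => uv.
    rewrite ler_wpDr // ler_wpM2r ?exprn_ge0 // ?(ltW y0) //.
    by apply: ler_wiXn2l (maxn_pred_le h uv); first exact: ltW.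
  rewrite ler_wpDl // mulrC ler_wpM2r ?exprn_ge0 // ?(ltW x0) //.
  rewrite maxnC in h.
  by apply: ler_wiXn2l (maxn_pred_le h (ltnW uv)); first exact: ltW.
apply: le_trans (ler_sum _ (fun b _ => step b)) _.
rewrite big_split /=.
have -> : (C1 + C2) / (2 * x * y) * (2 * x * y) ^+ t =
   C1 * ((2 * x * y) ^+ t / (2 * x * y)) + C2 * ((2 * x * y) ^+ t / (2 * x * y)).
  by ring.
have pw : (2 * x * y) ^+ t.-1 <= (2 * x * y) ^+ t / (2 * x * y).
  case: (t) => [|t'] /=; first by rewrite expr0 div1r invf_ge1 // ltW.
  by rewrite exprSr mulfK // gt_eqF.
apply: lerD.
  rewrite (sum_box1_level _ G1); apply: le_trans (H1 _ _) _.
  by rewrite ler_pM2l.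
(* For the second half the variable becomes [c = a - b]; [D] is large enough for the translated box
   to lie in [box1 D]. *)
pose D := (maxn (level1 a) B).+1.
apply: le_trans (_ : \sum_(c <- box1 D) G2 (level1 c) <= _).
  rewrite -(big_map (fun b => a - b) xpredT (fun c => G2 (level1 c))).
  apply: ler_sum_sub => //.
    by rewrite map_inj_uniq ?uniq_box1 // => b c /addrI /oppr_inj.
  move=> _ /mapP[b hb ->]; rewrite mem_box1 /D.
  apply: leq_trans (level1_split (a - b) a) _.
  have -> : a - b - a = - b by ring.
  by rewrite level1N ltnS; move: hb; rewrite mem_box1 geq_max leq_maxl leq_max => ->; rewrite orbT.
rewrite (sum_box1_level _ G2); apply: le_trans (H2 _ _) _.
rewrite ler_pM2l //; apply: le_trans pw.
by have -> : 2 * y * x = 2 * x * y by ring.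
Qed.

End RealSums.

(** * Frequency cubes and hyperbolic layers in several variables *)

Section Boxes.
Local Open Scope nat_scope.

Definition zcons d (a : int) (k : d.-tuple int) : d.+1.-tuple int :=
  [tuple of a :: k].

Definition level d (k : d.-tuple int) : nat := \sum_(i < d) level1 (tnth k i).

Definition zopp d (k : d.-tuple int) : d.-tuple int :=
  [tuple (- tnth k i)%R | i < d].
Definition zadd d (k l : d.-tuple int) : d.-tuple int :=
  [tuple (tnth k i + tnth l i)%R | i < d].
Definition zsub d (k l : d.-tuple int) : d.-tuple int :=
  [tuple (tnth k i - tnth l i)%R | i < d].

(** The cube [|k_i| < 2^N], built one coordinate at a time so that sums of products over the
    coordinates factor. *)
Fixpoint box d N : seq (d.-tuple int) :=
  if d is d'.+1 then [seq zcons a k | a <- box1 N, k <- box d' N]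
  else [:: [tuple]].

Definition layer d n : seq (d.-tuple int) := [seq k <- box d n | level k == n].

Lemma tnth_zcons0 d a (k : d.-tuple int) : tnth (zcons a k) ord0 = a.
Proof. by rewrite tnth0. Qed.

Lemma tnth_zconsS d a (k : d.-tuple int) i :
  tnth (zcons a k) (lift ord0 i) = tnth k i.
Proof. by rewrite tnthS. Qed.

Lemma zconsP d (k : d.+1.-tuple int) : exists a l, k = zcons a l.
Proof. by case/tupleP: k => a l; exists a, l. Qed.

Lemma zcons_inj d a b (k l : d.-tuple int) :
  zcons a k = zcons b l -> a = b /\ k = l.
Proof. by move/(congr1 val) => /= [-> h]; split => //; apply/val_inj. Qed.

Lemma zsub_zcons d a b (k l : d.-tuple int) :
  zsub (zcons a k) (zcons b l) = zcons (a - b)%R (zsub k l).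
Proof.
apply: eq_from_tnth => i; rewrite tnth_mktuple.
by case: (unliftP ord0 i) => [j|] ->; rewrite ?tnth_zcons0 ?tnth_zconsS ?tnth_mktuple.
Qed.

Lemma level_zcons d a (k : d.-tuple int) : level (zcons a k) = level1 a + level k.
Proof.
rewrite /level big_ord_recl tnth_zcons0; congr (_ + _).
by apply: eq_bigr => i _; rewrite tnth_zconsS.
Qed.

Lemma levelN d (k : d.-tuple int) : level (zopp k) = level k.
Proof. by apply: eq_bigr => i _; rewrite tnth_mktuple level1N. Qed.

Lemma mem_box d N (k : d.-tuple int) :
  (k \in box d N) = [forall i, level1 (tnth k i) <= N].
Proof.
elim: d k => [|d IH] k.
  rewrite inE tuple0 eqxx; apply/esym/forallP; by case.
have [a [l ->]] := zconsP k.
apply/allpairsP/forallP => [[[b m] /= [hb hm /zcons_inj[-> ->]]] i|h].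
  case: (unliftP ord0 i) => [j|] ->; rewrite ?tnth_zcons0 ?tnth_zconsS.
    by move: hm; rewrite IH => /forallP.
  by rewrite -mem_box1.
exists (a, l); split => //=.
  by rewrite mem_box1; have := h ord0; rewrite tnth_zcons0.
by rewrite IH; apply/forallP => i; have := h (lift ord0 i); rewrite tnth_zconsS.
Qed.

Lemma uniq_box d N : uniq (box d N).
Proof.
elim: d => [//|d IH]; apply: allpairs_uniq; rewrite ?uniq_box1 //.
by move=> [a k] [b l] _ _ /zcons_inj /= [-> ->].
Qed.

Lemma level1_le_level d (k : d.-tuple int) i : level1 (tnth k i) <= level k.
Proof. by rewrite /level (bigD1 i) //= leq_addr. Qed.

Lemma mem_box_level d n (k : d.-tuple int) : level k <= n -> k \in box d n.
Proof.
move=> h; rewrite mem_box; apply/forallP => i.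
exact: leq_trans (level1_le_level k i) h.
Qed.

Lemma level_box d N (k : d.-tuple int) : k \in box d N -> level k <= d * N.
Proof.
rewrite mem_box => /forallP h; rewrite -{2}[d]card_ord -sum_nat_const.
by apply: leq_sum => i _.
Qed.

Lemma mem_layer d n (k : d.-tuple int) : (k \in layer d n) = (level k == n).
Proof.
rewrite mem_filter; case: eqP => // <-; exact: mem_box_level.
Qed.

Lemma uniq_layer d n : uniq (layer d n).
Proof. by rewrite filter_uniq // uniq_box. Qed.

Lemma mem_zopp_layer d n (k : d.-tuple int) :
  (zopp k \in layer d n) = (k \in layer d n).
Proof. by rewrite !mem_layer levelN. Qed.

Lemma perm_box_layers d N M : d * N < M ->
  perm_eq (box d N) (flatten [seq [seq k <- layer d n | k \in box d N] | n <- iota 0 M]).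
Proof.
move=> NM; apply: uniq_perm; first exact: uniq_box.
  apply: (@uniq_flatten_map _ _ _ (@level d)); first exact: iota_uniq.
    by move=> n; rewrite filter_uniq // uniq_layer.
  by move=> n k; rewrite mem_filter mem_layer => /andP[_ /eqP].
move=> k; apply/idP/flatten_mapP => [h|[n _]]; last by rewrite mem_filter => /andP[].
exists (level k); last by rewrite mem_filter h mem_layer /=.
by rewrite mem_iota /= add0n (leq_ltn_trans _ NM) // level_box.
Qed.

Lemma sum_box_layers (V : nmodType) d N M (F : d.-tuple int -> V) : d * N < M ->
  (\sum_(k <- box d N) F k =
   \sum_(n < M) \sum_(k <- layer d n | k \in box d N) F k)%R.
Proof.
move=> /perm_box_layers/(perm_big _)-> /=; rewrite big_flatten big_map.
rewrite -(big_mkord xpredT (fun n => \sum_(k <- layer d n | k \in box d N) F k)%R).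
rewrite /index_iota subn0; apply: eq_bigr => n _.
by rewrite big_filter.
Qed.

Lemma sum_box_layersP (V : nmodType) d N M (P : pred (d.-tuple int))
    (F : d.-tuple int -> V) : d * N < M ->
  (\sum_(k <- box d N | P k) F k =
   \sum_(n < M) \sum_(k <- layer d n | (k \in box d N) && P k) F k)%R.
Proof.
move=> NM; rewrite big_mkcond (sum_box_layers _ NM); apply: eq_bigr => n _.
by rewrite [in RHS]big_mkcondr.
Qed.

(** This links the cubes, over which the partial kernels are summed, to the layers, on which the
    estimates hold. *)
Lemma box_shell_level d N (k : d.-tuple int) : k \notin box d N -> N < level k.
Proof. by rewrite ltnNge; apply: contra; exact: mem_box_level. Qed.

Lemma sum_boxS_diff (V : zmodType) d N (F : d.-tuple int -> V) :
  (\sum_(k <- box d N.+1) F k - \sum_(k <- box d N) F k =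
   \sum_(k <- box d N.+1 | k \notin box d N) F k)%R.
Proof.
rewrite (bigID (fun k => k \in box d N)) /=.
have -> : (\sum_(k <- box d N.+1 | k \in box d N) F k = \sum_(k <- box d N) F k)%R.
  rewrite -big_filter; apply: perm_big; apply: uniq_perm; rewrite ?filter_uniq ?uniq_box //.
  move=> k; rewrite mem_filter andb_idr // !mem_box => /forallP h.
  by apply/forallP => i; apply: leqW.
by rewrite addrAC subrr add0r.
Qed.

End Boxes.

(** * Cardinality of the layers and convolution of product weights *)

Section BoxSums.
Variable R : realFieldType.

Lemma sum_boxS (V : nmodType) d N (F : d.+1.-tuple int -> V) :
  \sum_(k <- box d.+1 N) F k =
  \sum_(a <- box1 N) \sum_(k <- box d N) F (zcons a k).
Proof. exact: (@big_allpairs_dep _ _ _ _ (fun=> _)). Qed.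

Lemma sum_box_level d N (x : R) :
  \sum_(k <- box d N) x ^+ level k = (\sum_(a <- box1 N) x ^+ level1 a) ^+ d.
Proof.
elim: d => [|d IH]; first by rewrite /= big_seq1 /level big_ord0 !expr0.
rewrite sum_boxS exprS mulr_suml; apply: eq_bigr => a _.
by rewrite -IH mulr_sumr; apply: eq_bigr => k _; rewrite level_zcons exprD.
Qed.

(** Once the last [d] coordinates [k] are chosen, the first one has level [n - level k], hence
    [2^(n - level k)] values. The sum of [2^(- level k)] factors over the coordinates, and in each
    of them every level from [0] to [n] contributes exactly [1]. *)
Lemma size_layer d n :
  ((size (layer d.+1 n))%:R : R) <= 2 ^+ n * n.+1%:R ^+ d.
Proof.
have -> : (size (layer d.+1 n))%:R =
    \sum_(k <- box d.+1 n) (level k == n)%:R :> R.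
  rewrite -[size _]count_predT /layer count_filter.
  rewrite -sum1_count natr_sum big_mkcond /=; apply: eq_bigr => k _.
  by rewrite /predI /=; case: (level k == n).
rewrite sum_boxS exchange_big /=.
apply: le_trans (_ : \sum_(k <- box d n) 2 ^+ n * (2^-1) ^+ level k <= _).
  apply: ler_sum => k _.
  under eq_bigr do rewrite level_zcons.
  rewrite (sum_box1_level _ (fun s => (s + level k == n)%N%:R)).
  case: (leqP (level k) n) => h.
    have h' : (n - level k < n.+1)%N by rewrite ltnS leq_subr.
    rewrite (bigD1 (Ordinal h')) //= subnK // eqxx mulr1.
    rewrite big1 ?addr0.
      rewrite exprVn -[X in _ <= 2 ^+ X / _](subnK h) exprD mulfK //.
    move=> i ni; rewrite (_ : (_ == n) = false) ?mulr0 //; apply/negP => /eqP e.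
    by move/eqP: ni; apply; apply: val_inj => /=; apply: (canRL (addnK _)).
  rewrite big1 ?mulr_ge0 ?exprn_ge0 ?invr_ge0 // => i _.
  rewrite (_ : (_ == n) = false) ?mulr0 //; apply/negP => /eqP e.
  by move: h; rewrite -e ltnNge leq_addl.
rewrite -mulr_sumr sum_box_level ler_wpM2l ?exprn_ge0 //.
rewrite (sum_box1_level _ (fun s => 2^-1 ^+ s)).
rewrite lerXn2r ?nnegrE ?ler0n //.
  by rewrite sumr_ge0 // => i _; rewrite mulr_ge0 ?exprn_ge0 ?invr_ge0.
rewrite (eq_bigr (fun=> 1)) ?sumr_const ?card_ord //.
by move=> i _; rewrite -exprMn divff ?expr1n // pnatr_eq0.
Qed.

(** Both weights are products over the coordinates, so the one-dimensional bound is simply raised to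
    the power [d]; no power of the level is lost. *)
Lemma conv_level d (x y : R) : 0 < x <= 1 -> 0 < y <= 1 ->
  1 < 2 * x -> 1 < 2 * y -> 2 * x * y < 1 ->
  exists2 C, 0 < C & forall (k : d.-tuple int) (B : nat),
  \sum_(l <- box d B) x ^+ level (zsub k l) * y ^+ level l <=
    C * (2 * x * y) ^+ level k.
Proof.
move=> hx hy x1 y1 xy1.
have [C C0 HC] := conv_level1 hx hy x1 y1 xy1.
have /andP[x0 _] := hx; have /andP[y0 _] := hy.
exists (C ^+ d); first exact: exprn_gt0.
elim: d => [|d IH] k B.
  by rewrite /= big_seq1 /level !big_ord0 !expr0 mulr1.
have [a [l ->]] := zconsP k.
rewrite sum_boxS.
rewrite (eq_bigr (fun b => (x ^+ level1 (a - b) * y ^+ level1 b) *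
  \sum_(m <- box d B) x ^+ level (zsub l m) * y ^+ level m)); last first.
  move=> b _; rewrite mulr_sumr; apply: eq_bigr => m _.
  by rewrite zsub_zcons !level_zcons !exprD; ring.
rewrite -mulr_suml level_zcons exprS exprD mulrACA.
apply: ler_pM => //; rewrite sumr_ge0 // => b _; rewrite mulr_ge0 ?exprn_ge0 // ltW //.
Qed.

End BoxSums.

(** * Sparse approximation in the uniform norm *)

Section Sparsification.
Variable R : realType.
Implicit Types (t lam : R).

Lemma expR_le_quad t : t <= 2^-1 -> expR t <= 1 + t + 2 * t ^+ 2.
Proof.
move=> t2; have t1 : 0 < 1 - t by lra.
have h : expR t <= (1 - t)^-1.
  by rewrite -[t]opprK expRN opprK lef_pV2 ?posrE ?expR_gt0 // expR_ge1Dx.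
apply: le_trans h _; rewrite -[_^-1]div1r ler_pdivrMr //.
have : 0 <= t ^+ 2 * (1 - 2 * t) by rewrite mulr_ge0 ?sqr_ge0 //; lra.
have -> : (1 + t + 2 * t ^+ 2) * (1 - t) = 1 + t ^+ 2 * (1 - 2 * t) by ring.
lra.
Qed.

Variables (Y I : finType) (p : I -> R) (a : I -> Y -> R).
Hypothesis p0 : forall i, 0 <= p i.
Hypothesis p1 : \sum_i p i = 1.
Hypothesis a1 : forall i y, `|a i y| <= 1.

Let u y := \sum_i p i * a i y.
Let dev (s : seq I) y := \sum_(i <- s) (a i y - u y).
Let Phi lam s := \sum_y expR (lam * dev s y).

Let u1 y : `|u y| <= 1.
Proof.
apply: le_trans (ler_norm_sum _ _ _) _; rewrite -p1 ler_sum // => i _.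
by rewrite normrM ger0_norm // ler_piMr.
Qed.

(** The linear term of the exponential has mean zero. As [|a i y - u y| <= 2], the condition on
    [lam] keeps the exponent below [1/2], where [expR_le_quad] applies, and the quadratic term is at
    most [2 * 4 * lam^2]. *)
Let mean_exp lam y : 0 < lam <= 4^-1 ->
  \sum_i p i * expR (lam * (a i y - u y)) <= expR (8 * lam ^+ 2).
Proof.
move=> /andP[l0 l4].
apply: le_trans (_ : \sum_i (p i + lam * (p i * a i y - p i * u y) +
    p i * (8 * lam ^+ 2)) <= _).
  apply: ler_sum => i _.
  have h : `|a i y - u y| <= 2.
    by apply: le_trans (ler_normB _ _) _; rewrite -[2]/(1 + 1) lerD.
  have h2 : (a i y - u y) ^+ 2 <= 4.
    rewrite -[X in X <= _]ger0_norm ?sqr_ge0 // normrX.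
    have -> : 4 = 2 ^+ 2 :> R by ring.
    by rewrite lerXn2r ?nnegrE.
  have -> : p i + lam * (p i * a i y - p i * u y) + p i * (8 * lam ^+ 2) =
    p i * (1 + lam * (a i y - u y) + 8 * lam ^+ 2) by ring.
  rewrite ler_wpM2l //.
  apply: le_trans (expR_le_quad _) _.
    move: h; rewrite ler_norml => /andP[_ h].
    have : lam * (a i y - u y) <= lam * 2 by rewrite ler_pM2l.
    lra.
  rewrite lerD2l exprMn.
  have : lam ^+ 2 * (a i y - u y) ^+ 2 <= lam ^+ 2 * 4.
    by rewrite ler_wpM2l // sqr_ge0.
  lra.
rewrite !big_split /= -mulr_suml -mulr_sumr big_split /= sumrN -mulr_suml p1.
rewrite !mul1r subrr mulr0 addr0; exact: expR_ge1Dx.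
Qed.

Let stepPhi lam s : 0 < lam <= 4^-1 ->
  exists i, Phi lam (i :: s) <= expR (8 * lam ^+ 2) * Phi lam s.
Proof.
move=> hl; set K := expR (8 * lam ^+ 2) * Phi lam s.
apply/existsP; apply: contraT; rewrite negb_exists => /forallP h.
have : \sum_i p i * Phi lam (i :: s) <= K.
  rewrite /Phi; under eq_bigr do rewrite mulr_sumr.
  rewrite exchange_big /= /K mulr_sumr ler_sum // => y _.
  rewrite (eq_bigr (fun i => expR (lam * dev s y) *
      (p i * expR (lam * (a i y - u y))))); last first.
    by move=> i _; rewrite /dev big_cons mulrDr expRD; ring.
  by rewrite -mulr_sumr mulrC ler_wpM2r ?expR_ge0 // mean_exp.
have [i pi0] : exists i, 0 < p i.
  apply/existsP; apply: contraT; rewrite negb_exists => /forallP h'.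
  move: p1; rewrite big1 => [/eqP|i _]; first by rewrite eq_sym oner_eq0.
  by apply/eqP; rewrite eq_le p0 leNgt h'.
have : K < \sum_i p i * Phi lam (i :: s).
  rewrite -[K]mul1r -p1 mulr_suml.
  rewrite (bigD1 i) //= [X in _ < X](bigD1 i) //=.
  apply: ltr_leD; first by rewrite ltr_pM2l // ltNge h.
  by apply: ler_sum => j _; rewrite ler_wpM2l // ltW // ltNge h.
by move=> h1 h2; move: (lt_le_trans h1 h2); rewrite ltxx.
Qed.

Let existsPhi lam m : 0 < lam <= 4^-1 ->
  exists2 s, size s = m & Phi lam s <= #|Y|%:R * expR (8 * lam ^+ 2 * m%:R).
Proof.
move=> hl; elim: m => [|m [s sm IH]].
  exists [::] => //; rewrite mulr0 expR0 mulr1 /Phi (eq_bigr (fun=> 1)).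
    by rewrite sumr_const.
  by move=> y _; rewrite /dev big_nil mulr0 expR0.
have [i hi] := stepPhi s hl; exists (i :: s); first by rewrite /= sm.
apply: le_trans hi _.
have -> : 8 * lam ^+ 2 * m.+1%:R = 8 * lam ^+ 2 + 8 * lam ^+ 2 * m%:R.
  by rewrite -natr1; ring.
by rewrite expRD [X in _ <= X]mulrCA ler_pM2l ?expR_gt0.
Qed.

(* Conditional expectations: the indices are chosen one by one so that the
   exponential moment summed over [Y] grows at most as it does on average for
   independent indices of law [p]. *)
Lemma empirical_deviation m : (0 < m)%N -> (1 < #|Y|)%N ->
  exists2 s : seq I, size s = m &
  forall y, \sum_(i <- s) (a i y - \sum_j p j * a j y) <=
    9 * Num.sqrt (m%:R * ln #|Y|%:R).
Proof.
move=> m0 Y1; set L := ln #|Y|%:R.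
have L0 : 0 < L by rewrite ln_gt0 // ltr1n.
have m0' : 0 < m%:R :> R by rewrite ltr0n.
(* Taking logarithms bounds the deviation by [L / lam + 8 lam m]; this [lam] makes both parts
   multiples of [sqrt (m L)], with constants [1] and [8]. *)
pose lam : R := Num.sqrt (L / m%:R).
have lam0 : 0 < lam by rewrite sqrtr_gt0 divr_gt0.
have lam2 : lam ^+ 2 = L / m%:R by rewrite sqr_sqrtr // ltW // divr_gt0.
have E : Num.sqrt (m%:R * L) = lam * m%:R.
  have -> : m%:R * L = (lam * m%:R) ^+ 2.
    by rewrite exprMn lam2; field; rewrite gt_eqF.
  by rewrite sqrtr_sqr ger0_norm // mulr_ge0 // ltW.
rewrite E.
case: (lerP lam 4^-1) => l4.
  have [s sm hs] := @existsPhi lam m (introT andP (conj lam0 l4)).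
  exists s => // y.
  have h : expR (lam * dev s y) <= #|Y|%:R * expR (8 * lam ^+ 2 * m%:R).
    by apply: le_trans hs; rewrite /Phi (bigD1 y) //= lerDl sumr_ge0.
  have {}h : lam * dev s y <= L + 8 * lam ^+ 2 * m%:R.
    rewrite -ler_expR expRD lnK // posrE ltr0n; exact: ltnW.
  have hL : L = lam ^+ 2 * m%:R by rewrite lam2 mulfVK // gt_eqF.
  rewrite -(ler_pM2l lam0); apply: le_trans h _; rewrite {1}hL.
  by rewrite le_eqVlt; apply/orP; left; apply/eqP; ring.
(* For [lam > 1/4] the trivial bound [2 m <= 9 lam m] suffices, so any index repeated [m] times will
   do; [existsPhi] only serves to exhibit one. *)
have [i _] : exists i : I, True.
  have [|i pi0] := @existsPhi 4^-1 1; first lra.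
  by case: i pi0 => // i s _ _; exists i.
exists (nseq m i); first by rewrite size_nseq.
move=> y; rewrite big_nseq iter_addr_0 -[X in X <= _]mulr_natr.
have : a i y - u y <= 2.
  by apply: le_trans (ler_norm _) _; apply: le_trans (ler_normB _ _) _;
     rewrite -[2]/(1 + 1) lerD.
rewrite -/(u y) => h; rewrite (mulrA 9) ler_pM2r //; lra.
Qed.

End Sparsification.

(** * Complex moduli and the exponential on the unit circle *)

Section ComplexFacts.
Variable R : realType.
Implicit Types (z w : R[i]) (s t : R).

Lemma normcD z w : normc (z + w) <= normc z + normc w.
Proof. exact: le_normcD. Qed.

Lemma normc_opp z : normc (- z) = normc z.
Proof. exact: normcN. Qed.

Lemma normc_ge0 z : 0 <= normc z.
Proof. by case: z => a b /=; rewrite sqrtr_ge0. Qed.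

Lemma normc_zero : normc (0 : R[i]) = 0.
Proof. exact: normc0. Qed.

Lemma normc_one : normc (1 : R[i]) = 1.
Proof. exact: normc1. Qed.

Lemma normc_sum (I : Type) (r : seq I) (P : pred I) (f : I -> R[i]) :
  normc (\sum_(i <- r | P i) f i) <= \sum_(i <- r | P i) normc (f i).
Proof.
elim/big_rec2: _ => [|i x y _ h]; first by rewrite normc_zero.
by apply: le_trans (normcD _ _) _; rewrite lerD2l.
Qed.

Lemma normcC t : normc t%:C = `|t|.
Proof. by rewrite /= expr0n addr0 sqrtr_sqr. Qed.

Lemma normc_conj z : normc (conjc z) = normc z.
Proof. by case: z => a b /=; rewrite sqrrN. Qed.

Lemma normcE2 z : normc z ^+ 2 = complex.Re z ^+ 2 + complex.Im z ^+ 2.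
Proof. by case: z => a b /=; rewrite sqr_sqrtr // addr_ge0 ?sqr_ge0. Qed.

Lemma Re_le_normc z : `|complex.Re z| <= normc z.
Proof.
rewrite -ler_sqr ?nnegrE ?normc_ge0 //.
by rewrite normcE2 real_normK ?num_real // lerDl sqr_ge0.
Qed.

Lemma Im_le_normc z : `|complex.Im z| <= normc z.
Proof.
rewrite -ler_sqr ?nnegrE ?normc_ge0 //.
by rewrite normcE2 real_normK ?num_real // lerDr sqr_ge0.
Qed.

Lemma normc_le_ReIm z : normc z <= `|complex.Re z| + `|complex.Im z|.
Proof.
rewrite -ler_sqr ?nnegrE ?normc_ge0 ?addr_ge0 //.
rewrite normcE2 sqrrD !real_normK ?num_real //.
by rewrite addrAC lerDl mulrn_wge0 // mulr_ge0.
Qed.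

Lemma normc_conjM z : z * conjc z = (normc z ^+ 2)%:C.
Proof.
by rewrite normcE2; case: z => a b /=; rewrite /GRing.mul /=; congr Complex; ring.
Qed.

Lemma ReM z w : complex.Re (z * w) =
  complex.Re z * complex.Re w - complex.Im z * complex.Im w.
Proof. by case: z w => a b [c e]. Qed.

Lemma ImM z w : complex.Im (z * w) =
  complex.Re z * complex.Im w + complex.Im z * complex.Re w.
Proof. by case: z w => a b [c e]. Qed.

Lemma ReD z w : complex.Re (z + w) = complex.Re z + complex.Re w.
Proof. by case: z w => a b [c e]. Qed.

Lemma ImD z w : complex.Im (z + w) = complex.Im z + complex.Im w.
Proof. by case: z w => a b [c e]. Qed.

Lemma Re_sum (I : Type) (r : seq I) (P : pred I) (f : I -> R[i]) :
  complex.Re (\sum_(i <- r | P i) f i) = \sum_(i <- r | P i) complex.Re (f i).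
Proof. by elim/big_rec2: _ => // i x y _ <-; rewrite ReD. Qed.

Lemma Im_sum (I : Type) (r : seq I) (P : pred I) (f : I -> R[i]) :
  complex.Im (\sum_(i <- r | P i) f i) = \sum_(i <- r | P i) complex.Im (f i).
Proof. by elim/big_rec2: _ => // i x y _ <-; rewrite ImD. Qed.

Definition expi t : R[i] := cos t +i* sin t.

Lemma expiD s t : expi (s + t) = expi s * expi t.
Proof.
apply/eqP; rewrite eq_complex ReM ImM /= cosD sinD eqxx /=.
by rewrite [X in X == _]addrC.
Qed.

Lemma expi0 : expi 0 = 1.
Proof. by rewrite /expi cos0 sin0. Qed.

Lemma expiN t : expi (- t) = conjc (expi t).
Proof. by rewrite /expi cosN sinN. Qed.

Lemma normc_expi t : normc (expi t) = 1.
Proof. by rewrite /= cos2Dsin2 sqrtr1. Qed.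

Lemma expi_2pi : expi (pi *+ 2) = 1.
Proof. by rewrite /expi cos2pi sin2pi. Qed.

Lemma expiMn t n : expi (t *+ n) = expi t ^+ n.
Proof.
elim: n => [|n IH]; first by rewrite mulr0n expi0.
by rewrite mulrS expiD IH exprS.
Qed.

Lemma expi_2piz (a : int) : expi (a%:~R * (pi *+ 2)) = 1.
Proof.
case: a => n; rewrite mulrC ?NegzE ?mulrNz -?pmulrn ?mulrN ?expiN mulr_natr expiMn.
  by rewrite expi_2pi expr1n.
by rewrite expi_2pi expr1n conjc1.
Qed.

Lemma cos_lip s t : `|cos s - cos t| <= `|s - t|.
Proof.
wlog st : s t / t <= s.
  move=> h; case: (leP t s) => [/h//|/ltW/h]; by rewrite distrC (distrC t).
have D x : x \in `]t, s[%R -> is_derive x 1 (@cos R) ((fun x => - sin x) x).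
  by move=> _; exact: is_derive_cos.
have C : {within `[t, s], continuous (@cos R)}.
  by apply: continuous_subspaceT; exact: continuous_cos.
have [c _ ->] := MVT_segment st D C.
by rewrite normrM ler_piMl // normrN sin_max.
Qed.

Lemma sin_lip s t : `|sin s - sin t| <= `|s - t|.
Proof.
wlog st : s t / t <= s.
  move=> h; case: (leP t s) => [/h//|/ltW/h]; by rewrite distrC (distrC t).
have D x : x \in `]t, s[%R -> is_derive x 1 (@sin R) ((@cos R) x).
  by move=> _; exact: is_derive_sin.
have C : {within `[t, s], continuous (@sin R)}.
  by apply: continuous_subspaceT; exact: continuous_sin.
have [c _ ->] := MVT_segment st D C.
by rewrite normrM ler_piMl // cos_max.
Qed.

Lemma expi_lip s t : normc (expi s - expi t) <= 2 * `|s - t|.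
Proof.
apply: le_trans (normc_le_ReIm _) _.
by rewrite mulr2n mulrDl mul1r lerD // ?cos_lip ?sin_lip.
Qed.

End ComplexFacts.

(** * Characters of the torus: multiplicativity, periodicity, Lipschitz bound *)

Section Characters.
Variables (R : realType).

Definition zdot d (k : d.-tuple int) (x : Rn R d) : R :=
  \sum_(l < d) (tnth k l)%:~R * tnth x l.

Definition xsub d (x y : Rn R d) : Rn R d := [tuple tnth x l - tnth y l | l < d].

Lemma cexpE d (k : d.-tuple int) (x : Rn R d) : cexp k x = expi (zdot k x).
Proof. by []. Qed.

Lemma normc_cexp d (k : d.-tuple int) (x : Rn R d) : normc (cexp k x) = 1.
Proof. exact: normc_expi. Qed.

Lemma cexp_zadd d (k l : d.-tuple int) (x : Rn R d) :
  cexp (zadd k l) x = cexp k x * cexp l x.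
Proof.
rewrite !cexpE -expiD /zdot -big_split /=; congr expi; apply: eq_bigr => i _.
by rewrite tnth_mktuple rmorphD /= mulrDl.
Qed.

Lemma cexp_zopp d (k : d.-tuple int) (x : Rn R d) :
  cexp (zopp k) x = conjc (cexp k x).
Proof.
rewrite !cexpE -expiN /zdot -sumrN; congr expi; apply: eq_bigr => i _.
by rewrite tnth_mktuple rmorphN /= mulNr.
Qed.

Lemma cexp_xsub d (k : d.-tuple int) (x y : Rn R d) :
  cexp k (xsub x y) = cexp k x * cexp (zopp k) y.
Proof.
rewrite cexp_zopp !cexpE -expiN -expiD /zdot -sumrN -big_split /=; congr expi.
by apply: eq_bigr => i _; rewrite tnth_mktuple mulrBr.
Qed.

Lemma zdot_zcons d a (k : d.-tuple int) (t : measurableTypeR R) (x : Rn R d) :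
  zdot (zcons a k) (cons_pair (t, x)) = a%:~R * t + zdot k x.
Proof.
rewrite /zdot big_ord_recl tnth_zcons0; congr (_ + _).
by apply: eq_bigr => i _; rewrite tnth_zconsS tnthS.
Qed.

Lemma cexp_zcons d a (k : d.-tuple int) (t : measurableTypeR R) (x : Rn R d) :
  cexp (zcons a k) (cons_pair (t, x)) = expi (a%:~R * t) * cexp k x.
Proof. by rewrite !cexpE zdot_zcons expiD. Qed.

Lemma cexp_periodic d (k z : d.-tuple int) (x : Rn R d) :
  cexp k [tuple tnth x l + (tnth z l)%:~R * (pi *+ 2) | l < d] = cexp k x.
Proof.
rewrite !cexpE /zdot.
rewrite (eq_bigr (fun l => (tnth k l)%:~R * tnth x l +
   (tnth k l * tnth z l)%:~R * (pi *+ 2))); last first.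
  by move=> l _; rewrite tnth_mktuple mulrDr rmorphM /= mulrA.
rewrite big_split /= expiD -mulr_suml -rmorph_sum /=.
by rewrite expi_2piz mulr1.
Qed.

Lemma cexp_lip d (k : d.-tuple int) n (x y : Rn R d) (e : R) :
  k \in box d n -> (forall l, `|tnth x l - tnth y l| <= e) ->
  normc (cexp k x - cexp k y) <= 2 * (d%:R * (2 ^+ n * e)).
Proof.
rewrite mem_box => /forallP hk he.
rewrite !cexpE; apply: le_trans (expi_lip _ _) _; rewrite ler_wpM2l //.
rewrite /zdot -sumrB; apply: le_trans (ler_norm_sum _ _ _) _.
apply: le_trans (_ : \sum_(l < d) 2 ^+ n * e <= _); last first.
  by rewrite sumr_const card_ord mulr_natl.
apply: ler_sum => l _; rewrite -mulrBr normrM ler_pM //.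
rewrite -intr_norm -abszE -pmulrn -natrX ler_nat ltnW //.
by rewrite -level1_le.
Qed.

End Characters.

(** * Sparsification of trigonometric polynomials on a grid *)

Section SparseTrig.
Variable R : realType.

(** Frequencies may be repeated, as they may in [sigma]: the length of the list is the number of
    terms that counts. *)
Definition tpoly d (t : seq (d.-tuple int * R[i])) (x : Rn R d) : R[i] :=
  \sum_(p <- t) p.2 * cexp p.1 x.

(** Euclidean division of the floor of [t / w] by [L.+1], with [w] the mesh: the remainder is the
    grid point and the quotient counts the periods. *)
Lemma grid_approx1 (L : nat) (t : R) :
  exists p : 'I_L.+1 * int,
  `|t - ((p.1 : nat)%:R * (pi *+ 2 / L.+1%:R) + p.2%:~R * (pi *+ 2))| <=
    pi *+ 2 / L.+1%:R.
Proof.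
set w := pi *+ 2 / L.+1%:R.
have L0 : 0 < L.+1%:R :> R by rewrite ltr0n.
have w0 : 0 < w by rewrite divr_gt0 // mulrn_wgt0 // pi_gt0.
pose b := Num.floor (t / w).
have /andP[b1 b2] := floor_itv (t / w).
have hn : (`|(b %% L.+1%:Z)%Z| < L.+1)%N.
  by have := @ltz_pmod b L.+1 isT; have := @modz_ge0 b L.+1 isT; lia.
exists (Ordinal hn, (b %/ L.+1%:Z)%Z) => /=.
have -> : (`|(b %% L.+1%:Z)%Z|)%:R = ((b %% L.+1%:Z)%Z)%:~R :> R.
  by rewrite pmulrn -[in RHS](@gez0_abs (b %% L.+1%:Z)%Z) // modz_ge0.
have -> : pi *+ 2 = L.+1%:R * w :> R.
  by rewrite /w mulrC divfK // gt_eqF.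
have -> : t - ((b %% L.+1%:Z)%Z%:~R * w + (b %/ L.+1%:Z)%Z%:~R * (L.+1%:R * w)) =
    (t / w - b%:~R) * w.
  have -> : b%:~R = (b %/ L.+1%:Z)%Z%:~R * L.+1%:R + (b %% L.+1%:Z)%Z%:~R :> R.
    by rewrite [in LHS](divz_eq b L.+1%:Z) rmorphD rmorphM.
  move: (b %/ _)%Z (b %% _)%Z L.+1%:R => u1 u2 u3; field.
  by rewrite gt_eqF.
rewrite normrM (gtr0_norm w0) ler_piMl ?(ltW w0) //.
rewrite ger0_norm ?subr_ge0 // lerBlDl ltW //.
by move: b2; rewrite rmorphD.
Qed.

Lemma ln2_le1 : ln 2 <= 1 :> R.
Proof.
rewrite -ler_expR lnK ?posrE //; apply: le_trans (expR_ge1Dx _); lra.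
Qed.

(** The polynomial is [A] times the mean of unimodular multiples of exponentials, drawn with
    probability [|c k| / A]. An empirical mean of [m] of them is an [m]-term polynomial, close to it
    on a finite grid by [empirical_deviation] and elsewhere by the Lipschitz bound. The logarithm of
    the grid size is [O(n+1)], whence the square root. *)
Lemma sparse_trig d : exists2 C : R, 0 < C &
  forall n m (s : seq (d.-tuple int)) (c : d.-tuple int -> R[i]),
  (0 < m)%N -> (m <= 2 ^ (d * n))%N -> {subset s <= box d n} ->
  exists2 t : seq (d.-tuple int * R[i]), size t = m &
  forall x, normc (\sum_(k <- s) c k * cexp k x - tpoly t x) <=
    C * (\sum_(k <- s) normc (c k)) * Num.sqrt (n.+1%:R / m%:R).
Proof.
(* [K * n.+1] dominates the binary logarithm of the number of tests [Y] below. In the next constant,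
   [18] is [9] for each of the real and imaginary parts, and the [1] is for the passage from the
   grid to all points. *)
pose K := (d ^ 2 + 7 * d + 2)%N.
exists (18 * Num.sqrt K%:R + 1).
  by rewrite ltr_wpDl // mulr_ge0 // sqrtr_ge0.
move=> n m s c m0 mle hs.
set A := \sum_(k <- s) normc (c k).
have A0 : 0 <= A by rewrite sumr_ge0 // => k _; rewrite normc_ge0.
have m0' : 0 < m%:R :> R by rewrite ltr0n.
have [A00|/negPf An0] := eqVneq A 0.
  exists (nseq m ([tuple 0 | _ < d], 0)); first by rewrite size_nseq.
  move=> x; rewrite A00 mulr0 mul0r /tpoly big_nseq iter_addr_0 mul0r mul0rn subr0.
  apply: le_trans (normc_sum _ _ _) _.
  rewrite (eq_bigr (fun k => normc (c k))) -/A ?A00 // => k _.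
  by rewrite normcM normc_cexp mulr1.
have {An0}Agt0 : 0 < A by rewrite lt0r An0.
(* In the exponent, [n] offsets the size of the frequencies, [d * n] brings the error down to
   [1 / m] since [m <= 2 ^ (d * n)], and [d + 6] absorbs the factors [d] and [8 pi]. *)
pose L := (2 ^ (n + d * n + d + 6)).-1.
have LE : L.+1 = (2 ^ (n + d * n + d + 6))%N by rewrite prednK // expn_gt0.
pose I := 'I_(size s).
pose kk (i : I) := tnth (in_tuple s) i.
have kks i : kk i \in box d n by apply: hs; exact: mem_tnth.
pose p (i : I) := normc (c (kk i)) / A.
(* The phase is [0] at a vanishing coefficient, by the convention on inverses; hence only
   [normc (ph i) <= 1]. *)
pose ph (i : I) := c (kk i) / (normc (c (kk i)))%:C.
have ph1 i : normc (ph i) <= 1.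
  rewrite normcM normcV normcC ger0_norm ?normc_ge0 //.
  by have [->|?] := eqVneq (normc (c (kk i))) 0; rewrite ?mul0r // divff.
pose v (i : I) x := ph i * cexp (kk i) x.
have v1 i x : normc (v i x) <= 1 by rewrite normcM normc_cexp mulr1.
pose proj (b : bool) (z : R[i]) := if b then complex.Re z else complex.Im z.
have proj_le b z : `|proj b z| <= normc z.
  by case: b; rewrite ?Re_le_normc ?Im_le_normc.
have projZ b t (z : R[i]) : proj b (t%:C * z) = t * proj b z.
  by case: b; rewrite /= ?ReM ?ImM /= mul0r ?subr0 ?addr0.
have proj_sum b J (r : seq J) f : proj b (\sum_(j <- r) f j) = \sum_(j <- r) proj b (f j).
  by case: b; rewrite /= ?Re_sum ?Im_sum.
have projB b z w : proj b (z - w) = proj b z - proj b w.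
  by case: b; case: z => ? ?; case: w.
pose pt (y : d.-tuple 'I_L.+1) : Rn R d :=
  [tuple (tnth y l : nat)%:R * (pi *+ 2 / L.+1%:R) | l < d].
(* A test is a grid point with a sign and a choice of real or imaginary part, so that one-sided
   deviations control the complex modulus. *)
pose Y := (d.-tuple 'I_L.+1 * (bool * bool))%type.
pose a (i : I) (y : Y) := (-1) ^+ y.2.1 * proj y.2.2 (v i (pt y.1)).
have p0 i : 0 <= p i by rewrite divr_ge0 // normc_ge0.
have p1 : \sum_i p i = 1.
  rewrite -mulr_suml /kk -(big_tnth _ _ s xpredT (fun k => normc (c k))) -/A.
  by rewrite divff // gt_eqF.
have a1 i y : `|a i y| <= 1.
  by rewrite normrM normr_sign mul1r; apply: le_trans (proj_le _ _) _.
have cY : #|{: Y}| = (2 ^ (d * (n + d * n + d + 6) + 2))%N.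
  by rewrite !card_prod card_bool card_tuple card_ord LE -expnM [(_ * d)%N]mulnC expnD.
have Y1 : (1 < #|{: Y}|)%N.
  by rewrite cY -{1}(expn0 2) ltn_exp2l // addn2.
have [r sr hr] := empirical_deviation p0 p1 a1 m0 Y1.
set B := 9 * _ in hr.
pose g x := \sum_(k <- s) c k * cexp k x.
have gE x : g x = A%:C * \sum_j (p j)%:C * v j x.
  rewrite /g big_tnth mulr_sumr; apply: eq_bigr => i _.
  rewrite mulrA -rmorphM /= /v mulrA; congr (_ * _).
  rewrite /p [A * _]mulrC mulfVK ?gt_eqF // /ph /kk.
  set z := c _; have [z0|z0] := eqVneq (normc z) 0.
    by rewrite (eq0_normc z0) mul0r mulr0.
  rewrite mulrCA divff ?mulr1 //.
  by apply: contra z0 => /eqP/complexI ->.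
pose D x := \sum_(i <- r) (v i x - \sum_j (p j)%:C * v j x).
have hD y : normc (D (pt y)) <= 2 * B.
  have h b : `|proj b (D (pt y))| <= B.
    have H (b1 : bool) : (-1) ^+ b1 * proj b (D (pt y)) <= B.
      apply: le_trans (hr (y, (b1, b))); rewrite le_eqVlt; apply/orP; left.
      rewrite /D proj_sum mulr_sumr; apply/eqP; apply: eq_bigr => i _.
      rewrite projB mulrBr /a /=; congr (_ - _).
      rewrite proj_sum mulr_sumr; apply: eq_bigr => j _.
      by rewrite projZ mulrCA.
    rewrite ler_norml; apply/andP; split.
      by rewrite lerNl -mulN1r -(expr1 (-1)); exact: (H true).
    by rewrite -[X in X <= _]mul1r -(expr0 (-1)); exact: (H false).
  apply: le_trans (normc_le_ReIm _) _.
  by rewrite [2]mulr2n mulrDl mul1r lerD //; [exact: (h true)|exact: (h false)].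
pose eta := 2 * (d%:R * (2 ^+ n * (pi *+ 2 / L.+1%:R))) : R.
have Dx x : normc (D x) <= 2 * B + m%:R * (2 * eta).
  have /choice[f hf] := @grid_approx1 L.
  pose y := [tuple (f (tnth x l)).1 | l < d].
  pose z := [tuple (f (tnth x l)).2 | l < d].
  (* The grid covers one period only; the exponentials do not see the translation by [z], so [x] may
     be compared with a nearby translate of a grid point. *)
  pose x' : Rn R d := [tuple tnth (pt y) l + (tnth z l)%:~R * (pi *+ 2) | l < d].
  have vlip i : normc (v i x - v i (pt y)) <= eta.
    rewrite /v -mulrBr normcM -(cexp_periodic (kk i) z (pt y)) -/x'.
    rewrite -[X in _ <= X]mul1r ler_pM ?normc_ge0 //.
    apply: cexp_lip => // l; rewrite !tnth_mktuple; exact: hf.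
  have -> : D x = D (pt y) + (D x - D (pt y)) by rewrite addrC subrK.
  apply: le_trans (normcD _ _) _; rewrite lerD //.
  rewrite /D -sumrB; apply: le_trans (normc_sum _ _ _) _.
  apply: le_trans (_ : \sum_(i <- r) 2 * eta <= _); last first.
    by rewrite big_const_seq count_predT sr iter_addr_0 -[X in X <= _]mulr_natl.
  apply: ler_sum => i _.
  rewrite opprD addrACA -opprD.
  apply: le_trans (normcD _ _) _; rewrite normc_opp [2]mulr2n mulrDl mul1r lerD //.
  rewrite -sumrB; apply: le_trans (normc_sum _ _ _) _.
  rewrite -[X in _ <= X]mul1r -p1 mulr_suml; apply: ler_sum => j _.
  by rewrite -mulrBr normcM normcC ger0_norm // ler_wpM2l.
exists [seq (kk i, (A / m%:R)%:C * ph i) | i <- r]; first by rewrite size_map.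
move=> x.
have -> : \sum_(k <- s) c k * cexp k x - tpoly [seq (kk i, (A / m%:R)%:C * ph i) | i <- r] x
    = - ((A / m%:R)%:C * D x).
  rewrite -/(g x) gE /tpoly big_map /D.
  have -> : \sum_(j <- r) (A / m%:R)%:C * ph j * cexp (kk j) x =
      (A / m%:R)%:C * \sum_(j <- r) v j x.
    by rewrite mulr_sumr; apply: eq_bigr => i _; rewrite [RHS]mulrA.
  rewrite sumrB mulrBr opprB.
  rewrite [X in _ = _ * X - _]big_const_seq count_predT sr iter_addr_0.
  rewrite -[X in _ = _ * X - _]mulr_natl mulrA; congr (_ * _ - _).
  by rewrite -(rmorph_nat (real_complex R)) -rmorphM /= mulfVK // gt_eqF.
rewrite normc_opp normcM normcC ger0_norm ?divr_ge0 ?(ltW m0') //.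
set S := Num.sqrt (_ / _).
have SE : m%:R * S = Num.sqrt (m%:R * n.+1%:R).
  rewrite -[X in X * _](ger0_norm (ltW m0')) -sqrtr_sqr -sqrtrM ?sqr_ge0 //.
  by congr Num.sqrt; field; rewrite gt_eqF.
apply: le_trans (_ : A / m%:R * (2 * B + m%:R * (2 * eta)) <= _).
  by rewrite ler_wpM2l // divr_ge0 // ltW.
have hB : 2 * B <= 18 * Num.sqrt K%:R * (m%:R * S).
  rewrite SE -mulrA -sqrtrM ?ler0n // /B mulrA.
  have -> : 2 * 9 = 18 :> R by ring.
  rewrite ler_wpM2l // ler_wsqrtr // mulrCA ler_pM2l //.
  rewrite cY natrX lnXn // -[X in X <= _]mulr_natl.
  apply: le_trans (_ : (d * (n + d * n + d + 6) + 2)%:R * 1 <= _).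
    by rewrite ler_wpM2l ?ler0n // ln2_le1.
  by rewrite mulr1 -natrM ler_nat /K; clear; nia.
have heta : 2 * eta <= S.
  apply: le_trans (_ : m%:R^-1 <= _).
    apply: le_trans (_ : (2 ^ (d * n))%:R^-1 <= _); last first.
      by rewrite lef_pV2 ?posrE ?ltr0n ?expn_gt0 // ler_nat.
    have -> : 2 * eta = 8 * pi * (d%:R * (2 ^+ n / L.+1%:R)).
      by rewrite /eta -[pi *+ 2]mulr_natl; ring.
    have pi4 : pi <= 4 :> R by have := @pihalf_lt2 R; lra.
    have -> : L.+1%:R = 2 ^+ n * 2 ^+ (d * n) * 2 ^+ d * 2 ^+ 6 :> R.
      by rewrite LE natrX !exprD.
    rewrite natrX.
    have d2 : d%:R <= 2 ^+ d :> R by rewrite -natrX ler_nat ltnW // ltn_expl.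
    have n0 : 0 < 2 ^+ n :> R by rewrite exprn_gt0.
    have d0 : 0 < 2 ^+ d :> R by rewrite exprn_gt0.
    have dn0 : 0 < 2 ^+ (d * n) :> R by rewrite exprn_gt0.
    have -> : 8 * pi * (d%:R * (2 ^+ n / (2 ^+ n * 2 ^+ (d * n) * 2 ^+ d * 2 ^+ 6)))
       = (pi / 4) * (d%:R / 2 ^+ d) * 2^-1 * (2 ^+ (d * n))^-1 :> R.
      by field; rewrite !gt_eqF.
    rewrite ler_piMl ?invr_ge0 ?(ltW dn0) //.
    rewrite mulr_ile1 ?invr_ge0 ?mulr_ge0 ?divr_ge0 ?pi_ge0 ?(ltW d0) ?ler0n //.
      by rewrite mulr_ile1 ?divr_ge0 ?pi_ge0 ?(ltW d0) ?ler0n // ler_pdivrMr // mul1r.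
    by rewrite invf_le1 // ler1n.
  rewrite -[X in X <= _]ger0_norm ?invr_ge0 ?(ltW m0') // -sqrtr_sqr ler_wsqrtr //.
  rewrite expr2 mulrC ler_wpM2r ?invr_ge0 ?(ltW m0') //.
  apply: le_trans (_ : 1 <= _); last by rewrite ler1n.
  by rewrite invf_le1 // ler1n.
have -> : (18 * Num.sqrt K%:R + 1) * A * S =
  A / m%:R * (18 * Num.sqrt K%:R * (m%:R * S) + m%:R * S).
  by field; rewrite gt_eqF.
rewrite ler_wpM2l ?divr_ge0 ?(ltW m0') // lerD //.
by rewrite ler_pM2l.
Qed.

End SparseTrig.

(** * Integration on the torus *)

Section TorusIntegral.
Variable R : realType.

(** Meant for the nonnegative functions [1 + cos (a t)] and [1 + sin (a t)], from whose mean the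
    constant [1] is subtracted afterwards. *)
Lemma integral_trig_itv (F f : R -> R) :
  (forall t : R, is_derive t 1 F (f t)) -> continuous f ->
  F (pi *+ 2) = F 0 + pi *+ 2 -> (forall t, 0 <= f t) ->
  (\int[uniform_prob (@twopi_gt0 R)]_t (f t)%:E = 1)%E.
Proof.
move=> dF cf FE f0.
have cF : continuous F.
  move=> t; apply: differentiable_continuous; apply/derivable1_diffP.
  by have [] := dF t.
rewrite integral_uniform; last 2 first.
- apply/measurable_EFinP; exact: continuous_measurable_fun.
- by move=> t; rewrite lee_fin.
rewrite (@continuous_FTC2 _ f F 0 (pi *+ 2)) ?twopi_gt0 //.
- rewrite FE -EFinB -EFinM subr0 addrC addKr mulVf // gt_eqF // twopi_gt0 //.
- by apply: continuous_subspaceT.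
- split.
  + by move=> t _; have [] := dF t.
  + by apply: cvg_at_right_filter; exact: cF.
  + by apply: cvg_at_left_filter; exact: cF.
- by move=> t _; rewrite derive1E; have [_ ->] := dF t.
Qed.

Lemma is_derive_lin_comp (g dg : R -> R) (a b t : R) :
  (forall x : R, is_derive x 1 g (dg x)) ->
  is_derive t 1 (fun t : R => t + b * g (a * t)) (1 + b * (dg (a * t) * a)).
Proof.
move=> hg.
have h1 : is_derive t 1 (fun t : R => a * t) a.
  have := @is_deriveZ _ _ _ id a t 1 1 (is_derive_id t 1).
  by rewrite /GRing.scale /= mulr1.
have h2 : is_derive t 1 (g \o (fun t : R => a * t)) (dg (a * t) * a).
  exact: is_derive1_comp.
have h3 := @is_deriveZ _ _ _ _ b t 1 _ h2.
exact: (is_deriveD (is_derive_id t 1) h3).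
Qed.

Lemma integral_cos_sin_uniform (a : int) : a != 0 ->
  \int[uniform_prob (@twopi_gt0 R)]_t cos (a%:~R * t) = 0 /\
  \int[uniform_prob (@twopi_gt0 R)]_t sin (a%:~R * t) = 0.
Proof.
move=> a0; have a0' : a%:~R != 0 :> R by rewrite intr_eq0.
pose mu : probability _ R := uniform_prob (@twopi_gt0 R).
rewrite -/mu.
have mc : continuous (fun t : R => cos (a%:~R * t)).
  by move=> t; apply: continuous_comp; [exact: mulrl_continuous|exact: continuous_cos].
have ms : continuous (fun t : R => sin (a%:~R * t)).
  by move=> t; apply: continuous_comp; [exact: mulrl_continuous|exact: continuous_sin].
have bint (f : R -> R) : continuous f -> (forall t, `|f t| <= 1) ->
    mu.-integrable setT (EFin \o f).
  move=> cf f1; apply: measurable_bounded_integrable => //.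
  - by rewrite (le_lt_trans (probability_le1 _ _)) // ltry.
  - exact: continuous_measurable_fun.
  - exists 1; split => // M M1 t _; apply: le_trans (f1 t) _; exact: ltW.
have shift (f : R -> R) : continuous f -> (forall t, `|f t| <= 1) ->
    (\int[mu]_t (1 + f t)%:E = 1)%E -> \int[mu]_t f t = 0.
  move=> cf f1 H.
  have : \int[mu]_t (1 + f t) = 1 by rewrite /Rintegral H.
  rewrite RintegralD //; last 2 first.
  - by apply: (bint (cst 1)); [move=> ?; exact: cvg_cst|move=> ?; rewrite normr1].
  - exact: bint.
  have -> : \int[mu]_t (1 : R) = 1.
    by rewrite Rintegral_cst // [X in fine X](@probability_setT _ _ _ mu) mulr1.
  move=> /eqP.
  by rewrite -[X in _ == X]addr0 (inj_eq (addrI _)) => /eqP.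
have per : expi (a%:~R * (pi *+ 2)) = 1 :> R[i] by exact: expi_2piz.
split; apply: shift => //.
- by move=> t; exact: cos_max.
- apply: (@integral_trig_itv (fun t => t + a%:~R^-1 * sin (a%:~R * t))).
  + move=> t.
    apply: is_derive_eq (is_derive_lin_comp _ _ _ (@is_derive_sin R)) _.
    by rewrite mulrCA mulVf // mulr1.
  + by move=> t; apply: cvgD; [exact: cvg_cst|exact: mc].
  + by move: per => [_ ->]; rewrite !mulr0 sin0 !mulr0 !addr0 add0r.
  + by move=> t; have := cos_geN1 (a%:~R * t); lra.
- by move=> t; exact: sin_max.
- apply: (@integral_trig_itv (fun t => t + - a%:~R^-1 * cos (a%:~R * t))).
  + move=> t.
    apply: is_derive_eq (is_derive_lin_comp _ _ _ (@is_derive_cos R)) _.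
    by move: (sin _) => u; field.
  + by move=> t; apply: cvgD; [exact: cvg_cst|exact: ms].
  + by move: per => [-> _]; rewrite mulr0 cos0; ring.
  + by move=> t; have := sin_geN1 (a%:~R * t); lra.
Qed.
End TorusIntegral.

(** * Integrals of complex functions on the torus *)

Section TorusCintegral.
Variables (R : realType) (d : nat).
Local Notation mu := (torus_measure R d).
Implicit Types (f g : Rn R d -> R[i]).

Definition Cintegrable f :=
  Cmeasurable f /\ (\int[mu]_x (normc (f x))%:E < +oo)%E.

Lemma measurable_normc f : Cmeasurable f ->
  measurable_fun [set: Rn R d] (fun x => normc (f x)).
Proof.
move=> [mr mi].
have -> : (fun x => normc (f x)) =
    Num.sqrt \o (fun x => complex.Re (f x) ^+ 2 + complex.Im (f x) ^+ 2).
  by apply/funext => x /=; case: (f x).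
apply: measurableT_comp.
  by apply: continuous_measurable_fun; exact: sqrt_continuous.
by apply: measurable_funD; exact: measurable_funX.
Qed.

Lemma Cmeasurable_cst (c : R[i]) : Cmeasurable (fun _ : Rn R d => c).
Proof. by split; exact: measurable_cst. Qed.

Lemma CmeasurableD f g : Cmeasurable f -> Cmeasurable g ->
  Cmeasurable (fun x => f x + g x).
Proof.
move=> [fr fi] [gr gi]; split.
  by under eq_fun do rewrite ReD; exact: measurable_funD.
by under eq_fun do rewrite ImD; exact: measurable_funD.
Qed.

Lemma CmeasurableM f g : Cmeasurable f -> Cmeasurable g ->
  Cmeasurable (fun x => f x * g x).
Proof.
move=> [fr fi] [gr gi]; split.
  by under eq_fun do rewrite ReM; apply: measurable_funB; exact: measurable_funM.
by under eq_fun do rewrite ImM; apply: measurable_funD; exact: measurable_funM.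
Qed.

Lemma Cmeasurable_sum (I : Type) (s : seq I) (F : I -> Rn R d -> R[i]) :
  (forall i, Cmeasurable (F i)) -> Cmeasurable (fun x => \sum_(i <- s) F i x).
Proof.
move=> mF; split.
  under eq_fun do rewrite Re_sum.
  by apply: measurable_sum => i; have [] := mF i.
under eq_fun do rewrite Im_sum.
by apply: measurable_sum => i; have [] := mF i.
Qed.

Lemma measurable_zdot (k : d.-tuple int) :
  measurable_fun [set: Rn R d] (fun x : Rn R d => zdot k x).
Proof.
apply: measurable_sum => l.
by apply: measurable_funM; [exact: measurable_cst|exact: measurable_tnth].
Qed.

Lemma Cmeasurable_cexp (k : d.-tuple int) : Cmeasurable (@cexp R d k).
Proof.
split.
  apply: (@measurableT_comp _ _ _ _ _ _ (@cos R)); last exact: measurable_zdot.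
  apply: continuous_measurable_fun; exact: continuous_cos.
apply: (@measurableT_comp _ _ _ _ _ _ (@sin R)); last exact: measurable_zdot.
apply: continuous_measurable_fun; exact: continuous_sin.
Qed.

Lemma Cintegrable_ReIm f : Cintegrable f ->
  mu.-integrable setT (fun x => (complex.Re (f x))%:E) /\
  mu.-integrable setT (fun x => (complex.Im (f x))%:E).
Proof.
move=> [[mr mi] fo].
have mn := measurable_normc (conj mr mi).
split; apply/integrableP; split; try exact/measurable_EFinP.
  apply: le_lt_trans fo; apply: ge0_le_integral => //.
  - by apply/measurable_EFinP; exact: measurableT_comp.
  - exact/measurable_EFinP.
  - by move=> x _ /=; rewrite lee_fin Re_le_normc.
apply: le_lt_trans fo; apply: ge0_le_integral => //.
- by apply/measurable_EFinP; exact: measurableT_comp.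
- exact/measurable_EFinP.
- by move=> x _ /=; rewrite lee_fin Im_le_normc.
Qed.

Lemma le_Cintegrable f g : Cmeasurable f -> Cintegrable g ->
  (forall x, normc (f x) <= normc (g x)) -> Cintegrable f.
Proof.
move=> mf [mg goo] fg; split => //; apply: le_lt_trans goo.
apply: ge0_le_integral => //.
- by move=> x _; rewrite lee_fin normc_ge0.
- by apply/measurable_EFinP; apply: measurable_normc.
- by apply/measurable_EFinP; apply: measurable_normc.
- by move=> x _; rewrite lee_fin.
Qed.

Lemma integral_torus_cst (c : R) : (\int[mu]_x c%:E = c%:E)%E.
Proof.
have := @integral_cst _ _ _ mu setT measurableT c%:E.
by rewrite /cst [X in (_ * X)%E]probability_setT mule1.
Qed.

Lemma Cintegrable_cst (c : R[i]) : Cintegrable (fun=> c).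
Proof.
split; first exact: Cmeasurable_cst.
by rewrite (integral_torus_cst (normc c)) ltry.
Qed.

Lemma CintegrableD f g : Cintegrable f -> Cintegrable g ->
  Cintegrable (fun x => f x + g x).
Proof.
move=> [mf fo] [mg go]; split; first exact: CmeasurableD.
have mf' := measurable_normc mf; have mg' := measurable_normc mg.
apply: le_lt_trans (_ : \int[mu]_x ((normc (f x))%:E + (normc (g x))%:E) < _)%E.
  apply: ge0_le_integral => //.
  - by move=> x _; rewrite lee_fin normc_ge0.
  - by apply/measurable_EFinP; apply: measurable_normc; exact: CmeasurableD.
  - by apply: emeasurable_funD; exact/measurable_EFinP.
  - by move=> x _; rewrite -EFinD lee_fin normcD.
rewrite ge0_integralD //; first exact: lte_add_pinfty.
- by move=> x _; rewrite lee_fin normc_ge0.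
- exact/measurable_EFinP.
- by move=> x _; rewrite lee_fin normc_ge0.
- exact/measurable_EFinP.
Qed.

Lemma CintegrableZ (c : R[i]) f : Cintegrable f -> Cintegrable (fun x => c * f x).
Proof.
move=> [mf fo]; split; first by apply: CmeasurableM => //; exact: Cmeasurable_cst.
have mf' := measurable_normc mf.
under eq_integral do rewrite normcM EFinM.
rewrite ge0_integralZl //; first by rewrite lte_mul_pinfty // lee_fin normc_ge0.
- exact/measurable_EFinP.
- by move=> x _; rewrite lee_fin normc_ge0.
- by rewrite lee_fin normc_ge0.
Qed.

Lemma Cintegrable_sum (I : Type) (s : seq I) (F : I -> Rn R d -> R[i]) :
  (forall i, Cintegrable (F i)) -> Cintegrable (fun x => \sum_(i <- s) F i x).
Proof.
move=> h; elim: s => [|i s IH].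
  by under eq_fun do rewrite big_nil; exact: Cintegrable_cst.
by under eq_fun do rewrite big_cons; exact: CintegrableD.
Qed.

Lemma Cintegral_cst (c : R[i]) : Cintegral (fun _ : Rn R d => c) = c.
Proof.
by rewrite /Cintegral /Rintegral !integral_torus_cst; case: c.
Qed.

Lemma CintegralD f g : Cintegrable f -> Cintegrable g ->
  Cintegral (fun x => f x + g x) = Cintegral f + Cintegral g.
Proof.
move=> /Cintegrable_ReIm [fr fi] /Cintegrable_ReIm [gr gi].
rewrite /Cintegral /GRing.add /=; congr Complex.
  by rewrite -RintegralD //; apply: eq_Rintegral => x _; rewrite ReD.
by rewrite -RintegralD //; apply: eq_Rintegral => x _; rewrite ImD.
Qed.

Lemma CintegralZ (c : R[i]) f : Cintegrable f ->
  Cintegral (fun x => c * f x) = c * Cintegral f.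
Proof.
move=> /Cintegrable_ReIm [fr fi].
have zr (a : R) (h : Rn R d -> R) : mu.-integrable setT (fun x => (h x)%:E) ->
    mu.-integrable setT (fun x => (a * h x)%:E).
  by move=> hh; under eq_fun do rewrite EFinM; exact: integrableZl.
rewrite /Cintegral; apply/eqP; rewrite eq_complex ReM ImM /=.
rewrite -!RintegralZl //.
rewrite -RintegralB // -?RintegralD //; try exact: zr.
apply/andP; split; apply/eqP; apply: eq_Rintegral => x _; by rewrite ?ReM ?ImM.
Qed.

Lemma Cintegral_sum (I : Type) (s : seq I) (F : I -> Rn R d -> R[i]) :
  (forall i, Cintegrable (F i)) ->
  Cintegral (fun x => \sum_(i <- s) F i x) = \sum_(i <- s) Cintegral (F i).
Proof.
move=> h; elim: s => [|i s IH].
  by under eq_fun do rewrite big_nil; rewrite big_nil Cintegral_cst.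
under eq_fun do rewrite big_cons.
by rewrite big_cons CintegralD ?IH //; exact: Cintegrable_sum.
Qed.

Lemma eq_Cintegral f g : f =1 g -> Cintegral f = Cintegral g.
Proof. by move=> /funext ->. Qed.

(** The real and imaginary parts are bounded separately; the factor [2] is harmless for estimates up
    to constants. *)
Lemma normc_Cintegral f : Cintegrable f ->
  ((normc (Cintegral f))%:E <= 2%:E * \int[mu]_x (normc (f x))%:E)%E.
Proof.
move=> If; have [fr fi] := Cintegrable_ReIm If.
have [mf _] := If; have mf' := measurable_normc mf.
apply: le_trans (_ : (`|complex.Re (Cintegral f)|)%:E +
  (`|complex.Im (Cintegral f)|)%:E <= _)%E.
  by rewrite -EFinD lee_fin normc_le_ReIm.
have -> : (2%:E = 1%:E + 1%:E :> \bar R)%E by rewrite -EFinD -[2]/(1 + 1).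
rewrite ge0_muleDl ?mul1e ?lee_fin //.
apply: leeD.
  rewrite /Cintegral /= EFin_normr_Rintegral //.
  apply: le_trans (le_abse_integral _ _ _) _ => //.
    by have /integrableP[] := fr.
  apply: ge0_le_integral => //.
  - by have /integrableP[? _] := fr; exact: measurableT_comp.
  - exact/measurable_EFinP.
  - by move=> x _; rewrite lee_fin Re_le_normc.
rewrite /Cintegral /= EFin_normr_Rintegral //.
apply: le_trans (le_abse_integral _ _ _) _ => //.
  by have /integrableP[] := fi.
apply: ge0_le_integral => //.
- by have /integrableP[? _] := fi; exact: measurableT_comp.
- exact/measurable_EFinP.
- by move=> x _; rewrite lee_fin Im_le_normc.
Qed.

Lemma bounded_Cintegrable f (M : R) : Cmeasurable f ->
  (forall x, normc (f x) <= M) -> Cintegrable f.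
Proof.
move=> mf hM; apply: le_Cintegrable mf (Cintegrable_cst M%:C) _ => x.
by rewrite normcC; apply: le_trans (hM x) (ler_norm _).
Qed.

Lemma Cintegrable_cexp (k : d.-tuple int) : Cintegrable (@cexp R d k).
Proof.
apply: (@bounded_Cintegrable _ 1); first exact: Cmeasurable_cexp.
by move=> x; rewrite normc_cexp.
Qed.

End TorusCintegral.

(** * Fubini on the torus and orthogonality of the characters *)

Section Orthogonality.
Variable R : realType.
Local Notation nu := (uniform_prob (@twopi_gt0 R)).

Lemma Rintegral_cons_pair d (f : Rn R d.+1 -> R) (M : R) :
  measurable_fun setT f -> (forall x, `|f x| <= M) ->
  \int[torus_measure R d.+1]_x f x =
  \int[nu]_t (\int[torus_measure R d]_x f (cons_pair (t, x))).
Proof.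
move=> mf fM.
have mg : measurable_fun setT (f \o @cons_pair R d).
  by apply: measurableT_comp => //; exact: measurable_cons_pair.
pose P : probability _ R := (nu \x torus_measure R d)%E.
have Ig : P.-integrable setT (EFin \o (f \o @cons_pair R d)).
  apply: measurable_bounded_integrable => //.
  - by rewrite (le_lt_trans (probability_le1 _ _)) // ltry.
  - by exists M; split; [exact: num_real|move=> N MN t _; apply: le_trans (fM _) _; exact: ltW].
rewrite /Rintegral.
rewrite (@integral_distribution _ _ _ _ _ P (@cons_pair R d) (EFin \o f)) //; last first.
  exact/measurable_EFinP.
rewrite -integral12_prod_meas1 //; congr fine; apply: eq_integral => t _.
rewrite /fubini_F fineK // ; apply: integrable_fin_num => //.
apply: (@measurable_bounded_integrable _ _ _ (torus_measure R d)
   (fun x => f (cons_pair (t, x)))) => //.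
- by rewrite (le_lt_trans (probability_le1 _ _)) // ltry.
- by apply: (measurableT_comp mg); exact: pair1_measurable.
- by exists M; split; [exact: num_real|move=> N MN x _; apply: le_trans (fM _) _; exact: ltW].
Qed.

Lemma cexp0 d (x : Rn R d) : cexp [tuple 0 | _ < d] x = 1.
Proof.
rewrite cexpE /zdot big1 ?expi0 // => l _.
by rewrite tnth_mktuple mul0r.
Qed.

Lemma Cintegral_cexp d (k : d.-tuple int) :
  Cintegral (@cexp R d k) = (k == [tuple 0 | _ < d])%:R.
Proof.
elim: d k => [|d IH] k.
  have -> : (k == [tuple 0 | _ < 0]) = true by rewrite (tuple0 k) [X in _ == X]tuple0; apply/eqP.
  rewrite -[RHS](@Cintegral_cst R 0); apply: eq_Cintegral => x.
  by rewrite cexpE /zdot big_ord0 expi0.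
have [a [l kE]] := zconsP k.
have -> : (k == [tuple 0 | _ < d.+1]) = (a == 0) && (l == [tuple 0 | _ < d]).
  have -> : [tuple 0 | _ < d.+1] = zcons (0 : int) [tuple 0 | _ < d].
    apply: eq_from_tnth => i; rewrite tnth_mktuple.
    by case: (unliftP ord0 i) => [j|] ->; rewrite ?tnth_zcons0 ?tnth_zconsS ?tnth_mktuple.
  rewrite kE; apply/eqP/andP => [/zcons_inj[-> ->]|[/eqP-> /eqP->]] //.
have [mr mi] := Cmeasurable_cexp R k.
have [Ir Ii] := Cintegrable_ReIm (Cintegrable_cexp R l).
have bnd1 x : `|complex.Re (cexp k x : R[i])| <= 1.
  by rewrite -(normc_cexp k x) Re_le_normc.
have bnd2 x : `|complex.Im (cexp k x : R[i])| <= 1.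
  by rewrite -(normc_cexp k x) Im_le_normc.
set A := Cintegral (@cexp R d l).
have zr (b : R) (h : Rn R d -> R) : (torus_measure R d).-integrable setT (fun x => (h x)%:E) ->
    (torus_measure R d).-integrable setT (fun x => (b * h x)%:E).
  by move=> hh; under eq_fun do rewrite EFinM; exact: integrableZl.
have -> : Cintegral (@cexp R d.+1 k) =
   (\int[nu]_t (cos (a%:~R * t) * complex.Re A - sin (a%:~R * t) * complex.Im A)) +i*
   (\int[nu]_t (cos (a%:~R * t) * complex.Im A + sin (a%:~R * t) * complex.Re A)).
  rewrite /Cintegral; congr Complex.
    rewrite (Rintegral_cons_pair mr bnd1); apply: eq_Rintegral => t _.
    rewrite -!RintegralZl // -RintegralB //; try exact: zr.
    by apply: eq_Rintegral => x _; rewrite kE cexp_zcons ReM.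
  rewrite (Rintegral_cons_pair mi bnd2); apply: eq_Rintegral => t _.
  rewrite -!RintegralZl // -RintegralD //; try exact: zr.
  by apply: eq_Rintegral => x _; rewrite kE cexp_zcons ImM.
rewrite /A IH.
have cst0 : \int[nu]_t (0 : R) = 0 by rewrite Rintegral_cst // mul0r.
have [l0|l0] := eqVneq l; last first.
  rewrite andbF /=; under eq_Rintegral do rewrite !mulr0 subr0.
  by under [X in _ +i* X]eq_Rintegral do rewrite !mulr0 addr0; rewrite cst0.
rewrite andbT /=; under eq_Rintegral do rewrite mulr1 mulr0 subr0.
under [X in _ +i* X]eq_Rintegral do rewrite mulr1 mulr0 add0r.
have [->|a0] := eqVneq a 0; last by have [-> ->] := integral_cos_sin_uniform R a0.
under eq_Rintegral do rewrite mul0r cos0.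
under [X in _ +i* X]eq_Rintegral do rewrite mul0r sin0.
rewrite cst0 Rintegral_cst // (_ : fine _ = 1) ?mulr1 //.
by rewrite [X in fine X](@probability_setT _ _ _ nu).
Qed.

End Orthogonality.

(** * Moments of polynomials with spectrum in one layer *)

Section LayerMoments.
Variables (R : realType) (d : nat).
Implicit Types (c : d.-tuple int -> R[i]) (k l : d.-tuple int).

Definition lpoly n c (x : Rn R d) : R[i] := \sum_(k <- layer d n) c k * cexp k x.

Definition fcoef (u : Rn R d -> R[i]) k : R[i] :=
  Cintegral (fun x => u x * cexp (zopp k) x).

Definition coef_le1 c := forall k, normc (c k) <= 1.

(** The factors have separate coefficient families because a polynomial and its conjugate both occur
    in an even moment. Membership in [cs] is expressed by [List.In], the families having no
    decidable equality. *)
Definition lprod n (cs : seq (d.-tuple int -> R[i])) (x : Rn R d) : R[i] :=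
  \prod_(c <- cs) lpoly n c x.

Lemma zoppK : involutive (@zopp d).
Proof. by move=> k; apply: eq_from_tnth => i; rewrite !tnth_mktuple opprK. Qed.

Lemma Cmeasurable_lpoly n c : Cmeasurable (lpoly n c).
Proof.
apply: Cmeasurable_sum => k.
by apply: CmeasurableM; [exact: Cmeasurable_cst|exact: Cmeasurable_cexp].
Qed.

Lemma normc_lpoly n c x : coef_le1 c -> normc (lpoly n c x) <= (size (layer d n))%:R.
Proof.
move=> hc; apply: le_trans (normc_sum _ _ _) _.
rewrite -sum1_size natr_sum; apply: ler_sum => k _.
by rewrite normcM normc_cexp mulr1.
Qed.

Lemma Cmeasurable_lprod n cs : Cmeasurable (lprod n cs).
Proof.
elim: cs => [|c cs IH]; rewrite /lprod.
  by under eq_fun do rewrite big_nil; exact: Cmeasurable_cst.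
under eq_fun do rewrite big_cons; apply: CmeasurableM => //.
exact: Cmeasurable_lpoly.
Qed.

Lemma normc_lprod n cs x : (forall c, List.In c cs -> coef_le1 c) ->
  normc (lprod n cs x) <= (size (layer d n))%:R ^+ size cs.
Proof.
elim: cs => [|c cs IH] h; first by rewrite /lprod big_nil normc_one.
rewrite /lprod big_cons normcM exprS ler_pM ?normc_ge0 //.
  by apply: normc_lpoly; apply: h; left.
by apply: IH => c' h'; apply: h; right.
Qed.

Lemma Cintegrable_lprod_cexp n cs k : (forall c, List.In c cs -> coef_le1 c) ->
  Cintegrable (fun x => lprod n cs x * cexp k x).
Proof.
move=> h; apply: (@bounded_Cintegrable _ _ _ ((size (layer d n))%:R ^+ size cs)).
  by apply: CmeasurableM; [exact: Cmeasurable_lprod|exact: Cmeasurable_cexp].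
by move=> x; rewrite normcM normc_cexp mulr1 normc_lprod.
Qed.

Lemma fcoef_lprodS n c cs k : (forall c0, List.In c0 (c :: cs) -> coef_le1 c0) ->
  fcoef (lprod n (c :: cs)) k =
  \sum_(l <- layer d n) c l * fcoef (lprod n cs) (zsub k l).
Proof.
move=> h.
have h' c' : List.In c' cs -> coef_le1 c' by move=> ?; apply: h; right.
rewrite /fcoef -(eq_bigr _ (fun l _ => CintegralZ (c l)
   (Cintegrable_lprod_cexp n (zopp (zsub k l)) h'))).
rewrite -Cintegral_sum; last first.
  by move=> l; apply: CintegrableZ; exact: Cintegrable_lprod_cexp.
apply: eq_Cintegral => x; rewrite /lprod big_cons {1}/lpoly !mulr_suml.
apply: eq_bigr => l _.
have -> : zopp (zsub k l) = zadd l (zopp k).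
  by apply: eq_from_tnth => i; rewrite !tnth_mktuple opprB.
by rewrite cexp_zadd; ring.
Qed.

Lemma fcoef1 k : fcoef (fun=> 1) k = (k == [tuple 0 | _ < d])%:R.
Proof.
rewrite /fcoef; under eq_Cintegral do rewrite mul1r.
rewrite Cintegral_cexp; congr (_%:R); congr nat_of_bool.
apply/eqP/eqP => [h|->]; last first.
  by apply: eq_from_tnth => i; rewrite !tnth_mktuple oppr0.
by rewrite -[k]zoppK h; apply: eq_from_tnth => i; rewrite !tnth_mktuple oppr0.
Qed.

Lemma fcoef_layer n c k : coef_le1 c ->
  normc (fcoef (lprod n [:: c]) k) <= (level k == n)%:R.
Proof.
move=> hc; rewrite fcoef_lprodS; last by move=> c' /= [<-|].
have E l : fcoef (lprod n [::]) (zsub k l) = (l == k)%:R.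
  have -> : lprod n [::] = fun=> 1.
    by apply/funext => x; rewrite /lprod big_nil.
  rewrite fcoef1; congr (_%:R); congr nat_of_bool; apply/eqP/eqP => [h|->]; last first.
    by apply: eq_from_tnth => i; rewrite !tnth_mktuple subrr.
  apply: eq_from_tnth => i; have := congr1 (fun t => tnth t i) h.
  by rewrite !tnth_mktuple => /eqP; rewrite subr_eq0 => /eqP.
under eq_bigr do rewrite E.
have [kn|kn] := boolP (level k == n).
  rewrite (bigD1_seq k) ?mem_layer ?uniq_layer //= eqxx mulr1 big1 ?addr0 //.
  by move=> l /negPf ->; rewrite mulr0.
rewrite big_seq big1 ?normc_zero // => l; rewrite mem_layer => ln.
case: eqP => [lk|_]; last by rewrite mulr0.
by move: kn; rewrite -lk ln.
Qed.

(* On the layer [n] one has [(2 / tau) ^+ n * (tau / 2) ^+ level k = 1]: this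
   replaces the cut-off to the layer by a product weight, for which the
   convolution of one more factor is a one-dimensional matter. *)
Lemma fcoef_lprod_le (tau : R) j : 1 < tau -> (0 < j)%N -> tau ^+ j < 2 ->
  exists2 C : R, 0 < C & forall n cs k, size cs = j ->
  (forall c, List.In c cs -> coef_le1 c) ->
  normc (fcoef (lprod n cs) k) <=
    C * ((2 / tau) ^+ n) ^+ j * (tau ^+ j / 2) ^+ level k.
Proof.
move=> tau1; have tau0 : 0 < tau by apply: lt_trans tau1.
case: j => // j _; elim: j => [|j IH] tau2.
  exists 1 => // n [//|c []] //= k _ hc.
  have := @fcoef_layer n c k (hc _ (or_introl erefl)).
  move/le_trans; apply; rewrite mul1r !expr1.
  case: eqP => [->|_]; last by rewrite mulr_ge0 ?exprn_ge0 ?divr_ge0 // ltW.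
  rewrite -exprMn (_ : _ * _ = 1) ?expr1n //.
  by field; rewrite gt_eqF.
have tauj : tau ^+ j.+1 < 2.
  apply: le_lt_trans tau2; rewrite [X in _ <= X]exprS ler_peMl ?exprn_ge0 ?ltW //.
have [C C0 HC] := IH tauj.
have tauj1 : 1 < tau ^+ j.+1 by rewrite exprn_egt1.
have tau2' : tau < 2.
  apply: le_lt_trans tauj; rewrite exprS ler_peMr ?(ltW tau0) //.
  by rewrite exprn_ege1 // ltW.
(* The weights are [x = tau^(j+1) / 2] for the product so far and [y = tau / 2] for the new factor,
   so [2 x y = tau^(j+2) / 2]; the condition [2 x y < 1] is what limits the number of factors for a
   given [tau]. *)
have [D D0 HD] : exists2 D : R, 0 < D & forall k (B : nat),
  \sum_(l <- box d B) (tau ^+ j.+1 / 2) ^+ level (zsub k l) * (tau / 2) ^+ level l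
   <= D * (2 * (tau ^+ j.+1 / 2) * (tau / 2)) ^+ level k.
  apply: conv_level.
  - by apply/andP; split; lra.
  - by apply/andP; split; lra.
  - by lra.
  - by lra.
  - rewrite [X in X < _](_ : _ = tau ^+ j.+2 / 2); first lra.
    by rewrite [tau ^+ j.+2]exprSr; field.
exists (C * D); first exact: mulr_gt0.
move=> n [//|c cs] k [sc] hc.
rewrite fcoef_lprodS //; apply: le_trans (normc_sum _ _ _) _.
have hc' c' : List.In c' cs -> coef_le1 c' by move=> ?; apply: hc; right.
set P := (2 / tau) ^+ n.
have P0 : 0 < P by rewrite exprn_gt0 // divr_gt0.
apply: le_trans (_ : C * P ^+ j.+2 * \sum_(l <- layer d n)
   (tau ^+ j.+1 / 2) ^+ level (zsub k l) * (tau / 2) ^+ level l <= _).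
  rewrite mulr_sumr big_seq [X in _ <= X]big_seq; apply: ler_sum => l.
  rewrite mem_layer => /eqP ln; rewrite normcM.
  apply: le_trans (_ : normc (fcoef (lprod n cs) (zsub k l)) <= _).
    by rewrite ler_piMl ?normc_ge0 //; apply: hc; left.
  apply: le_trans (HC n cs _ sc hc') _; rewrite -/P ln.
  have -> : C * P ^+ j.+2 * ((tau ^+ j.+1 / 2) ^+ level (zsub k l) * (tau / 2) ^+ n) =
     C * P ^+ j.+1 * (tau ^+ j.+1 / 2) ^+ level (zsub k l) * (P * (tau / 2) ^+ n).
    by rewrite [P ^+ j.+2]exprSr; ring.
  rewrite /P -exprMn (_ : 2 / tau * (tau / 2) = 1) ?expr1n ?mulr1 //.
  by field; rewrite gt_eqF.
have -> : C * D * P ^+ j.+2 * (tau ^+ j.+2 / 2) ^+ level k =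
  C * P ^+ j.+2 * (D * (tau ^+ j.+2 / 2) ^+ level k) by ring.
have CP0 : 0 <= C * P ^+ j.+2 by rewrite ltW // mulr_gt0 // exprn_gt0.
rewrite (ler_wpM2l CP0) //.
apply: le_trans (_ : \sum_(l <- box d n)
   (tau ^+ j.+1 / 2) ^+ level (zsub k l) * (tau / 2) ^+ level l <= _).
  apply: (@ler_sum_sub R _ _ _ (fun l => (tau ^+ j.+1 / 2) ^+ level (zsub k l) *
    (tau / 2) ^+ level l)); first exact: uniq_layer.
    by move=> l; rewrite mem_filter => /andP[].
  by move=> l; rewrite mulr_ge0 ?exprn_ge0 ?divr_ge0 ?exprn_ge0 // ltW.
apply: le_trans (HD k n) _.
rewrite [2 * _ * _](_ : _ = tau ^+ j.+2 / 2) //.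
by rewrite [tau ^+ j.+2]exprSr; field.
Qed.

Lemma perm_zopp_layer n : perm_eq (layer d n) (map (@zopp d) (layer d n)).
Proof.
apply: uniq_perm; rewrite ?map_inj_uniq ?uniq_layer //; first exact: inv_inj zoppK.
move=> k; apply/idP/mapP => [h|[l h ->]]; last by rewrite mem_zopp_layer.
by exists (zopp k); rewrite ?mem_zopp_layer ?zoppK.
Qed.

Lemma conj_lpoly n c x :
  conjc (lpoly n c x) = lpoly n (fun k => conjc (c (zopp k))) x.
Proof.
rewrite /lpoly [RHS](perm_big _ (perm_zopp_layer n)) /= big_map rmorph_sum /=.
by apply: eq_bigr => k _; rewrite zoppK rmorphM /= cexp_zopp.
Qed.

(** The moment is the zeroth Fourier coefficient of a product of [2 l + 2] factors. One factor is
    kept aside: pairing it with the others leaves an unweighted sum over the layer, whose terms are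
    [O(2^(2 l n))]. The size of the layer, and with it the power of [n], therefore enters once
    whatever [l] is. *)
Lemma integral_lpoly_even (l : nat) : exists2 C : R, 0 < C & forall n c,
  coef_le1 c ->
  (\int[torus_measure R d]_x (normc (lpoly n c x) ^+ (2 * l.+1))%:E <=
   (C * (size (layer d n))%:R * 2 ^+ (n * (2 * l)))%:E)%E.
Proof.
(* With this root of [2], the [2 l + 1] remaining factors stay below the threshold
   [tau ^+ j < 2]. *)
pose tau : R := 2 `^ (2 * l.+1)%:R^-1.
have tau0 : 0 < tau by rewrite powR_gt0.
have tauL : tau ^+ (2 * l.+1) = 2.
  by rewrite -powR_mulrn ?(ltW tau0) // -powRrM mulVf ?pnatr_eq0 // powRr1.
have tau1 : 1 < tau.
  rewrite ltNge; apply/negP => h.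
  have : tau ^+ (2 * l.+1) <= 1 by rewrite exprn_ile1 // ltW.
  rewrite tauL; lra.
have e1 : (2 * l.+1)%N = (2 * l).+2 by rewrite mulnS.
have tauj : tau ^+ (2 * l).+1 < 2.
  by rewrite -tauL e1 [X in _ < X]exprS ltr_pMl ?exprn_gt0.
have [C C0 HC] := fcoef_lprod_le tau1 (ltn0Sn _) tauj.
exists C => // n c hc.
pose c' k := conjc (c (zopp k)).
have hc' : coef_le1 c' by move=> k; rewrite /c' normc_conj.
(* [c'] gives the conjugate polynomial; together with the [c] kept aside there are [l.+1] factors of
   each kind. *)
pose cs := nseq l c ++ nseq l.+1 c'.
have hcs c0 : List.In c0 (c :: cs) -> coef_le1 c0.
  have In_nseq m a : List.In c0 (nseq m a) -> coef_le1 a -> coef_le1 c0.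
    by elim: m => //= m IH [<-//|/IH].
  case=> [<-//|h]; case: (List.in_app_or _ _ _ h) => {}h; exact: In_nseq h _.
have hcs' c0 : List.In c0 cs -> coef_le1 c0 by move=> h; apply: hcs; right.
have E x : (normc (lpoly n c x) ^+ (2 * l.+1))%:C = lprod n (c :: cs) x.
  have lprod_nseq m c0 s : lprod n (nseq m c0 ++ s) x = lpoly n c0 x ^+ m * lprod n s x.
    elim: m => [|m IH]; first by rewrite mul1r.
    by rewrite /lprod big_cons -/(lprod n _ x) IH mulrA -exprS.
  rewrite /lprod big_cons -/(lprod n cs x) /cs lprod_nseq.
  rewrite -[nseq l.+1 c']cats0 lprod_nseq /lprod big_nil mulr1 -conj_lpoly mulrA -exprS.
  by rewrite -exprMn normc_conjM exprM rmorphXn.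
have scs : size cs = (2 * l).+1 by rewrite size_cat !size_nseq addnS addnn mul2n.
have bnd x : normc (lprod n (c :: cs) x) <= (size (layer d n))%:R ^+ (size cs).+1.
  exact: normc_lprod.
have I0 := bounded_Cintegrable (Cmeasurable_lprod n (c :: cs)) bnd.
have [Ir _] := Cintegrable_ReIm I0.
have -> : (\int[torus_measure R d]_x (normc (lpoly n c x) ^+ (2 * l.+1))%:E =
   (complex.Re (Cintegral (lprod n (c :: cs))))%:E)%E.
  rewrite /= /Rintegral fineK; last exact: integrable_fin_num.
  by apply: eq_integral => x _; rewrite -E.
rewrite lee_fin; apply: le_trans (ler_norm _) _; apply: le_trans (Re_le_normc _) _.
have -> : Cintegral (lprod n (c :: cs)) = fcoef (lprod n (c :: cs)) [tuple 0 | _ < d].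
  apply: eq_Cintegral => x.
  have -> : zopp [tuple 0 | _ < d] = [tuple 0 | _ < d].
    by apply: eq_from_tnth => i; rewrite !tnth_mktuple oppr0.
  by rewrite cexp0 mulr1.
rewrite fcoef_lprodS //; apply: le_trans (normc_sum _ _ _) _.
apply: le_trans (_ : \sum_(k <- layer d n) C * 2 ^+ (n * (2 * l)) <= _); last first.
  rewrite big_const_seq count_predT iter_addr_0 -[X in X <= _]mulr_natr.
  by rewrite -!mulrA [2 ^+ _ * _]mulrC.
rewrite big_seq [X in _ <= X]big_seq; apply: ler_sum => k; rewrite mem_layer => /eqP kn.
rewrite normcM; apply: le_trans (_ : normc (fcoef (lprod n cs) (zsub [tuple 0 | _ < d] k)) <= _).
  by rewrite ler_piMl ?normc_ge0.
apply: le_trans (HC n cs _ scs hcs') _.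
have -> : level (zsub [tuple 0 | _ < d] k) = n.
  rewrite -kn -(levelN k); congr level; apply: eq_from_tnth => i.
  by rewrite !tnth_mktuple add0r.
have -> : ((2 / tau) ^+ n) ^+ (2 * l).+1 = ((2 / tau) ^+ (2 * l).+1) ^+ n.
  by rewrite -!exprM mulnC.
rewrite -mulrA ler_pM2l // -exprMn [(n * _)%N]mulnC exprM.
rewrite le_eqVlt; apply/orP; left; apply/eqP; congr (_ ^+ n).
rewrite expr_div_n [2 ^+ (2 * l).+1]exprS.
by field; rewrite !gt_eqF ?exprn_gt0.
Qed.

End LayerMoments.

(** * From even moments to all moments, and the dual bound *)

Section LayerDuality.
Variable R : realType.

Lemma powRD_gt0 (a s t : R) : 0 < a -> a `^ (s + t) = a `^ s * a `^ t.
Proof. by move=> a0; rewrite powRD // (gt_eqF a0) implybT. Qed.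

Lemma two_powR_lt1 (b : R) : 0 < b -> 0 < (2 : R) `^ (- b) < 1.
Proof.
move=> b0; rewrite powR_gt0 //= powRN invf_lt1 ?powR_gt0 //.
rewrite -[X in X < _](powRr0 2) /powR !gt_eqF // ltr_expR mul0r.
by rewrite mulr_gt0 // ln_gt0 // ltr1n.
Qed.

(** The first term suffices for [a <= A], the second one for [a > A]. *)
Lemma powR_interpolate (p a A : R) (m : nat) : 0 <= a -> 0 < A ->
  2 <= p <= (2 * m)%:R ->
  a `^ p <= A `^ (p - 2) * a ^+ 2 + A `^ (p - (2 * m)%:R) * a ^+ (2 * m).
Proof.
move=> a0 A0 /andP[p2 pm].
have T10 : 0 <= A `^ (p - 2) * a ^+ 2 by rewrite mulr_ge0 ?powR_ge0 ?exprn_ge0.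
have T20 : 0 <= A `^ (p - (2 * m)%:R) * a ^+ (2 * m).
  by rewrite mulr_ge0 ?powR_ge0 ?exprn_ge0.
move: a0; rewrite le_eqVlt => /orP[/eqP a0|a0].
  by rewrite -a0 powR0 ?gt_eqF ?a0 ?addr_ge0 //; lra.
case: (leP a A) => aA.
  rewrite ler_wpDr //.
  have -> : a `^ p = a `^ (p - 2) * a ^+ 2.
    by rewrite -powR_mulrn ?(ltW a0) // -powRD_gt0 ?subrK.
  rewrite ler_wpM2r ?exprn_ge0 ?(ltW a0) // ge0_ler_powR ?nnegrE ?(ltW a0) ?(ltW A0) //.
  lra.
rewrite ler_wpDl //.
have -> : a `^ p = a `^ (p - (2 * m)%:R) * a ^+ (2 * m).
  by rewrite -powR_mulrn ?(ltW a0) // -powRD_gt0 ?subrK.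
rewrite ler_wpM2r ?exprn_ge0 ?(ltW a0) //.
have -> : p - (2 * m)%:R = - ((2 * m)%:R - p) by rewrite opprB.
rewrite !powRN lef_pV2 ?posrE ?powR_gt0 //.
by rewrite ge0_ler_powR ?nnegrE ?(ltW a0) ?(ltW A0) ?subr_ge0 // ltW.
Qed.

Lemma integral_lpoly_powR d (p : R) : 2 <= p ->
  exists2 C : R, 0 < C & forall n c, @coef_le1 R d.+1 c ->
  (\int[torus_measure R d.+1]_x ((normc (lpoly n c x)) `^ p)%:E <=
   (C * (2 `^ (n%:R * (p - 1)) * n.+1%:R ^+ d))%:E)%E.
Proof.
move=> p2.
pose l := Num.bound p.
have pl : p <= (2 * l.+1)%:R.
  have : p < l%:R by apply: archi_boundP; lra.
  move=> h; apply: le_trans (ltW h) _; rewrite ler_nat; lia.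
have [C0 C00 H0] := @integral_lpoly_even R d.+1 0.
have [C1 C10 H1] := @integral_lpoly_even R d.+1 l.
exists (C0 + C1); first exact: addr_gt0.
move=> n c hc; have {}H0 := H0 n c hc; have {}H1 := H1 n c hc.
set mu := torus_measure _ _ in H0 H1 *; set g := lpoly n c in H0 H1 *.
(* This cut makes the bounds of the two terms equal up to constants, both being [A^(p-2)] times the
   size of the layer. *)
pose A : R := 2 ^+ n.
have A0 : 0 < A by exact: exprn_gt0.
have mg := measurable_normc (@Cmeasurable_lpoly R d.+1 n c).
apply: le_trans (_ : \int[mu]_x ((A `^ (p - 2))%:E * (normc (g x) ^+ (2 * 1))%:E +
  (A `^ (p - (2 * l.+1)%:R))%:E * (normc (g x) ^+ (2 * l.+1))%:E) <= _)%E.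
  apply: ge0_le_integral => //.
  - by move=> x _; rewrite lee_fin powR_ge0.
  - apply/measurable_EFinP.
    by apply: (@measurableT_comp _ _ _ _ _ _ (fun t : R => t `^ p)) => //; exact: measurable_powR.
  - apply: emeasurable_funD; apply: emeasurable_funM => //; apply/measurable_EFinP;
      exact: measurable_funX.
  - move=> x _; rewrite -!EFinM -EFinD lee_fin.
    by apply: powR_interpolate; rewrite ?normc_ge0 // p2 pl.
rewrite ge0_integralD //; first last.
- by apply: emeasurable_funM => //; apply/measurable_EFinP; exact: measurable_funX.
- by move=> x _; rewrite -EFinM lee_fin mulr_ge0 ?powR_ge0 ?exprn_ge0 ?normc_ge0.
- by apply: emeasurable_funM => //; apply/measurable_EFinP; exact: measurable_funX.
- by move=> x _; rewrite -EFinM lee_fin mulr_ge0 ?powR_ge0 ?exprn_ge0 ?normc_ge0.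
rewrite !ge0_integralZl ?lee_fin ?powR_ge0 //; first last.
- by move=> x _; rewrite lee_fin exprn_ge0 ?normc_ge0.
- by apply/measurable_EFinP; exact: measurable_funX.
- by move=> x _; rewrite lee_fin exprn_ge0 ?normc_ge0.
- by apply/measurable_EFinP; exact: measurable_funX.
set S : R := (size (layer d.+1 n))%:R in H0 H1.
apply: le_trans (_ : (A `^ (p - 2))%:E * (C0 * S * 2 ^+ (n * (2 * 0)))%:E +
  (A `^ (p - (2 * l.+1)%:R))%:E * (C1 * S * 2 ^+ (n * (2 * l)))%:E <= _)%E.
  by apply: leeD; apply: lee_wpmul2l; rewrite // lee_fin powR_ge0.
have S0 : 0 <= S by rewrite ler0n.
rewrite -!EFinM -EFinD lee_fin !muln0 expr0 mulr1.
have E2 : A `^ (p - (2 * l.+1)%:R) * 2 ^+ (n * (2 * l)) = A `^ (p - 2).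
  rewrite exprM -/A -powR_mulrn ?(ltW A0) // -powRD_gt0 //.
  by congr powR; rewrite mulnS natrD; ring.
have -> : A `^ (p - 2) * (C0 * S) +
   A `^ (p - (2 * l.+1)%:R) * (C1 * S * 2 ^+ (n * (2 * l))) =
   (C0 + C1) * (A `^ (p - 2) * S).
  by rewrite [X in _ + X](_ : _ = C1 * S * A `^ (p - 2)); [ring|rewrite -E2; ring].
rewrite ler_pM2l ?addr_gt0 //.
have -> : 2 `^ (n%:R * (p - 1)) = A `^ (p - 2) * 2 ^+ n.
  rewrite -/A powRrM powR_mulrn // -/A -[X in _ * X]powRr1 ?(ltW A0) //.
  by rewrite -powRD_gt0 //; congr powR; ring.
by rewrite -mulrA ler_wpM2l ?powR_ge0 // size_layer.
Qed.

(* The sharp exponent of [n.+1] here, smaller than what Hausdorff-Young gives,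
   is that of the Hardy-Littlewood inequality restricted to one layer. *)
Lemma lpoly_duality d (q : R) : 1 < q <= 2 ->
  exists2 K : R, 0 < K & forall phi, Cmeasurable phi -> (Lqnorm q phi <= 1)%E ->
  forall n c, @coef_le1 R d.+1 c ->
  (\int[torus_measure R d.+1]_x (normc (phi x) * normc (lpoly n c x))%:E <=
   (K * (2 `^ (n%:R * q^-1) * n.+1%:R `^ (d%:R * (1 - q^-1))))%:E)%E.
Proof.
move=> /andP[q1 q2].
have q0 : 0 < q by lra.
have qi1 : q^-1 < 1 by rewrite invf_lt1.
have qi2 : 2^-1 <= q^-1 by rewrite lef_pV2 ?posrE.
pose p := (1 - q^-1)^-1.
have p0 : 0 < p by rewrite invr_gt0; lra.
have p2 : 2 <= p by rewrite -[2]invrK lef_pV2 ?posrE; lra.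
have pq : q^-1 + p^-1 = 1 by rewrite invrK; ring.
have [C C0 HC] := @integral_lpoly_powR d p p2.
exists (C `^ p^-1); first by rewrite powR_gt0.
move=> phi mphi hphi n c hc; set mu := torus_measure _ _; set g := lpoly n c.
have mg := measurable_normc (@Cmeasurable_lpoly R d.+1 n c).
have mf := measurable_normc mphi.
have H := hoelder mu mf mg q0 p0 pq.
apply: le_trans (_ : 'N[mu]_1[(fun x => (normc (phi x) * normc (g x))%:E)] <= _)%E.
  rewrite Lnorm1; apply: ge0_le_integral => //.
  - by move=> x _; rewrite lee_fin mulr_ge0 ?normc_ge0.
  - by apply/measurable_EFinP; exact: measurable_funM.
  - by apply: measurableT_comp => //; apply/measurable_EFinP; exact: measurable_funM.
  - by move=> x _; exact: lee_abs.
apply: le_trans H _.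
apply: le_trans (_ : 'N[mu]_p%:E[(fun x => (normc (g x))%:E)] <= _)%E.
  rewrite -[X in (_ <= X)%E]mul1e; apply: lee_wpmul2r => //; exact: Lnorm_ge0.
rewrite unlock /=.
have -> : (\int[mu]_x (`|(normc (g x))%:E| `^ p) = \int[mu]_x ((normc (g x)) `^ p)%:E)%E.
  by apply: eq_integral => x _; rewrite /= ger0_norm ?normc_ge0.
have B0 : 0 <= C * (2 `^ (n%:R * (p - 1)) * n.+1%:R ^+ d).
  by rewrite mulr_ge0 ?(ltW C0) // mulr_ge0 ?powR_ge0 ?exprn_ge0.
apply: le_trans (_ : ((C * (2 `^ (n%:R * (p - 1)) * n.+1%:R ^+ d))%:E `^ p^-1 <= _)%E).
  apply: gt0_ler_poweR; rewrite ?invr_ge0 ?(ltW p0) // ?in_itv /= ?leey ?andbT ?lee_fin //.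
    by lra.
    by apply: integral_ge0 => x _; rewrite lee_fin powR_ge0.
  exact: HC.
rewrite poweR_EFin lee_fin powRM ?(ltW C0) // ?mulr_ge0 ?powR_ge0 ?exprn_ge0 //.
rewrite ler_pM2l ?powR_gt0 // powRM ?powR_ge0 ?exprn_ge0 // -powRrM.
rewrite -powR_mulrn // -powRrM.
have -> : n%:R * (p - 1) * p^-1 = n%:R * q^-1.
  have -> : q^-1 = 1 - p^-1 by rewrite -pq; ring.
  by field; rewrite gt_eqF.
by rewrite (_ : d%:R * p^-1 = d%:R * (1 - q^-1)) // invrK.
Qed.

End LayerDuality.

(** * The kernel and the layers of a convolution *)

Section BernoulliKernel.
Variable R : realType.

Definition kernel_sum (r : R) (n : nat) (t : R) : R :=
  \sum_(1 <= k < n) k%:R `^ (- r) * cos (k%:R * t - r * pi / 2).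

(** Multiplied by [2 sin (t / 2)], the sum telescopes into a difference of two sines, as for the
    Dirichlet kernel. *)
Lemma cos_sum_bound (t theta : R) n : sin (t / 2) != 0 ->
  `|\sum_(1 <= k < n) cos (k%:R * t - theta)| <= `|sin (t / 2)|^-1.
Proof.
move=> st.
case: n => [|n]; first by rewrite big_geq // normr0 invr_ge0.
have -> : \sum_(1 <= k < n.+1) cos (k%:R * t - theta) =
  (sin (n%:R * t + t / 2 - theta) - sin (t / 2 - theta)) / (2 * sin (t / 2)).
  elim: n => [|n IH]; first by rewrite big_geq // mul0r add0r subrr mul0r.
  rewrite big_nat_recr //= IH.
  have -> : n.+1%:R * t + t / 2 - theta = (n.+1%:R * t - theta) + t / 2 by ring.
  have -> : n%:R * t + t / 2 - theta = (n.+1%:R * t - theta) - t / 2.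
    by rewrite -[n.+1%:R]natr1 mulrDl mul1r; lra.
  set A := n.+1%:R * t - theta; rewrite (sinB A (t / 2)) (sinD A (t / 2)).
  by move: (sin A) (cos A) (sin (_ - theta)) => u1 u2 u3; field.
rewrite normrM normfV normrM (ger0_norm (ler0n _ 2)) invfM mulrA.
rewrite ler_piMl ?invr_ge0 // ler_pdivrMr // mul1r.
by apply: le_trans (ler_normB _ _) _; rewrite [2]mulr2n lerD // sin_max.
Qed.

Lemma powRN_cvg0 (r : R) : 0 < r -> (fun n : nat => n%:R `^ (- r) : R) @ \oo --> (0 : R).
Proof.
move=> r0; apply/cvgrPdist_le => /= e e0.
near=> n; rewrite sub0r normrN ger0_norm ?powR_ge0 //.
have n1 : (0 < n)%N by near: n; exact: nbhs_infty_gt.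
have hn : e `^ (- r^-1) <= n%:R by near: n; exact: nbhs_infty_ger.
have n0 : 0 < n%:R :> R by rewrite ltr0n.
rewrite powRN -[e]invrK lef_pV2 ?posrE ?powR_gt0 ?invr_gt0 //.
have -> : e^-1 = (e `^ (- r^-1)) `^ r.
  by rewrite -powRrM mulNr mulVf ?gt_eqF // -powR_inv1 // ltW.
by rewrite ge0_ler_powR ?nnegrE ?powR_ge0 ?(ltW r0) ?(ltW n0).
Unshelve. all: by end_near. Qed.

Lemma kernel_sum_cvg (r t : R) : 0 < r -> sin (t / 2) != 0 ->
  cvgn (fun n => kernel_sum r n t).
Proof.
move=> r0 st; set theta := r * pi / 2.
pose a (k : nat) : R := k%:R `^ (- r).
pose b n := \sum_(1 <= k < n) cos (k%:R * t - theta).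
pose B := `|sin (t / 2)|^-1.
have bB n : `|b n| <= B by exact: cos_sum_bound.
have B0 : 0 <= B by rewrite invr_ge0.
pose v i := (a i.+1 - a i.+2) * b i.+2.
have adec i : a i.+2 <= a i.+1.
  rewrite /a !powRN lef_pV2 ?posrE ?powR_gt0 //.
  by rewrite ge0_ler_powR ?nnegrE ?(ltW r0) // ler_nat.
(* Summation by parts: the boundary term tends to [0], and [series v] converges absolutely because
   [b] is bounded and the differences of the decreasing [a] telescope. The shift of indices comes
   from the sum starting at [k = 1]. *)
have SE n : kernel_sum r n.+1 t = a n.+1 * b n.+1 + series v n.
  elim: n => [|n IH].
    by rewrite /kernel_sum /b /series /= !big_geq // mulr0 addr0.
  rewrite seriesSr /kernel_sum big_nat_recr //= -/(kernel_sum r n.+1 t) IH /v.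
  have -> : b n.+2 = b n.+1 + cos (n.+1%:R * t - theta) by rewrite /b big_nat_recr.
  by rewrite -/theta -/(a n.+1); ring.
have ser_cvg : cvgn (series v).
  apply: normed_cvg; apply: nondecreasing_is_cvgn.
    by apply: nondecreasing_series => i _ _; exact: normr_ge0.
  exists (B * a 1%N) => _ [n _ <-].
  apply: le_trans (_ : B * (a 1%N - a n.+1) <= _); last first.
    by rewrite ler_wpM2l // lerBlDr lerDl powR_ge0.
  change (series (fun i => `|v i|) n <= B * (a 1%N - a n.+1)).
  elim: n => [|n IH]; first by rewrite /series /= big_geq // subrr mulr0.
  rewrite seriesSr /= normrM ger0_norm ?subr_ge0 //.
  have : (a n.+1 - a n.+2) * `|b n.+2| <= (a n.+1 - a n.+2) * B.
    by rewrite ler_wpM2l ?subr_ge0.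
  lra.
have ab0 : (fun n => a n.+1 * b n.+1) @ \oo --> (0 : R).
  apply/cvgr0Pnorm_le => /= e e0.
  have := powRN_cvg0 r0 => /cvgr0Pnorm_le /(_ (e / (B + 1))).
  have BB : 0 < B + 1 by lra.
  move=> /(_ (divr_gt0 e0 BB)) [N _ hN].
  exists N => // n /= Nn; rewrite normrM.
  have := hN n.+1 (leq_trans Nn (leqnSn n)); rewrite /= -/(a n.+1) ler_pdivlMr // => h.
  apply: le_trans h; rewrite ler_wpM2l //; have := bB n.+1; lra.
apply/cvg_ex; exists (0 + limn (series v)).
rewrite -(cvg_shiftS); under eq_fun do rewrite SE.
exact: cvgD.
Qed.

Lemma cos_sin_period (t : R) (k : nat) : sin (t / 2) = 0 ->
  cos (k%:R * t) = 1 /\ sin (k%:R * t) = 0.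
Proof.
move=> st.
have e1 : expi t = 1.
  have -> : t = t / 2 + t / 2 by field.
  rewrite /expi cosD sinD st; congr Complex; last by ring.
  by have := cos2Dsin2 (t / 2); rewrite st !expr2; lra.
have : expi (k%:R * t) = 1 by rewrite mulr_natl expiMn e1 expr1n.
by case.
Qed.

Lemma kernel_sum_period (r t : R) n : sin (t / 2) = 0 -> kernel_sum r n t = kernel_sum r n 0.
Proof.
move=> st; apply: eq_bigr => k _; congr (_ * _).
by rewrite mulr0 !cosB; have [-> ->] := cos_sin_period k st; rewrite cos0 sin0.
Qed.

Lemma measurable_sin_half : measurable_fun [set: R] (fun t : R => sin (t / 2)).
Proof.
apply: continuous_measurable_fun => t.
apply: continuous_comp; last exact: continuous_sin.
exact: mulrr_continuous.
Qed.

Lemma measurable_kernel_sum r n : measurable_fun [set: R] (kernel_sum r n).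
Proof.
apply: measurable_sum => k; apply: measurable_funM => //.
apply: continuous_measurable_fun => t.
apply: continuous_comp; last exact: continuous_cos.
by apply: cvgB; [exact: mulrl_continuous|exact: cvg_cst].
Qed.

Lemma measurable_F1 (r : R) : 0 < r -> measurable_fun [set: R] (F1 r).
Proof.
move=> r0; apply: measurable_funD => //; apply: measurable_funM => //.
(* Where [sin (t / 2) = 0] the series may diverge, but there the partial sums
   do not depend on [t], so that [limn] takes one constant junk value. *)
pose T n t : R := if sin (t / 2) == 0 then limn (fun n => kernel_sum r n 0) else kernel_sum r n t.
apply: (@measurable_fun_cvg _ _ _ _ T).
  move=> n; apply: measurable_fun_ifT; last exact: measurable_kernel_sum.
    by apply: measurable_fun_eqr => //; exact: measurable_sin_half.
  exact: measurable_cst.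
move=> t _; rewrite /T; case: eqP => [st|/eqP st].
  have E : (fun n => kernel_sum r n t) = (fun n => kernel_sum r n 0).
    by apply/funext => n; exact: kernel_sum_period.
  rewrite -[X in _ --> X]/(limn (fun n => kernel_sum r n t)) E.
  exact: cvg_cst.
exact: kernel_sum_cvg.
Qed.

(** Only powers of two are kept: [kernel_sum r (2 ^ N)] uses the cosines with [k < 2 ^ N], which
    match the frequencies of [box1 N]. *)
Lemma F1_cvg (r t : R) : 0 < r -> sin (t / 2) != 0 ->
  (fun N => 1 + 2 * kernel_sum r (2 ^ N) t) @ \oo --> F1 r t.
Proof.
move=> r0 st; apply: cvgD; first exact: cvg_cst.
apply: cvgM; first exact: cvg_cst.
have h : (fun n => kernel_sum r n t) @ \oo --> limn (fun n => kernel_sum r n t) by exact: kernel_sum_cvg.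
apply: (cvg_comp _ _ _ h).
apply/cvgnyPge => A; near=> n.
by apply: (leq_trans _ (ltnW (@ltn_expl 2 n isT))); near: n; exact: nbhs_infty_ge.
Unshelve. all: by end_near. Qed.

(** The zeros form a countable set, and the uniform law is dominated by Lebesgue measure. *)
Lemma sin_half_null (t : R) :
  uniform_prob (@twopi_gt0 R) [set s | sin ((t - s) / 2) = 0] = 0%E.
Proof.
have C : countable [set s | sin ((t - s) / 2) = 0].
  apply: (@sub_countable _ _ _ (range (fun z : int => t - 2 * z%:~R * pi))).
    apply: subset_card_le => s /= hs.
    set u := (t - s) / 2 in hs.
    have pi0 := @pi_gt0 R.
    have /andP[z1 z2] := floor_itv (u / pi).
    set z := Num.floor (u / pi) in z1 z2.
    have v0 : 0 <= u - z%:~R * pi by rewrite subr_ge0 -ler_pdivlMr.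
    have v1 : u - z%:~R * pi < pi.
      by move: z2; rewrite rmorphD ltr_pdivrMr // mulrDl mul1r ltrBlDl.
    have s0 (k : nat) : sin (k%:R * pi : R) = 0.
      by elim: k => [|k IH]; rewrite ?mul0r ?sin0 // -natr1 mulrDl mul1r sinDpi IH oppr0.
    have sz (w : int) : sin (w%:~R * pi : R) = 0.
      case: w => k; first exact: s0.
      by rewrite NegzE mulrNz mulNr sinN s0 oppr0.
    have sv : sin (u - z%:~R * pi) = 0 by rewrite sinB hs sz; ring.
    have ve : u - z%:~R * pi = 0.
      apply/eqP; rewrite eq_le v0 andbT leNgt; apply/negP => vp.
      by have := @sin_gt0_pi R (u - z%:~R * pi); rewrite vp v1 sv ltxx => /(_ isT).
    by exists z => //; move/subr0_eq: ve; rewrite /u => e; rewrite -mulrA -e; field.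
  by apply: sub_countable (card_image_le _ _) _; exact: countableP.
have := @dominates_uniform_prob R _ _ (@twopi_gt0 R).
move/null_content_dominatesP; apply; last exact: countable_lebesgue_measure0.
exact: countable_measurable.
Qed.

Lemma torus_marginal_null d (j : 'I_d) (A : set R) : measurable A ->
  uniform_prob (@twopi_gt0 R) A = 0%E ->
  torus_measure R d [set y | A (tnth y j)] = 0%E.
Proof.
move=> mA A0.
have mB e (i : 'I_e) : measurable [set y : Rn R e | A (tnth y i)].
  rewrite -[X in measurable X]setTI.
  exact: (@measurable_tnth _ (measurableTypeR R) e i measurableT A mA).
elim: d j => [|d IH] j; first by case: j.
rewrite /= /distribution /pushforward /=.
case: (unliftP ord0 j) => [i|] ->.
  have -> : @cons_pair R d @^-1` [set y | A (tnth y (lift ord0 i))] =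
      setT `*` [set y | A (tnth y i)].
    apply/seteqP; split => -[t x] /=; rewrite tnthS; first by [].
    by case.
  rewrite product_measure1E //; last exact: mB.
  by rewrite [X in (_ * X)%E](IH i) mule0.
have -> : @cons_pair R d @^-1` [set y | A (tnth y ord0)] = A `*` setT.
  by apply/seteqP; split => -[t x] /=; rewrite tnth0 //; case.
by rewrite product_measure1E // [X in (X * _)%E]A0 mul0e.
Qed.

Lemma torus_ae_sin_half d (x : Rn R d) :
  {ae torus_measure R d, forall y, forall j : 'I_d, sin ((tnth x j - tnth y j) / 2) != 0}.
Proof.
pose E j := [set y : Rn R d | sin ((tnth x j - tnth y j) / 2) = 0].
have mA t : measurable [set s : R | sin ((t - s) / 2) = 0].
  have m : measurable_fun [set: R] (fun s : R => sin ((t - s) / 2)).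
    apply: (@measurableT_comp _ _ _ _ _ _ (fun t : R => sin (t / 2))) => //.
      exact: measurable_sin_half.
    by apply: measurable_funB => //.
  have := m measurableT [set 0] (measurable_set1 0).
  by rewrite setTI.
have E0 j : (torus_measure R d).-negligible (E j).
  exists (E j); split => //.
    rewrite -[X in measurable X]setTI.
    exact: (@measurable_tnth _ (measurableTypeR R) d j measurableT _ (mA (tnth x j))).
  exact: (torus_marginal_null j (mA (tnth x j)) (sin_half_null (tnth x j))).
have : (torus_measure R d).-negligible (\big[setU/set0]_(j < d) E j).
  elim/big_rec: _ => [|j B _ HB]; first exact: negligible_set0.
  exact: negligibleU.
apply: negligibleS => y /= /existsNP[j /negP]; rewrite negbK => /eqP h.
by rewrite (bigD1 j) //=; left.
Qed.

End BernoulliKernel.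

(** * Fourier coefficients of the kernel *)

Section KernelExpansion.
Variable R : realType.

(** The Fourier coefficients of [F1 r]: each cosine is split into two exponentials, and its phase
    [r pi / 2] takes the sign of the frequency. *)
Definition fhat1 (r : R) (a : int) : R[i] :=
  if a == 0 then 1
  else ((`|a|%N)%:R `^ (- r))%:C * expi (- (sgz a)%:~R * (r * pi / 2)).

Definition fhat (r : R) d (k : d.-tuple int) : R[i] := \prod_(j < d) fhat1 r (tnth k j).

Definition box_kernel (r : R) d N (x : Rn R d) : R :=
  \prod_(j < d) (1 + 2 * kernel_sum r (2 ^ N) (tnth x j)).

Lemma fhat1_cos (r t : R) j : (0 < j)%N ->
  fhat1 r j%:Z * expi (j%:Z%:~R * t) + fhat1 r (- j%:Z) * expi ((- j%:Z)%:~R * t) =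
  (2 * (j%:R `^ (- r) * cos (j%:R * t - r * pi / 2)))%:C.
Proof.
move=> j0; set u := j%:R * t - r * pi / 2.
have jz : (j%:Z == 0) = false by case: j j0 {u}.
have e1 : fhat1 r j%:Z = (j%:R `^ (- r))%:C * expi (- (r * pi / 2)).
  by rewrite /fhat1 jz absz_nat gtr0_sgz // mulN1r.
have e2 : fhat1 r (- j%:Z) = (j%:R `^ (- r))%:C * expi (r * pi / 2).
  by rewrite /fhat1 oppr_eq0 jz abszN absz_nat sgzN gtr0_sgz // rmorphN opprK mul1r.
rewrite e1 e2 -!mulrA -!expiD -mulrDr rmorphN /= mulNr -pmulrn.
have -> : - (r * (pi / 2)) + j%:R * t = u by rewrite /u; ring.
have -> : r * (pi / 2) - j%:R * t = - u by rewrite /u; ring.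
rewrite expiN /expi [in RHS]mulrCA [in RHS]rmorphM /=; congr (_ * _).
by rewrite /GRing.add /=; congr Complex; ring.
Qed.

Lemma kernel_sum_expand (r t : R) N :
  (1 + 2 * kernel_sum r (2 ^ N) t)%:C = \sum_(a <- box1 N) fhat1 r a * expi (a%:~R * t).
Proof.
elim: N => [|N IH].
  rewrite sum_box1 big_ord1 /= big_seq1 /fhat1 eqxx mul0r expi0 mulr1.
  by rewrite /kernel_sum big_geq // mulr0 addr0.
rewrite sum_box1 big_ord_recr /= -sum_box1 -IH /kernel_sum.
rewrite (@big_cat_nat _ _ _ (2 ^ N)%N) ?expn_gt0 ?leq_exp2l //=.
rewrite mulrDr addrA rmorphD /=; congr (_ + _).
rewrite big_cat /= !big_map -big_split /= mulr_sumr rmorph_sum /=.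
rewrite /index_iota expnS mul2n -addnn addnK.
apply: eq_big_seq => j; rewrite mem_iota => /andP[j1 _].
by rewrite -fhat1_cos // (leq_trans _ j1) // expn_gt0.
Qed.

Lemma box_kernel_expand (r : R) d N (x : Rn R d) :
  (box_kernel r N x)%:C = \sum_(k <- box d N) fhat r k * cexp k x.
Proof.
elim: d x => [|d IH] x.
  by rewrite /box_kernel big_ord0 /= big_seq1 /fhat big_ord0 mul1r cexpE /zdot big_ord0 expi0.
case/tupleP: x => t x.
rewrite /box_kernel big_ord_recl rmorphM /= tnth0 kernel_sum_expand sum_boxS mulr_suml.
apply: eq_bigr => a _.
under eq_bigr do rewrite tnthS.
rewrite -[\prod_(i < d) _]/(box_kernel r N x) IH mulr_sumr; apply: eq_bigr => k _.
rewrite (cexp_zcons a k t x) /fhat big_ord_recl tnth_zcons0.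
under [in RHS]eq_bigr do rewrite tnth_zconsS.
by ring.
Qed.

Lemma normc_prod (I : Type) (s : seq I) (f : I -> R[i]) :
  normc (\prod_(i <- s) f i) = \prod_(i <- s) normc (f i).
Proof.
elim/big_rec2: _ => [|i x y _ <-]; [exact: normc_one|exact: normcM].
Qed.

(** A nonzero [a] only satisfies [|a| >= 2^(level1 a - 1)]; the missing digit costs a factor [2^r]
    per coordinate. *)
Lemma normc_fhat (r : R) d (k : d.-tuple int) : 0 < r ->
  normc (fhat r k) <= 2 `^ (r * d%:R) * 2 `^ (- r * (level k)%:R).
Proof.
move=> r0.
have h a : normc (fhat1 r a) <= 2 `^ r * 2 `^ (- r * (level1 a)%:R).
  rewrite /fhat1; case: eqP => [->|/eqP a0].
    rewrite normc_one mulr0 powRr0 mulr1 -[X in X <= _](powRr0 2).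
    by rewrite ler_powR ?ler1n // ltW.
  rewrite normcM normc_expi mulr1 normcC ger0_norm ?powR_ge0 //.
  rewrite -powRD_gt0 // (_ : r + _ = ((level1 a)%:R - 1) * - r); last by ring.
  rewrite powRrM !powRN lef_pV2 ?posrE ?powR_gt0 // ?ltr0n ?absz_gt0 //.
  rewrite ge0_ler_powR ?nnegrE ?powR_ge0 ?(ltW r0) //.
  have l0 : (0 < level1 a)%N.
    by rewrite lt0n; apply: contra a0 => /eqP l; have := level1_bound a; rewrite l expn0 ltnS leqn0 absz_eq0.
  have -> : (level1 a)%:R - 1 = (level1 a).-1%:R :> R.
    by rewrite -[in LHS](prednK l0) -natr1 addrK.
  rewrite powR_mulrn // -natrX ler_nat.
  have := @level1_le a (level1 a).-1; rewrite leqNgt prednK // leqnn /= => /esym/negbT.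
  by rewrite -leqNgt.
rewrite /fhat normc_prod.
apply: le_trans (_ : \prod_(j < d) (2 `^ r * 2 `^ (- r * (level1 (tnth k j))%:R)) <= _).
  by apply: ler_prod => j _; rewrite normc_ge0 h.
rewrite big_split /= prodr_const card_ord -powR_mulrn ?powR_ge0 // -powRrM.
rewrite ler_pM2l ?powR_gt0 // /level natr_sum mulr_sumr.
elim/big_rec2: _ => [|j y z _ h2]; first by rewrite powRr0.
by rewrite powRD_gt0 // ler_pM2l ?powR_gt0.
Qed.

Lemma powR_le_exp (e b : R) : 0 <= e -> 0 < b ->
  exists2 C : R, 0 < C & forall n : nat, n.+1%:R `^ e <= C * 2 `^ (b * n%:R).
Proof.
move=> e0 b0.
have l2 : 0 < ln 2 :> R by rewrite ln_gt0 // ltr1n.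
(* The slope [del] in [ln x <= del x - ln del] must satisfy [e * del <= b * ln 2]; the denominator
   [e + 1] also allows [e = 0]. *)
pose del := b * ln 2 / (e + 1).
have e1 : 0 < e + 1 by lra.
have d0 : 0 < del by rewrite divr_gt0 // mulr_gt0.
have ed : e * del <= b * ln 2.
  rewrite /del mulrA ler_pdivrMr // mulrC ler_wpM2l ?mulr_ge0 ?(ltW b0) ?(ltW l2) //; lra.
exists (2 `^ b * expR (- (e * ln del))); first by rewrite mulr_gt0 ?powR_gt0 ?expR_gt0.
move=> n; have n0 : 0 < n.+1%:R :> R by rewrite ltr0n.
rewrite mulrAC -powRD_gt0 // {1}/powR gt_eqF // {1}/powR gt_eqF // -expRD ler_expR.
have lnx : ln n.+1%:R <= del * n.+1%:R - ln del.
  have := @expR_ge1Dx R (ln (del * n.+1%:R)).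
  have dx0 : 0 < del * n.+1%:R := mulr_gt0 d0 n0.
  rewrite lnK ?posrE // lnM ?posrE //; lra.
have := ler_wpM2l e0 lnx.
have : e * del * n.+1%:R <= b * ln 2 * n.+1%:R by rewrite ler_wpM2r // ltW.
rewrite -natr1; lra.
Qed.

End KernelExpansion.

Lemma cvg_prod_seq (R : realType) (I : Type) (s : seq I) (u : I -> nat -> R) (l : I -> R) :
  (forall i, u i @ \oo --> l i) ->
  (fun N => \prod_(i <- s) u i N) @ \oo --> \prod_(i <- s) l i.
Proof.
move=> h; elim: s => [|i s IH].
  by under eq_fun do rewrite big_nil; rewrite big_nil; exact: cvg_cst.
under eq_fun do rewrite big_cons; rewrite big_cons.
exact: cvgM.
Qed.

(** * Layers of a convolution: coefficient bounds and pointwise convergence *)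

Section ConvolutionLimit.
Variables (R : realType) (d : nat) (q r : R).
Hypothesis q12 : 1 < q <= 2.
Hypothesis rq : q^-1 < r.
Local Notation mu := (torus_measure R d.+1).

Let e := d%:R * (1 - q^-1) : R.
Let a := r - q^-1.

Let q0 : 0 < q. Proof. by case/andP: q12 => ? _; lra. Qed.
Let r0 : 0 < r. Proof. by apply: lt_trans rq; rewrite invr_gt0. Qed.
Let a0 : 0 < a. Proof. by rewrite subr_gt0. Qed.

Definition layer_weight (n : nat) : R := 2 `^ (- a * n%:R) * n.+1%:R `^ e.

Let w (n : nat) : R := 2 `^ (r * d.+1%:R) * 2 `^ (- r * n%:R).
Let w0 n : 0 < w n. Proof. by rewrite mulr_gt0 // powR_gt0. Qed.

(** The constant of [lpoly_duality], fixed before [phi] so that the coefficient bounds are uniform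
    over the class. *)
Variable K : R.
Hypothesis K0 : 0 < K.
Hypothesis KP : forall phi, Cmeasurable phi -> (Lqnorm q phi <= 1)%E ->
  forall n c, @coef_le1 R d.+1 c ->
  (\int[mu]_x (normc (phi x) * normc (lpoly n c x))%:E <=
   (K * (2 `^ (n%:R * q^-1) * n.+1%:R `^ e))%:E)%E.

Let K1 : R := 2 `^ (r * d.+1%:R) * K.
Let K10 : 0 < K1. Proof. by rewrite mulr_gt0 // powR_gt0. Qed.

Let wK n : w n * (K * (2 `^ (n%:R * q^-1) * n.+1%:R `^ e)) = K1 * layer_weight n.
Proof.
rewrite /w /K1 /layer_weight (_ : - a * n%:R = - r * n%:R + n%:R * q^-1); last first.
  by rewrite /a; ring.
by rewrite powRD_gt0 //; ring.
Qed.

Variable phi : Rn R d.+1 -> R[i].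
Hypothesis mphi : Cmeasurable phi.
Hypothesis phi1 : (Lqnorm q phi <= 1)%E.

Let mnphi := measurable_normc mphi.

(** A single exponential is a polynomial with spectrum in the layer of [k], so [KP] already contains
    the integrability of [phi]. *)
Let Cintegrable_phi k : Cintegrable (fun y => phi y * cexp k y).
Proof.
split; first by apply: CmeasurableM => //; exact: Cmeasurable_cexp.
pose c (l : d.+1.-tuple int) : R[i] := (l == k)%:R.
have hc : coef_le1 c by move=> l; rewrite /c; case: eqP => _; rewrite ?normc_one ?normc_zero.
apply: (le_lt_trans _ (le_lt_trans (KP mphi phi1 (level k) hc) (ltry _))).
rewrite le_eqVlt; apply/orP; left; apply/eqP; apply: eq_integral => y _.
rewrite normcM; congr (_ * normc _)%:E.
rewrite /lpoly (bigD1_seq k) ?mem_layer ?uniq_layer //= /c eqxx mul1r big1 ?addr0 //.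
by move=> l /negPf ->; rewrite mul0r.
Qed.

(** The exponentials are conjugated since the kernel is evaluated at [x - y]; [P] cuts out the part
    of a layer lying in a given set of frequencies. *)
Definition block_poly (P : pred (d.+1.-tuple int)) (c : d.+1.-tuple int -> R[i]) n y :=
  \sum_(k <- layer d.+1 n | P k) c k * cexp (zopp k) y.

Let block_polyE P c n v : 0 < v -> (forall k, level k = n -> normc (c k) <= v) ->
  exists2 c', coef_le1 c' & forall y, block_poly P c n y = v%:C * lpoly n c' y.
Proof.
move=> v0 hc.
exists (fun k => if (level k == n) && P (zopp k) then c (zopp k) / v%:C else 0).
  move=> k; case: ifP => [/andP[/eqP kn _]|_]; last by rewrite normc_zero.
  rewrite normcM normcV normcC (gtr0_norm v0) ler_pdivrMr // mul1r.
  by apply: hc; rewrite levelN.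
move=> y; rewrite /block_poly /lpoly mulr_sumr (perm_big _ (perm_zopp_layer d.+1 n)) /=.
rewrite big_map big_mkcond /= big_seq [RHS]big_seq.
apply: eq_bigr => k; rewrite mem_layer zoppK => ->.
rewrite /=; case: ifP => _; last by rewrite mul0r mulr0.
rewrite mulrA mulrCA divff ?mulr1 //.
by apply/eqP => /complexI v00; rewrite v00 ltxx in v0.
Qed.

Let Cmeasurable_block P c n : Cmeasurable (block_poly P c n).
Proof.
rewrite /block_poly; under eq_fun do rewrite big_mkcond.
apply: Cmeasurable_sum => k; case: (P k); last exact: Cmeasurable_cst.
by apply: CmeasurableM; [exact: Cmeasurable_cst|exact: Cmeasurable_cexp].
Qed.

Let block_bound P c n : (forall k, level k = n -> normc (c k) <= w n) ->
  (\int[mu]_y (normc (phi y) * normc (block_poly P c n y))%:E <=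
   (K1 * layer_weight n)%:E)%E.
Proof.
move=> /(block_polyE P (w0 n)) [c' hc' E].
have -> : (\int[mu]_y (normc (phi y) * normc (block_poly P c n y))%:E =
    \int[mu]_y ((w n)%:E * (normc (phi y) * normc (lpoly n c' y))%:E))%E.
  apply: eq_integral => y _.
  by rewrite E normcM normcC (gtr0_norm (w0 n)) mulrCA EFinM.
rewrite ge0_integralZl ?lee_fin ?(ltW (w0 n)) //; first last.
- by move=> y _; rewrite lee_fin mulr_ge0 ?normc_ge0.
- apply/measurable_EFinP; apply: measurable_funM => //.
  by apply: measurable_normc; exact: Cmeasurable_lpoly.
rewrite -wK [X in (_ <= X)%E]EFinM; apply: lee_wpmul2l; first by rewrite lee_fin ltW.
exact: KP.
Qed.

Let mblock P c n : measurable_fun setT (fun y => normc (block_poly P c n y)).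
Proof. by apply: measurable_normc; exact: Cmeasurable_block. Qed.

Let blocks_bound (P : pred (d.+1.-tuple int)) (c : d.+1.-tuple int -> R[i]) N M :
  (forall k, normc (c k) <= w (level k)) -> (forall k, P k -> (N <= level k)%N) ->
  (\int[mu]_y (normc (phi y) * normc (\sum_(n < M) block_poly P c n y))%:E <=
   (K1 * \sum_(n < M | (N <= n)%N) layer_weight n)%:E)%E.
Proof.
move=> hc hP.
apply: le_trans (_ : \int[mu]_y (\sum_(n < M)
   (normc (phi y) * normc (block_poly P c n y))%:E) <= _)%E.
  apply: ge0_le_integral => //.
  - by move=> y _; rewrite lee_fin mulr_ge0 ?normc_ge0.
  - apply/measurable_EFinP; apply: measurable_funM => //.
    by apply: measurable_normc; apply: Cmeasurable_sum => n; exact: Cmeasurable_block.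
  - by apply: emeasurable_sum => n; apply/measurable_EFinP; exact: measurable_funM.
  - move=> y _; rewrite sumEFin lee_fin -mulr_sumr ler_wpM2l ?normc_ge0 //.
    exact: normc_sum.
rewrite ge0_integral_sum //; first last.
- by move=> n y _; rewrite lee_fin mulr_ge0 ?normc_ge0.
- by move=> n; apply/measurable_EFinP; exact: measurable_funM.
rewrite mulr_sumr -sumEFin [X in (_ <= X)%E]big_mkcond; apply: lee_sum => n _.
case: leqP => Nn; first by apply: block_bound => k <-.
rewrite (_ : (fun y => _) = cst 0%E) ?integral0 //.
apply/funext => y; rewrite /block_poly big_seq_cond big1 ?normc_zero ?mulr0 //.
move=> k /andP[]; rewrite mem_layer => /eqP kn /hP.
by rewrite kn leqNgt Nn.
Qed.

(** Half of the exponential decay of [layer_weight]; the other half absorbs the power of [n.+1]. *)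
Let rho : R := 2 `^ (- (a / 2)).
Let rho01 : 0 < rho < 1. Proof. by apply: two_powR_lt1; rewrite divr_gt0. Qed.

Let tail_bound : exists2 C : R, 0 < C & forall N M,
  K1 * \sum_(n < M | (N <= n)%N) layer_weight n <= C * rho ^+ N.
Proof.
have e0 : 0 <= e.
  by rewrite mulr_ge0 ?ler0n // subr_ge0 invf_le1 // ltW //; case/andP: q12.
have [C C0 HC] := powR_le_exp e0 (divr_gt0 a0 (ltr0n R 2)).
have /andP[rp r1] := rho01.
exists (K1 * (C / (1 - rho))); first by rewrite !mulr_gt0 // invr_gt0 subr_gt0.
move=> N M; rewrite -[X in _ <= X]mulrA ler_pM2l //.
apply: le_trans (_ : \sum_(n < M | (N <= n)%N) C * rho ^+ n <= _).
  apply: ler_sum => n _; rewrite /layer_weight.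
  apply: le_trans (_ : 2 `^ (- a * n%:R) * (C * 2 `^ (a / 2 * n%:R)) <= _).
    by rewrite ler_pM2l ?powR_gt0.
  rewrite mulrCA ler_pM2l // -powRD_gt0 // -powR_mulrn ?(ltW rp) // /rho -powRrM.
  by rewrite le_eqVlt; apply/orP; left; apply/eqP; congr powR; field.
by rewrite -mulr_sumr -mulrA ler_pM2l // mulrC sum_geo_tail.
Qed.

Variable x : Rn R d.+1.

Let cx (k : d.+1.-tuple int) : R[i] := fhat r k * cexp k x.

Let cx_le k : normc (cx k) <= w (level k).
Proof. by rewrite normcM normc_cexp mulr1 normc_fhat. Qed.

(** The cube [N] without the preceding one. The case [N = 0] is separate since [0.-1 = 0] would make
    the first shell empty. *)
Let Q N (k : d.+1.-tuple int) := (k \in box d.+1 N) && ((N == 0%N) || (k \notin box d.+1 N.-1)).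

Let Q_level N k : Q N k -> (N <= level k)%N.
Proof. by case: N => // N /andP[_ /= h]; exact: box_shell_level. Qed.

Let Dl N y := \sum_(n < (d.+1 * N).+1) block_poly (Q N) cx n y.

Let PK N y : R := box_kernel r N (xsub x y).

Let PK_E N y : (PK N y)%:C = \sum_(k <- box d.+1 N) cx k * cexp (zopp k) y.
Proof.
rewrite box_kernel_expand; apply: eq_bigr => k _.
by rewrite cexp_xsub mulrA.
Qed.

Let Dl0 y : Dl 0 y = (PK 0 y)%:C.
Proof.
rewrite PK_E (@sum_box_layers _ _ _ (d.+1 * 0).+1) //; apply: eq_bigr => n _.
by apply: eq_bigl => k; rewrite /Q eqxx andbT.
Qed.

Let DlS N y : Dl N.+1 y = (PK N.+1 y)%:C - (PK N y)%:C.
Proof.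
rewrite !PK_E sum_boxS_diff (@sum_box_layersP _ _ _ (d.+1 * N.+1).+1) //.
Qed.

Let PK_le N y : `|PK N y| <= \sum_(n < N.+1) normc (Dl n y).
Proof.
rewrite -normcC; elim: N => [|N IH]; first by rewrite big_ord1 Dl0.
rewrite big_ord_recr.
apply: le_trans (_ : normc ((PK N y)%:C + Dl N.+1 y) <= _).
  by rewrite DlS addrC subrK.
by apply: (le_trans (normcD _ _)); apply: lerD.
Qed.

Let mDl N : Cmeasurable (Dl N).
Proof. by apply: Cmeasurable_sum => n; exact: Cmeasurable_block. Qed.

(** The majorant: the partial kernels are sums of the increments [Dl], so [G] dominates [phi] times
    each of them. It may be infinite at some points, but its integral is finite because the
    increment [N] involves only layers of level at least [N]. *)
Let G y : \bar R := (\sum_(N <oo) (normc (phi y) * normc (Dl N y))%:E)%E.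

Let mterm N : measurable_fun setT (fun y => (normc (phi y) * normc (Dl N y))%:E).
Proof.
apply/measurable_EFinP; apply: measurable_funM => //.
exact: measurable_normc.
Qed.

Let term_ge0 N y : (0 <= (normc (phi y) * normc (Dl N y))%:E)%E.
Proof. by rewrite lee_fin mulr_ge0 ?normc_ge0. Qed.

Let G_ge0 y : (0 <= G y)%E.
Proof. by apply: nneseries_ge0 => n _ _. Qed.

Let mG : measurable_fun setT G.
Proof. by apply: ge0_emeasurable_sum => n *. Qed.

Let intG : (\int[mu]_y G y < +oo)%E.
Proof.
rewrite integral_nneseries //.
have [C C0 HC] := tail_bound; have /andP[rp r1] := rho01.
have r1' : 0 < 1 - rho by rewrite subr_gt0.
apply: le_lt_trans (ltry (C / (1 - rho))).
apply: lime_le; first by apply: is_cvg_nneseries => n _ _; exact: integral_ge0.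
apply: nearW => n.
apply: le_trans (_ : (\sum_(0 <= N < n) (C * rho ^+ N)%:E <= _)%E).
  apply: lee_sum => N _.
  apply: le_trans (blocks_bound _ cx_le (@Q_level N)) _.
  by rewrite lee_fin HC.
rewrite sumEFin lee_fin -mulr_sumr ler_pM2l // big_mkord.
have := @sum_geo_tail R rho 0 n; rewrite expr0 div1r; apply.
exact: rho01.
Qed.

Let FK y : R := \prod_(j < d.+1) F1 r (tnth (xsub x y) j).

Let mxsub (h : R -> R) j : measurable_fun setT h ->
  measurable_fun [set: Rn R d.+1] (fun y => h (tnth (xsub x y) j)).
Proof.
move=> mh; under eq_fun do rewrite tnth_mktuple.
apply: (@measurableT_comp _ _ _ _ _ _ h) => //.
by apply: measurable_funB => //; exact: measurable_tnth.
Qed.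

Let mprod (h : nat -> R -> R) N : (forall n, measurable_fun setT (h n)) ->
  measurable_fun [set: Rn R d.+1] (fun y => \prod_(j < d.+1) h N (tnth (xsub x y) j)).
Proof.
by move=> mh; apply: measurable_prod => j _; exact: mxsub.
Qed.

Let mPK N : measurable_fun setT (PK N).
Proof.
apply: (@mprod (fun N t => 1 + 2 * kernel_sum r (2 ^ N) t)) => n.
by apply: measurable_funD => //; apply: measurable_funM => //; exact: measurable_kernel_sum.
Qed.

Let mFK : measurable_fun setT FK.
Proof. by apply: (@mprod (fun _ => F1 r) 0%N) => n; exact: measurable_F1. Qed.

Let PK_cvg : {ae mu, forall y, (fun N => PK N y) @ \oo --> FK y}.
Proof.
have := torus_ae_sin_half x; apply: negligibleS => y /= hn h; apply: hn.
apply: cvg_prod_seq => j; apply: F1_cvg => //.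
by rewrite tnth_mktuple; exact: h.
Qed.

(** Used with the real and the imaginary part of [phi]. The exceptional null set of [y] depends on
    [x], but [x] is fixed before integrating, so the limit is obtained at every [x]. *)
Let real_conv_cvg (u : Rn R d.+1 -> R) : measurable_fun setT u ->
  (forall y, `|u y| <= normc (phi y)) ->
  mu.-integrable setT (fun y => (u y * FK y)%:E) /\
  (fun N => \int[mu]_y (u y * PK N y)) @ \oo --> \int[mu]_y (u y * FK y).
Proof.
move=> mu' hu.
have uPK N y : (`|(u y * PK N y)%:E| <= G y)%E.
  apply: le_trans (_ : (\sum_(0 <= n < N.+1) (normc (phi y) * normc (Dl n y))%:E <= _)%E); last first.
    exact: nneseries_lim_ge.
  rewrite sumEFin big_mkord lee_fin normrM -mulr_sumr.
  by apply: ler_pM => //; exact: PK_le.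
have mf N : measurable_fun setT (fun y => (u y * PK N y)%:E).
  by apply/measurable_EFinP; exact: measurable_funM.
have mf' : measurable_fun setT (fun y => (u y * FK y)%:E).
  by apply/measurable_EFinP; exact: measurable_funM.
have IG : mu.-integrable setT G.
  apply/integrableP; split; first exact: mG.
  by under eq_integral do rewrite gee0_abs //.
have cv : {ae mu, forall y, setT y ->
    (fun N => (u y * PK N y)%:E) @ \oo --> (u y * FK y)%:E}.
  have := PK_cvg; apply: negligibleS => y /= hn h; apply: hn => _.
  by apply: cvg_EFin; [exact: nearW|apply: cvgM => //; exact: cvg_cst].
have bd : {ae mu, forall y (N : nat), setT y -> (`|(u y * PK N y)%:E| <= G y)%E}.
  by apply: aeW => y N _; exact: uPK.
have [If _ H] := dominated_convergence measurableT mf mf' cv IG bd.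
split => //.
have fin : (\int[mu]_y (u y * FK y)%:E)%E \is a fin_num by exact: integrable_fin_num.
rewrite /Rintegral; apply: fine_cvg; rewrite fineK //; exact: H.
Qed.

Let Cint_PK N : Cintegral (fun y => phi y * (PK N y)%:C) =
  \sum_(k <- box d.+1 N) fhat r k * fcoef phi k * cexp k x.
Proof.
under eq_Cintegral do rewrite PK_E mulr_sumr.
rewrite Cintegral_sum; last first.
  move=> k; under eq_fun do rewrite mulrCA; apply: CintegrableZ.
  exact: Cintegrable_phi.
apply: eq_bigr => k _; under eq_Cintegral do rewrite mulrCA.
by rewrite CintegralZ ?Cintegrable_phi // /cx /fcoef; ring.
Qed.

Let conv_cvg : forall eps : R, 0 < eps -> exists N0, forall N, (N0 <= N)%N ->
  normc (Defs.conv phi (@Defs.F R d.+1 r) x -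
    \sum_(k <- box d.+1 N) fhat r k * fcoef phi k * cexp k x) <= eps.
Proof.
move=> eps eps0; have e2 : 0 < eps / 2 by lra.
have [_ cr] := real_conv_cvg mphi.1 (fun y => Re_le_normc (phi y)).
have [_ ci] := real_conv_cvg mphi.2 (fun y => Im_le_normc (phi y)).
move/cvgrPdist_le : cr => /(_ _ e2) [N1 _ h1].
move/cvgrPdist_le : ci => /(_ _ e2) [N2 _ h2].
exists (maxn N1 N2) => N; rewrite geq_max => /andP[n1 n2].
rewrite -Cint_PK.
apply: le_trans (normc_le_ReIm _) _.
have -> : eps = eps / 2 + eps / 2 by field.
have ReB (z z' : R[i]) : complex.Re (z - z') = complex.Re z - complex.Re z'.
  by case: z; case: z'.
have ImB (z z' : R[i]) : complex.Im (z - z') = complex.Im z - complex.Im z'.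
  by case: z; case: z'.
rewrite ReB ImB; apply: lerD.
  have := h1 N n1; rewrite /= /Cintegral /Defs.conv /=.
  congr (`| _ - _| <= _); apply: eq_Rintegral => y _; by rewrite ReM /= mulr0 subr0.
have := h2 N n2; rewrite /= /Cintegral /Defs.conv /=.
by congr (`| _ - _| <= _); apply: eq_Rintegral => y _; rewrite ImM /= mulr0 add0r.
Qed.

(** Duality: the sum of the [|fcoef phi k|] over the layer is the integral of [phi] against a
    polynomial with unimodular or zero coefficients, to which [block_bound] applies after scaling by
    [w n]. *)
Lemma conv_coef_bound n : \sum_(k <- layer d.+1 n) normc (fhat r k * fcoef phi k) <=
  2 * K1 * layer_weight n.
Proof.
pose c (k : d.+1.-tuple int) : R[i] :=
  conjc (fcoef phi k) / (normc (fcoef phi k))%:C * (w n)%:C.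
have hc k : level k = n -> normc (c k) <= w n.
  move=> _; rewrite !normcM normcV !normcC (gtr0_norm (w0 n)) normc_conj.
  rewrite (ger0_norm (normc_ge0 _)) ler_piMl ?(ltW (w0 n)) //.
  by have [->|z0] := eqVneq (normc (fcoef phi k)) 0; rewrite ?mul0r // divff.
have H := block_bound xpredT hc.
have E : Cintegral (fun y => phi y * block_poly xpredT c n y) =
    (\sum_(k <- layer d.+1 n) w n * normc (fcoef phi k))%:C.
  under eq_Cintegral do rewrite /block_poly mulr_sumr.
  rewrite Cintegral_sum; last first.
    by move=> k; under eq_fun do rewrite mulrCA; exact/CintegrableZ/Cintegrable_phi.
  rewrite rmorph_sum; apply: eq_bigr => k _; under eq_Cintegral do rewrite mulrCA.
  rewrite CintegralZ ?Cintegrable_phi // -/(fcoef phi k) /c.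
  set z := fcoef phi k; have [z0|z0] := eqVneq (normc z) 0.
    by rewrite (eq0_normc z0) normc_zero !mulr0 rmorph0.
  have z0' : (normc z)%:C != 0 by apply: contra z0 => /eqP/complexI ->.
  have -> : conjc z / (normc z)%:C * (w n)%:C * z = (w n)%:C * (z * conjc z / (normc z)%:C).
    by ring.
  have z2 : (normc z ^+ 2)%:C / (normc z)%:C = (normc z)%:C.
    by rewrite expr2 rmorphM mulfK.
  by rewrite normc_conjM z2 -rmorphM.
have I : Cintegrable (fun y => phi y * block_poly xpredT c n y).
  under eq_fun do rewrite /block_poly mulr_sumr.
  apply: Cintegrable_sum => k; under eq_fun do rewrite mulrCA.
  exact/CintegrableZ/Cintegrable_phi.
have H2 := normc_Cintegral I.
rewrite E normcC ger0_norm in H2; last first.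
  by apply: sumr_ge0 => k _; rewrite mulr_ge0 ?normc_ge0 ?(ltW (w0 n)).
have H3 : \sum_(k <- layer d.+1 n) w n * normc (fcoef phi k) <= 2 * (K1 * layer_weight n).
  rewrite -lee_fin EFinM; apply: le_trans H2 _.
  apply: lee_wpmul2l => //.
  by under eq_integral do rewrite normcM.
rewrite -mulrA; apply: le_trans H3.
rewrite big_seq [X in _ <= X]big_seq; apply: ler_sum => k; rewrite mem_layer => /eqP kn.
by rewrite normcM ler_wpM2r ?normc_ge0 // -kn normc_fhat.
Qed.

(** The cube [N] contains every layer below [N], and its other frequencies lie in layers from [N]
    on, whose coefficient sums have a geometric tail. This transfers convergence from cubes to
    layers. *)
Lemma conv_layers_cvg (eps : R) : 0 < eps -> exists N0, forall N, (N0 <= N)%N ->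
  normc (Defs.conv phi (@Defs.F R d.+1 r) x -
    \sum_(n < N) \sum_(k <- layer d.+1 n) fhat r k * fcoef phi k * cexp k x) <= eps.
Proof.
pose ak k := fhat r k * fcoef phi k.
move=> eps0; have e2 : 0 < eps / 2 by lra.
have [N1 h1] := conv_cvg e2.
have [C C0 HC] := tail_bound; have /andP[rp r1] := rho01.
have rc : (fun N => rho ^+ N) @ \oo --> (0 : R) by apply: cvg_expr; rewrite gtr0_norm.
have e4 : 0 < eps / 2 / (2 * C) by rewrite divr_gt0 // mulr_gt0.
move/cvgr0Pnorm_le : rc => /(_ _ e4) [N2 _ h2].
exists (maxn N1 N2) => N; rewrite geq_max => /andP[n1 n2].
set S := Defs.conv _ _ _.
pose B := \sum_(k <- box d.+1 N) fhat r k * fcoef phi k * cexp k x.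
pose H := \sum_(n < N) \sum_(k <- layer d.+1 n) ak k * cexp k x.
rewrite -/H.
have -> : S - H = (S - B) + (B - H) by rewrite addrA subrK.
apply: (le_trans (normcD _ _)).
have -> : eps = eps / 2 + eps / 2 by field.
apply: lerD; first exact: h1.
pose M := (d.+1 * N).+1.
have NM : (N <= M)%N by rewrite /M mulSn leqW // leq_addr.
have -> : H = \sum_(n < M | (n < N)%N) \sum_(k <- layer d.+1 n) ak k * cexp k x.
  exact: (big_ord_widen _ (fun n => \sum_(k <- layer d.+1 n) ak k * cexp k x) NM).
have -> : B = \sum_(n < M) \sum_(k <- layer d.+1 n | k \in box d.+1 N) ak k * cexp k x.
  exact: (sum_box_layers _ (ltnSn (d.+1 * N))).
rewrite (bigID (fun n : 'I_M => (n < N)%N)) /=.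
have -> : \sum_(n < M | (n < N)%N) \sum_(k <- layer d.+1 n | k \in box d.+1 N) ak k * cexp k x =
    \sum_(n < M | (n < N)%N) \sum_(k <- layer d.+1 n) ak k * cexp k x.
  apply: eq_bigr => n nN; rewrite big_mkcond big_seq [RHS]big_seq.
  apply: eq_bigr => k; rewrite mem_layer => /eqP kn.
  by rewrite mem_box_level // kn ltnW.
rewrite addrAC subrr add0r.
apply: (le_trans (normc_sum _ _ _)).
apply: le_trans (_ : \sum_(n < M | (N <= n)%N) 2 * K1 * layer_weight n <= _).
  under eq_bigl do rewrite -leqNgt.
  apply: ler_sum => n _; apply: (le_trans (normc_sum _ _ _)).
  apply: le_trans (conv_coef_bound n).
  rewrite big_mkcond; apply: ler_sum => k _; case: ifP => _; last exact: normc_ge0.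
  by rewrite normcM normc_cexp mulr1.
rewrite -mulr_sumr -mulrA.
apply: le_trans (_ : 2 * (C * rho ^+ N) <= _).
  by rewrite ler_pM2l.
have := h2 N n2; rewrite /= ger0_norm ?exprn_ge0 ?(ltW rp) //.
rewrite ler_pdivlMr ?mulr_gt0 // => h; apply: le_trans h.
by rewrite le_eqVlt; apply/orP; left; apply/eqP; ring.
Qed.

End ConvolutionLimit.

Lemma W_layers (R : realType) d (q r : R) : 1 < q <= 2 -> q^-1 < r ->
  exists2 C : R, 0 < C & forall f, @W R d.+1 r q f ->
  exists a : d.+1.-tuple int -> R[i],
  (forall n, \sum_(k <- layer d.+1 n) normc (a k) <= C * layer_weight d q r n) /\
  (forall x (eps : R), 0 < eps -> exists N0, forall N, (N0 <= N)%N ->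
    normc (f x - \sum_(n < N) \sum_(k <- layer d.+1 n) a k * cexp k x) <= eps).
Proof.
move=> q12 rq; have [K K0 KP] := lpoly_duality d q12.
exists (2 * (2 `^ (r * d.+1%:R) * K)); first by rewrite !mulr_gt0 // powR_gt0.
move=> f [phi [mphi _ phi1 ->]].
exists (fun k => fhat r k * fcoef phi k); split.
  by move=> n; exact: (conv_coef_bound q12 rq KP mphi phi1 n).
by move=> x eps; exact: (conv_layers_cvg q12 rq K0 KP mphi phi1).
Qed.

(** * Allocation of the terms among the layers *)

Lemma succ_addn_leq (m n : nat) : ((m + n).+1 <= m.+1 * n.+1)%N.
Proof. by rewrite mulSn mulnS; lia. Qed.

Lemma succ_succ_leq (n : nat) : (n.+2 <= 2 * n.+1)%N.
Proof. by lia. Qed.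

Section Assembly.
Variable R : realType.

Lemma sigma_le d m (f : Rn R d -> R[i]) (t : seq (d.-tuple int * R[i])) (E : R) :
  (size t <= m)%N -> (forall x, normc (f x - tpoly t x) <= E) ->
  (sigma m f <= E%:E)%E.
Proof.
move=> tm hE; apply: ge_ereal_inf.
(* As default value of [nth], this pads the list up to [m] terms with zero coefficients. *)
pose p0 : d.-tuple int * R[i] := ([tuple 0 | _ < d], 0).
exists (unorm (fun x => f x - tpoly t x)); last first.
  by apply: ge_ereal_sup => _ [x _ <-]; rewrite lee_fin.
exists (fun j => (nth p0 t j).1), (fun j => (nth p0 t j).2).
congr unorm; apply/funext => x; congr (_ - _).
rewrite /tpoly (big_nth p0) big_mkord.
rewrite (big_ord_widen m (fun j => (nth p0 t j).2 * cexp (nth p0 t j).1 x) tm).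
rewrite big_mkcond; apply: eq_bigr => j _.
case: ltnP => // h; by rewrite (nth_default _ h) mul0r.
Qed.

(** The budget [v] is real, so that it may decay geometrically. Below [1] no term is used, and the
    trivial bound suffices since the square root is then at least [1]; otherwise truncating [v]
    loses at most a factor [2]. *)
Lemma layer_sparse d : exists2 C : R, 0 < C &
  forall n (v : R) (a : d.-tuple int -> R[i]), 0 < v -> v <= 2 ^+ (d * n) ->
  exists t : seq (d.-tuple int * R[i]),
  [/\ (size t)%:R <= v, v < 1 -> t = [::] &
  forall x, normc (\sum_(k <- layer d n) a k * cexp k x - tpoly t x) <=
    C * (\sum_(k <- layer d n) normc (a k)) * Num.sqrt (n.+1%:R / v)].
Proof.
have [C C0 HC] := sparse_trig R d.
exists (2 * C + 1); first by rewrite addr_gt0 // mulr_gt0.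
move=> n v a v0 vle.
set A := \sum_(k <- layer d n) normc (a k).
have A0 : 0 <= A by apply: sumr_ge0 => k _; exact: normc_ge0.
have n0 : 1 <= n.+1%:R :> R by rewrite ler1n.
case: (ltP v 1) => v1.
  exists [::]; split => //; first exact: ltW.
  move=> x; rewrite /tpoly big_nil subr0.
  apply: (le_trans (normc_sum _ _ _)).
  rewrite (eq_bigr (fun k => normc (a k))) -/A; last first.
    by move=> k _; rewrite normcM normc_cexp mulr1.
  rewrite mulrAC ler_peMl //.
  have s1 : 1 <= Num.sqrt (n.+1%:R / v).
    rewrite -[X in X <= _]sqrtr1 ler_wsqrtr // ler_pdivlMr // mul1r.
    exact: le_trans (ltW v1) n0.
  by rewrite -[X in X <= _]mulr1 ler_pM //; lra.
have /andP[m1 m2] := truncn_itv (ltW v0).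
set m := Num.truncn v in m1 m2.
have m0 : (0 < m)%N by rewrite -ltnS -(ltr_nat R); exact: le_lt_trans v1 m2.
have mle : (m <= 2 ^ (d * n))%N.
  by rewrite -(ler_nat R) natrX; exact: le_trans m1 vle.
have sub : {subset layer d n <= box d n} by move=> k; rewrite mem_filter => /andP[].
have [t st ht] := HC n m (layer d n) a m0 mle sub.
exists t; split; [by rewrite st|by []|].
move=> x; apply: le_trans (ht x) _; rewrite -/A.
have S : Num.sqrt (n.+1%:R / m%:R) <= 2 * Num.sqrt (n.+1%:R / v) :> R.
  have -> : 2 = Num.sqrt (2 ^+ 2) :> R by rewrite sqrtr_sqr ger0_norm.
  rewrite -sqrtrM ?sqr_ge0 // ler_wsqrtr // mulrCA ler_pM2l ?ltr0n //.
  rewrite ler_pdivlMr // mulrC ler_pdivrMr ?ltr0n //.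
  have : m.+1%:R <= 2 * m%:R :> R by rewrite -natrM ler_nat -(prednK m0) succ_succ_leq.
  have : 1 <= m%:R :> R by rewrite ler1n.
  lra.
have S0 : 0 <= Num.sqrt (n.+1%:R / v) by exact: sqrtr_ge0.
apply: le_trans (_ : C * A * (2 * Num.sqrt (n.+1%:R / v)) <= _).
  by rewrite ler_wpM2l // mulr_ge0 // ltW.
rewrite mulrA ler_wpM2r // mulrAC ler_wpM2r //; lra.
Qed.

Lemma sum_geo_shift (z : R) (N M : nat) : 0 < z < 1 ->
  \sum_(n < M | (N <= n)%N) z ^+ (n - N) <= (1 - z)^-1.
Proof.
move=> z01; have /andP[z0 z1] := z01.
rewrite -(@ler_pM2l _ (z ^+ N)) ?exprn_gt0 //.
apply: le_trans (sum_geo_tail N M z01); rewrite mulr_sumr.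
by apply: ler_sum => n Nn; rewrite -exprD subnKC.
Qed.

Variables (d : nat) (q r : R).
Hypothesis q12 : 1 < q <= 2.
Hypothesis rq : q^-1 < r.

Let e := d%:R * (1 - q^-1) : R.
Let al := r - q^-1.

Let al0 : 0 < al. Proof. by rewrite subr_gt0. Qed.
Let e0 : 0 <= e.
Proof.
case/andP: q12 => q1 _; rewrite mulr_ge0 ?ler0n // subr_ge0 invf_le1 ?ltW //; lra.
Qed.

Let tau : R := 2 `^ (- al).
Let tau01 : 0 < tau < 1. Proof. exact: two_powR_lt1. Qed.
Let sg : R := 2 `^ (- (al / 4)).
Let sg01 : 0 < sg < 1. Proof. by apply: two_powR_lt1; rewrite divr_gt0. Qed.

(** Put [j = n - N]. The coefficients gain [2^(-al j)] and the shrinking budget loses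
    [2^(al j / 2)]. Half of the remaining [2^(-al j / 2)] absorbs the growth of the power of [n.+1],
    by [n.+1 <= N.+1 * j.+1]; the other half is [sg ^+ j]. *)
Let err_term : exists2 C : R, 0 < C & forall N n (V : R), 0 < V -> (N <= n)%N ->
  layer_weight d q r n * Num.sqrt (n.+1%:R / (V * tau ^+ (n - N))) <=
  C * (2 `^ (- al * N%:R) * V `^ (- 2^-1) * N.+1%:R `^ (e + 2^-1)) * sg ^+ (n - N).
Proof.
have e20 : 0 <= e + 2^-1 by rewrite addr_ge0.
have al4 : 0 < al / 4 by rewrite divr_gt0.
have [C C0 HC] := powR_le_exp e20 al4.
exists C => // N n V V0 Nn; set j := (n - N)%N.
have nE : n = (N + j)%N by rewrite subnKC.
have /andP[t0 _] := tau01; have /andP[s0 _] := sg01.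
have tj0 : 0 < tau ^+ j by exact: exprn_gt0.
have n0 : 0 < n.+1%:R :> R by rewrite ltr0n.
have -> : Num.sqrt (n.+1%:R / (V * tau ^+ j)) =
   n.+1%:R `^ 2^-1 * (V `^ (- 2^-1) * 2 `^ (al * j%:R / 2)).
  rewrite -powR12_sqrt ?divr_ge0 ?mulr_ge0 ?(ltW V0) ?(ltW tj0) //.
  rewrite powRM ?invr_ge0 ?mulr_ge0 ?(ltW V0) ?(ltW tj0) //; congr (_ * _).
  rewrite -powR_inv1 ?mulr_ge0 ?(ltW V0) ?(ltW tj0) // -powRrM mulN1r.
  rewrite powRM ?(ltW V0) ?(ltW tj0) //; congr (_ * _).
  rewrite -powR_mulrn ?(ltW t0) // /tau -!powRrM; congr powR; ring.
rewrite /layer_weight -/e -/al.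
have -> : 2 `^ (- al * n%:R) * n.+1%:R `^ e *
    (n.+1%:R `^ 2^-1 * (V `^ (- 2^-1) * 2 `^ (al * j%:R / 2))) =
  (n.+1%:R `^ (e + 2^-1)) * (2 `^ (- al * n%:R + al * j%:R / 2)) * V `^ (- 2^-1).
  by rewrite !powRD_gt0 //; ring.
have -> : - al * n%:R + al * j%:R / 2 = - al * N%:R + (- (al / 4) * j%:R + - (al / 4 * j%:R)).
  by rewrite nE natrD; field.
rewrite (powRD_gt0 (- al * N%:R)) // (powRD_gt0 (- (al / 4) * j%:R)) //.
have sgE : 2 `^ (- (al / 4) * j%:R) = sg ^+ j.
  by rewrite -powR_mulrn ?(ltW s0) // -powRrM.
rewrite sgE.
have nle : n.+1%:R `^ (e + 2^-1) <= N.+1%:R `^ (e + 2^-1) * (C * 2 `^ (al / 4 * j%:R)).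
  apply: le_trans (_ : N.+1%:R `^ (e + 2^-1) * j.+1%:R `^ (e + 2^-1) <= _).
    rewrite -powRM // ge0_ler_powR ?nnegrE ?mulr_ge0 //.
    by rewrite -natrM ler_nat nE succ_addn_leq.
  by rewrite ler_pM2l ?powR_gt0.
set u := 2 `^ (al / 4 * j%:R) in nle *.
have u0 : 0 < u by rewrite powR_gt0.
rewrite (powRN _ (al / 4 * j%:R)) -/u.
set X := 2 `^ (- al * N%:R); set Y := V `^ _; set Z := sg ^+ j.
have X0 : 0 < X by rewrite powR_gt0.
have Y0 : 0 < Y by rewrite powR_gt0.
have Z0 : 0 < Z by rewrite exprn_gt0.
apply: le_trans (_ : N.+1%:R `^ (e + 2^-1) * (C * u) * (X * (Z * u^-1)) * Y <= _).
  have W0 : 0 < X * (Z * u^-1) by rewrite mulr_gt0 // divr_gt0.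
  rewrite (ler_pM2r Y0) (ler_pM2r W0); exact: nle.
rewrite le_eqVlt; apply/orP; left; apply/eqP; field.
by rewrite gt_eqF.
Qed.

Let W_approx : exists2 C : R, 0 < C & forall f, @W R d.+1 r q f ->
  forall N (V : R), 0 < V -> V <= 2 ^+ (d.+1 * N) ->
  exists2 t : seq (d.+1.-tuple int * R[i]),
  (size t)%:R <= \sum_(n < N) (size (layer d.+1 n))%:R + V / (1 - tau) &
  forall x, normc (f x - tpoly t x) <=
    C * (2 `^ (- al * N%:R) * V `^ (- 2^-1) * N.+1%:R `^ (e + 2^-1)).
Proof.
have [C1 C10 H1] := W_layers d q12 rq.
have [C2 C20 H2] := layer_sparse d.+1.
have [C3 C30 H3] := err_term.
have /andP[t0 t1] := tau01; have /andP[s0 s1] := sg01.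
exists (C2 * C1 * C3 / (1 - sg)); first by rewrite !mulr_gt0 // invr_gt0 subr_gt0.
move=> f /H1 [a [ha hf]] N V V0 VN.
pose v n := V * tau ^+ (n - N).
have v0 n : 0 < v n by rewrite mulr_gt0 // exprn_gt0.
have vle n : (N <= n)%N -> v n <= 2 ^+ (d.+1 * n).
  move=> Nn; apply: le_trans (_ : 2 ^+ (d.+1 * N) <= _); last first.
    by rewrite ler_eXn2l ?ltr1n // leq_mul2l Nn orbT.
  apply: le_trans VN; rewrite /v ler_piMr ?(ltW V0) //.
  by rewrite exprn_ile1 // ltW.
pose err n := C2 * (C1 * layer_weight d q r n) * Num.sqrt (n.+1%:R / v n).
have ex n : exists t : seq (d.+1.-tuple int * R[i]),
  [/\ (size t)%:R <= (if (n < N)%N then (size (layer d.+1 n))%:R else v n),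
   (N <= n)%N -> v n < 1 -> t = [::] &
   forall x, normc (\sum_(k <- layer d.+1 n) a k * cexp k x - tpoly t x) <=
     if (n < N)%N then 0 else err n].
  case: ltnP => nN.
    exists [seq (k, a k) | k <- layer d.+1 n]; split => //; first by rewrite size_map.
    by move=> x; rewrite /tpoly big_map subrr normc_zero.
  have [t [ht1 ht2 ht3]] := H2 n (v n) a (v0 n) (vle n nN).
  exists t; split => // x; apply: le_trans (ht3 x) _.
  by rewrite /err ler_wpM2r ?sqrtr_ge0 // ler_pM2l.
have [T HT] := choice ex.
(* From [N + J] on the budget is below [1], so the lists are empty and the approximant is a finite
   sum. *)
have [J hJ] : exists J, forall n, (J <= n)%N -> tau ^+ n < V^-1.
  have tc : (fun n => tau ^+ n) @ \oo --> (0 : R) by apply: cvg_expr; rewrite gtr0_norm.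
  have V2 : 0 < V^-1 / 2 by rewrite divr_gt0 // invr_gt0.
  move/cvgr0Pnorm_le : tc => /(_ _ V2) [J _ h]; exists J => n Jn.
  have := h n Jn; rewrite /= gtr0_norm ?exprn_gt0 //.
  have : 0 < V^-1 by rewrite invr_gt0.
  lra.
pose M := (N + J)%N.
have TM n : (M <= n)%N -> T n = [::].
  move=> Mn; have [_ h _] := HT n; apply: h.
    by apply: leq_trans Mn; exact: leq_addr.
  rewrite /v -ltr_pdivlMl // mulr1; apply: hJ.
  by rewrite leq_subRL //; apply: leq_trans Mn; exact: leq_addr.
exists (flatten [seq T n | n <- iota 0 M]).
  rewrite size_flatten sumnE /shape !big_map natr_sum.
  have -> : \sum_(n <- iota 0 M) (size (T n))%:R = \sum_(n < M) (size (T n))%:R :> R.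
    by rewrite -(big_mkord xpredT (fun n => (size (T n))%:R)) /index_iota subn0.
  rewrite (bigID (fun n : 'I_M => (n < N)%N)) /=; apply: lerD.
    have NM : (N <= M)%N by exact: leq_addr.
    rewrite (big_ord_widen M (fun n => (size (layer d.+1 n))%:R) NM).
    apply: ler_sum => n nN; by have [+ _ _] := HT n; rewrite nN.
  apply: le_trans (_ : \sum_(n < M | (N <= n)%N) V * tau ^+ (n - N) <= _).
    under eq_bigl do rewrite -leqNgt.
    by apply: ler_sum => n nN; have [+ _ _] := HT n; rewrite ltnNge nN.
  by rewrite -mulr_sumr ler_pM2l // sum_geo_shift.
move=> x; set E := C2 * C1 * C3 / _ * _.
(* The layers of [f] are summed only up to an arbitrary [eps], by a cut [N'] that may depend on [x];
   the approximant does not depend on it. *)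
apply/ler_addgt0Pr => eps eps0.
have [N0 hN0] := hf x eps eps0.
pose N' := maxn N0 M.
have -> : tpoly (flatten [seq T n | n <- iota 0 M]) x = \sum_(n < N') tpoly (T n) x.
  rewrite /tpoly big_flatten big_map.
  have -> : \sum_(n <- iota 0 M) tpoly (T n) x = \sum_(n < M) tpoly (T n) x.
    by rewrite -(big_mkord xpredT (fun n => tpoly (T n) x)) /index_iota subn0.
  rewrite (big_ord_widen N' (fun n => tpoly (T n) x) (leq_maxr _ _)).
  rewrite big_mkcond; apply: eq_bigr => n _.
  by case: ltnP => // Mn; rewrite TM // /tpoly big_nil.
pose S := \sum_(n < N') \sum_(k <- layer d.+1 n) a k * cexp k x.
have -> : f x - \sum_(n < N') tpoly (T n) x = (S - \sum_(n < N') tpoly (T n) x) + (f x - S).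
  by rewrite [RHS]addrC addrA subrK.
apply: (le_trans (normcD _ _)); apply: lerD; last first.
  by apply: hN0; exact: leq_maxl.
rewrite /S -sumrB; apply: (le_trans (normc_sum _ _ _)).
apply: le_trans (_ : \sum_(n < N' | (N <= n)%N) err n <= _).
  rewrite [X in _ <= X]big_mkcond; apply: ler_sum => n _.
  by have [_ _ h] := HT n; apply: le_trans (h x) _; case: ltnP.
pose P := 2 `^ (- al * N%:R) * V `^ (- 2^-1) * N.+1%:R `^ (e + 2^-1).
apply: le_trans (_ : \sum_(n < N' | (N <= n)%N) C2 * C1 * (C3 * P) * sg ^+ (n - N) <= _).
  apply: ler_sum => n Nn; rewrite /err [C2 * _]mulrA -[X in X <= _]mulrA -[X in _ <= X]mulrA.
  rewrite ler_pM2l ?mulr_gt0 //; exact: H3.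
rewrite -mulr_sumr.
have P0 : 0 < P by rewrite !mulr_gt0 // powR_gt0.
have -> : E = C2 * C1 * (C3 * P) * (1 - sg)^-1 by rewrite /E -/P; ring.
have CP : 0 < C2 * C1 * (C3 * P) := mulr_gt0 (mulr_gt0 C20 C10) (mulr_gt0 C30 P0).
by rewrite (ler_pM2l CP) sum_geo_shift.
Qed.

(** The sum of [al * d], from rewriting [2^(- al N)] in terms of [2^N N.+1^d], of [e] from the layer
    weight, and of [1/2] from the sparsification. *)
Let be := d%:R * (al + 1 - q^-1) + 2^-1 : R.

Lemma sigma_W_le : exists2 C : R, 0 < C & forall f, @W R d.+1 r q f ->
  forall m, (2 <= m)%N ->
  (sigma m f <= (C * (m%:R `^ (- (al + 2^-1)) * ln m%:R `^ be))%:E)%E.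
Proof.
have [C1 C10 H1] := W_approx.
have /andP[t0 t1] := tau01.
have t1' : 0 < 1 - tau by rewrite subr_gt0.
(* With budget [V = 2^N N.+1^d], the full layers below [N] use at most [V] terms and the others at
   most [V / (1 - tau)]. *)
pose D0 := 1 + (1 - tau)^-1.
have D01 : 1 <= D0 by rewrite lerDl invr_ge0 ltW.
have D00 : 0 < D0 by lra.
have qi : q^-1 < 1 by case/andP: q12 => q1 _; rewrite invf_lt1 //; lra.
have be0 : 0 <= be.
  rewrite /be addr_ge0 // mulr_ge0 ?ler0n //; have := al0; lra.
pose s := al + 2^-1.
have s0 : 0 < s by rewrite addr_gt0.
have l2 : 0 < ln 2 :> R by rewrite ln_gt0 // ltr1n.
(* For [m < D0] no [N] is admissible. Taking [N = 0] and a budget of [1/2] in all makes the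
   approximant empty, so that [f] itself is bounded uniformly over the class; the rate is bounded
   below for these [m]. *)
have [C2 C20 H2] : exists2 C2 : R, 0 < C2 & forall f, @W R d.+1 r q f ->
    forall m, (2 <= m)%N -> m%:R < D0 ->
    (sigma m f <= (C2 * (m%:R `^ (- s) * ln m%:R `^ be))%:E)%E.
  pose V0 := (1 - tau) / 2.
  have V00 : 0 < V0 by rewrite divr_gt0.
  pose E := C1 * (2 `^ (- al * 0%:R) * V0 `^ (- 2^-1) * 1%:R `^ (e + 2^-1)).
  have E0 : 0 < E by rewrite !mulr_gt0 // powR_gt0.
  exists (E * (D0 `^ s * (ln 2) `^ (- be))); first by rewrite !mulr_gt0 // powR_gt0.
  move=> f /H1 h m m2 mD.
  have V01 : V0 <= 2 ^+ (d.+1 * 0) by rewrite muln0 expr0 /V0; lra.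
  have [t ht1 ht2] := h 0%N V0 V00 V01.
  have t00 : (size t <= m)%N.
    move: ht1; rewrite big_ord0 add0r /V0 mulrAC divff ?gt_eqF // div1r => ht1.
    suff : (size t < 1)%N by rewrite ltnS leqn0 => /eqP ->.
    by rewrite -(ltr_nat R); apply: le_lt_trans ht1 _; lra.
  apply: le_trans (sigma_le t00 ht2) _; rewrite lee_fin -/E.
  rewrite -[X in X <= _]mulr1 -mulrA ler_pM2l //.
  have m0 : 0 < m%:R :> R by rewrite ltr0n ltnW.
  have lm : ln 2 <= ln m%:R :> R by rewrite ler_ln ?posrE // ler_nat.
  have lm0 : 0 < ln m%:R :> R by exact: lt_le_trans lm.
  rewrite mulrACA !powRN -[X in X <= _]mulr1 ler_pM //.
    rewrite ler_pdivlMr ?powR_gt0 // mul1r.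
    by rewrite ge0_ler_powR ?nnegrE ?(ltW s0) ?(ltW m0) ?(ltW D00) ?(ltW mD).
  rewrite mulrC ler_pdivlMr ?powR_gt0 // mul1r.
  by rewrite ge0_ler_powR ?nnegrE ?(ltW l2) ?(ltW lm0).
(* Consecutive values of [VV] below differ by a factor of at most [2^(d+1)]; hence for the largest
   [N] with [D0 * VV N <= m] one also has [m < D1 * VV N]. *)
pose D1 := D0 * 2 ^+ d.+1.
have D10 : 0 < D1 by rewrite mulr_gt0 // exprn_gt0.
exists (C2 + C1 * (D1 `^ s * (2 / ln 2) `^ be)).
  by rewrite addr_gt0 // !mulr_gt0 // powR_gt0 // divr_gt0.
move=> f fW m m2.
have m0 : 0 < m%:R :> R by rewrite ltr0n ltnW.
have lm : ln 2 <= ln m%:R :> R by rewrite ler_ln ?posrE // ler_nat.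
have lm0 : 0 < ln m%:R :> R by exact: lt_le_trans lm.
pose T := m%:R `^ (- s) * ln m%:R `^ be.
have T0 : 0 < T by rewrite mulr_gt0 // powR_gt0.
rewrite -/s -/T.
case: (ltP m%:R D0) => mD.
  apply: le_trans (H2 f fW m m2 mD) _; rewrite lee_fin ler_pM2r // lerDl.
  by rewrite !mulr_ge0 ?(ltW C10) ?powR_ge0.
pose VV N : R := 2 ^+ N * N.+1%:R ^+ d.
have exN : exists N, D0 * VV N <= m%:R.
  by exists 0%N; rewrite /VV expr0 mul1r expr1n mulr1.
have ubN N : D0 * VV N <= m%:R -> (N <= m)%N.
  move=> h; apply: ltnW; apply: leq_trans (ltn_expl N (isT : (1 < 2)%N)) _.
  rewrite -(ler_nat R) natrX; apply: le_trans h.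
  rewrite /VV mulrCA ler_peMr ?exprn_ge0 //.
  by rewrite -[X in X <= _]mulr1 ler_pM // -natrX ler1n expn_gt0.
case: (ex_maxnP exN ubN) => N hN maxN.
have V0 : 0 < VV N by rewrite mulr_gt0 ?exprn_gt0.
have mV : m%:R < D1 * VV N.
  have h : m%:R < D0 * VV N.+1.
    by rewrite ltNge; apply/negP => /maxN; rewrite ltnn.
  apply: (lt_le_trans h); rewrite /D1 -mulrA ler_pM2l // /VV exprS [2 ^+ d.+1]exprS.
  have : N.+2%:R ^+ d <= 2 ^+ d * N.+1%:R ^+ d :> R.
    by rewrite -exprMn lerXn2r ?nnegrE ?mulr_ge0 // -natrM ler_nat succ_succ_leq.
  set u : R := N.+2%:R ^+ d; set u' : R := N.+1%:R ^+ d => uu.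
  have -> : 2 * 2 ^+ d * (2 ^+ N * u') = 2 * 2 ^+ N * (2 ^+ d * u') by ring.
  by rewrite ler_pM2l // mulr_gt0 // exprn_gt0.
have VN : VV N <= 2 ^+ (d.+1 * N).
  rewrite /VV mulSn exprD ler_pM2l ?exprn_gt0 // mulnC exprM.
  by rewrite lerXn2r ?nnegrE ?exprn_ge0 // -natrX ler_nat ltn_expl.
have [t ht1 ht2] := H1 f fW N (VV N) V0 VN.
have tm : (size t <= m)%N.
  rewrite -(ler_nat R); apply: le_trans ht1 _; apply: le_trans hN.
  rewrite /D0 mulrDl mul1r [_^-1 * _]mulrC lerD2r.
  apply: le_trans (_ : \sum_(n < N) 2 ^+ n * N.+1%:R ^+ d <= _).
    apply: ler_sum => n _; apply: le_trans (size_layer R d n) _.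
    rewrite ler_pM2l ?exprn_gt0 // lerXn2r ?nnegrE // ler_nat.
    exact: ltnW (ltn_ord n).
  rewrite -mulr_suml /VV ler_pM2r ?exprn_gt0 //.
  have := subrX1 (2 : R) N; have -> : 2 - 1 = 1 :> R by ring.
  rewrite mul1r => <-; lra.
apply: le_trans (sigma_le tm ht2) _; rewrite lee_fin.
apply: le_trans (_ : C1 * (D1 `^ s * (2 / ln 2) `^ be) * T <= _); last first.
  by rewrite ler_pM2r // lerDr ltW.
rewrite -[X in _ <= X]mulrA ler_pM2l //.
have N1 : N.+1%:R <= 2 / ln 2 * ln m%:R :> R.
  rewrite mulrAC ler_pdivlMr // -natr1 mulrDl mul1r.
  have : N%:R * ln 2 <= ln m%:R :> R.
    rewrite mulr_natl -lnXn // ler_ln ?posrE ?exprn_gt0 //.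
    apply: le_trans hN; rewrite /VV mulrCA ler_peMr ?exprn_ge0 //.
    by rewrite -[X in X <= _]mulr1 ler_pM // -natrX ler1n expn_gt0.
  lra.
have N0 : 0 < N.+1%:R :> R by rewrite ltr0n.
have -> : 2 `^ (- al * N%:R) = VV N `^ (- al) * N.+1%:R `^ (al * d%:R).
  rewrite /VV powRM ?exprn_ge0 // -!powR_mulrn // -!powRrM.
  rewrite -mulrA -powRD_gt0 // (_ : d%:R * - al + al * d%:R = 0); last by ring.
  by rewrite powRr0 mulr1; congr powR; ring.
have -> : VV N `^ (- al) * N.+1%:R `^ (al * d%:R) * VV N `^ (- 2^-1) * N.+1%:R `^ (e + 2^-1) =
   VV N `^ (- s) * N.+1%:R `^ be.
  have -> : - s = - al + - 2^-1 by rewrite /s; ring.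
  have -> : be = al * d%:R + (e + 2^-1) by rewrite /be /e; ring.
  by rewrite (powRD_gt0 (- al)) // (powRD_gt0 (al * d%:R)) //; ring.
have -> : D1 `^ s * (2 / ln 2) `^ be * T =
   (D1 `^ s * m%:R `^ (- s)) * ((2 / ln 2) `^ be * ln m%:R `^ be).
  by rewrite /T; ring.
apply: ler_pM; rewrite ?powR_ge0 //.
  rewrite !powRN ler_pdivlMr ?powR_gt0 // mulrC ler_pdivrMr ?powR_gt0 //.
  rewrite -powRM ?(ltW D10) ?(ltW V0) // ge0_ler_powR ?nnegrE ?(ltW s0) ?(ltW m0) ?(ltW mV) //.
  by rewrite mulr_ge0 // ltW.
rewrite -powRM ?(ltW lm0) ?divr_ge0 ?(ltW l2) // ge0_ler_powR ?nnegrE ?(ltW N0) //.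
by rewrite mulr_ge0 ?divr_ge0 ?(ltW l2) ?(ltW lm0).
Qed.

End Assembly.

(** Only the inclusion of unit balls is needed, so Young's inequality [t^2 <= t^q / p + 1 / p'] with
    [p = q / 2] is integrated against the probability measure; [q = 2] is set aside because then
    [p = 1]. *)
Lemma Lqnorm_le2 (R : realType) d (q : R) (phi : Rn R d -> R[i]) :
  Cmeasurable phi -> 2 <= q -> (Lqnorm q phi <= 1)%E -> (Lqnorm 2 phi <= 1)%E.
Proof.
move=> mphi q2 h.
have q0 : 0 < q by lra.
have mn := measurable_normc mphi.
set mu := torus_measure R d.
have I1 : (\int[mu]_x (normc (phi x) `^ q)%:E <= 1)%E.
  have E : (Lqnorm q phi `^ q = \int[mu]_x (normc (phi x) `^ q)%:E)%E.
    rewrite /Lqnorm poweR_Lnorm ?gt_eqF //; apply: eq_integral => x _ /=.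
    by rewrite ger0_norm ?normc_ge0.
  rewrite -E -(poweR1r q); apply: gt0_ler_poweR => //; first exact: ltW.
    by rewrite in_itv /= leey andbT; exact: Lnorm_ge0.
  by rewrite in_itv /= leey andbT.
have I2 : (\int[mu]_x (normc (phi x) `^ 2)%:E <= 1)%E.
  move: q2; rewrite le_eqVlt => /orP[/eqP q2E|q2]; first by rewrite q2E.
  pose p := q / 2; pose p' := (1 - p^-1)^-1.
  have p1 : 1 < p by rewrite ltr_pdivlMr ?mul1r.
  have p0 : 0 < p by lra.
  have pi1 : p^-1 < 1 by rewrite invf_lt1.
  have p'0 : 0 < p' by rewrite invr_gt0 subr_gt0.
  have pp : p^-1 + p'^-1 = 1 by rewrite invrK; ring.
  have young x : normc (phi x) `^ 2 <= p^-1 * normc (phi x) `^ q + p'^-1.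
    have := conjugate_powR (powR_ge0 (normc (phi x)) 2) ler01 p0 p'0 pp.
    rewrite mulr1 powR1 -powRrM mul1r.
    by rewrite (_ : 2 * p = q) 1?[_ / p]mulrC // /p; field.
  apply: le_trans (_ : \int[mu]_x ((p^-1)%:E * (normc (phi x) `^ q)%:E + (p'^-1)%:E) <= _)%E.
    apply: ge0_le_integral => //.
    - by move=> x _; rewrite lee_fin powR_ge0.
    - apply/measurable_EFinP.
      by apply: (@measurableT_comp _ _ _ _ _ _ (fun t : R => t `^ 2)) => //; exact: measurable_powR.
    - apply: emeasurable_funD => //; apply: emeasurable_funM => //; apply/measurable_EFinP.
      by apply: (@measurableT_comp _ _ _ _ _ _ (fun t : R => t `^ q)) => //; exact: measurable_powR.
    - by move=> x _; rewrite -EFinM -EFinD lee_fin young.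
  have mq : measurable_fun setT (fun x => (normc (phi x) `^ q)%:E).
    apply/measurable_EFinP.
    by apply: (@measurableT_comp _ _ _ _ _ _ (fun t : R => t `^ q)) => //; exact: measurable_powR.
  rewrite ge0_integralD //; last 3 first.
  - by move=> x _; rewrite -EFinM lee_fin mulr_ge0 ?powR_ge0 // invr_ge0 ltW.
  - exact: emeasurable_funM.
  - by move=> x _; rewrite lee_fin invr_ge0 ltW.
  rewrite ge0_integralZl ?lee_fin ?invr_ge0 ?(ltW p0) //; last first.
    by move=> x _; rewrite lee_fin powR_ge0.
  rewrite (integral_torus_cst d p'^-1).
  apply: le_trans (_ : (p^-1)%:E * 1 + (p'^-1)%:E <= _)%E.
    by apply: leeD => //; apply: lee_wpmul2l => //; rewrite lee_fin invr_ge0 ltW.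
  by rewrite mule1 -EFinD pp.
rewrite /Lqnorm unlock /=.
have -> : (\int[mu]_x (`|(normc (phi x))%:E| `^ 2) = \int[mu]_x ((normc (phi x)) `^ 2)%:E)%E.
  by apply: eq_integral => x _; rewrite /= ger0_norm ?normc_ge0.
rewrite -(poweR1r 2^-1); apply: gt0_ler_poweR => //.
  rewrite in_itv /= leey andbT.
  by apply: integral_ge0 => x _; rewrite lee_fin powR_ge0.
by rewrite in_itv /= leey andbT.
Qed.

Theorem theorem1p3 (R : realType) (d : nat) (q r : R) (hd : (1 <= d)%N) :
  let eta : R := q^-1 - 2^-1 in
  (1 < q <= 2 -> q^-1 < r ->
     lesssim (fun m => sigma_class m (@W R d r q))
       (fun m => m%:R `^ (- r + eta) *
                 ln m%:R `^ ((d%:R - 1) * (r - 2 * eta) + 2^-1)))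
  /\
  (2 <= q -> 2^-1 < r ->
     lesssim (fun m => sigma_class m (@W R d r q))
       (fun m => m%:R `^ (- r) * ln m%:R `^ (r * (d%:R - 1) + 2^-1))).
Proof.
case: d hd => // d _ eta.
have dE : d.+1%:R - 1 = d%:R :> R by rewrite -natr1 addrK.
split=> [q12 rq|q2 r2].
  have [C C0 H] := sigma_W_le d q12 rq.
  exists C => // m m2; apply: ge_ereal_sup => _ [f fW <-].
  rewrite dE.
  have -> : - r + eta = - (r - q^-1 + 2^-1) by rewrite /eta; ring.
  have -> : r - 2 * eta = r - q^-1 + 1 - q^-1 by rewrite /eta; move: q^-1 => u; field.
  exact: H.
have q22 : 1 < (2 : R) <= 2 by rewrite lexx ltr1n.
have [C C0 H] := sigma_W_le d q22 r2.
exists C => // m m2; apply: ge_ereal_sup => _ [f [phi [mphi pphi phi1 ->]] <-].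
rewrite dE.
have -> : - r = - (r - 2^-1 + 2^-1) by rewrite subrK.
have -> : r * d%:R + 2^-1 = d%:R * (r - 2^-1 + 1 - 2^-1) + 2^-1 by field.
apply: H => //; exists phi; split => //.
exact: Lqnorm_le2 mphi q2 phi1.
Qed.
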